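(* Let $\mathcal{C}$ be a fiat $2$-category, $\mathbf{M}$ a transitive $2$-representation of $\mathcal{C}$, $\mathtt{i}$ an object of $\mathcal{C}$ and $N\in\mathbf{M}(\mathtt{i})$ a non-zero object. Let $A^N=\underline{\mathrm{Hom}}(N,N)$, a coalgebra $1$-morphism in $\underline{\mathcal{C}}(\mathtt{i},\mathtt{i})$. Then the functor $$\Theta\colon \coprod_{\mathtt{j}\in\mathcal{C}}\mathbf{M}(\mathtt{j})\to \mathrm{comod}_{\underline{\mathcal{C}}}(A^N),\qquad M\mapsto \underline{\mathrm{Hom}}(N,M),$$ gives rise to an equivalence of $2$-representations of $\mathcal{C}$ between $\underline{\mathbf{M}}$ and $\mathrm{comod}_{\underline{\mathcal{C}}}(A^N)$. This equivalence restricts to an equivalence of $2$-representations of $\mathcal{C}$ between $\mathbf{M}$ and $\mathrm{inj}_{\underline{\mathcal{C}}}(A^N)$.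
   Context: Fix an algebraically closed field $\mathbb{k}$; all ($2$-)categories and ($2$-)functors are $\mathbb{k}$-linear. Composition of $1$-morphisms is written $\circ$ or by juxtaposition. Finitary and fiat $2$-categories. A category is finitary if it is additive, $\mathbb{k}$-linear, has split idempotents, finitely many isomorphism classes of indecomposable objects and finite dimensional morphism spaces. A $2$-category $\mathcal{C}$ is finitary if it has finitely many objects, every $\mathcal{C}(\mathtt{i},\mathtt{j})$ is finitary, horizontal composition is additive and $\mathbb{k}$-linear, and every identity $1$-morphism $\mathbb{1}_{\mathtt{i}}$ is indecomposable. It is fiat if moreover it has a weak involution ${}^*\colon\mathcal{C}\to\mathcal{C}^{\mathrm{co,op}}$ (reversing both $1$- and $2$-morphisms) such that for all $\mathrm{F}\in\mathcal{C}(\mathtt{i},\mathtt{j})$ there are $2$-morphisms $\alpha\colon\mathrm{F}\mathrm{F}^*\to\mathbb{1}_{\mathtt{j}}$, $\beta\colon\mathbb{1}_{\mathtt{i}}\to\mathrm{F}^*\mathrm{F}$ satisfying the triangle (zig-zag) identities of an adjunction. $2$-representations. A (finitary) $2$-representation $\mathbf{M}$ of $\mathcal{C}$ is a strict $2$-functor from $\mathcal{C}$ to the $2$-category of (finitary) categories, linear functors and natural transformations; write $\mathrm{F}X=\mathbf{M}(\mathrm{F})X$. Morphisms of $2$-representations are $2$-natural transformations (commuting with the action up to coherent natural isomorphism); such a morphism is an equivalence if each of its components is an equivalence of categories. A finitary $2$-representation $\mathbf{M}$ is transitive if for every $\mathtt{i}$ and every non-zero $X\in\mathbf{M}(\mathtt{i})$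 the $2$-subrepresentation given by the additive closure of all $\mathrm{F}X$ ($\mathrm{F}$ running over all $1$-morphisms of $\mathcal{C}$) is equivalent to $\mathbf{M}$. Injective abelianization. For a finitary category $\mathcal{A}$, objects of $\underline{\mathcal{A}}$ are tuples $(X,k,Y_i,f_i)_{i\ge1}$ with $k\in\mathbb{Z}_{\ge0}$, $X,Y_i\in\mathcal{A}$, $f_i\colon X\to Y_i$ and $Y_i=0$ for $i>k$. Morphisms to $(X',k',Y_i',f_i')$ are tuples $(g\colon X\to X',\,h_{i,j}\colon Y_i\to Y_j')$ with $f_i'g=\sum_jh_{j,i}f_j$ for all $i$, modulo those tuples for which there are $q_i\colon Y_i\to X'$ with $\sum_iq_if_i=g$; composition is $(g'g,\sum_kh'_{k,j}h_{i,k})$. This category is abelian, and $X\mapsto(X,0,0,0)$ identifies $\mathcal{A}$ with the injective objects of $\underline{\mathcal{A}}$. The $2$-category $\underline{\mathcal{C}}$ has the objects of $\mathcal{C}$, $\underline{\mathcal{C}}(\mathtt{i},\mathtt{j})=\underline{\mathcal{C}(\mathtt{i},\mathtt{j})}$, and composition $(\mathrm{F},k,\mathrm{G}_i,\alpha_i)\circ(\mathrm{F}',k',\mathrm{G}_i',\alpha_i')=(\mathrm{F}\mathrm{F}',k+k',\mathrm{H}_i,\beta_i)$ with $\mathrm{H}_i=\mathrm{F}\mathrm{G}'_i$, $\beta_i=\mathrm{id}_{\mathrm{F}}\circ_0\alpha'_i$ for $1\le i\le k'$, and $\mathrm{H}_i=\mathrm{G}_{i-k'}\mathrm{F}'$,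 $\beta_i=\alpha_{i-k'}\circ_0\mathrm{id}_{\mathrm{F}'}$ for $k'<i\le k'+k$, zero otherwise; horizontal composition of $2$-morphisms is component-wise. The $2$-representation $\underline{\mathbf{M}}$ is given by $\underline{\mathbf{M}}(\mathtt{i})=\underline{\mathbf{M}(\mathtt{i})}$; $\mathcal{C}$ acts component-wise, and $\underline{\mathcal{C}}$ acts by the same formula as for composition, with the second tuple replaced by an object of $\underline{\mathbf{M}(\mathtt{i})}$. Internal homs. For $N\in\mathbf{M}(\mathtt{i})$ and $M\in\mathbf{M}(\mathtt{j})$, the assignment $\mathrm{F}\mapsto\mathrm{Hom}_{\mathbf{M}(\mathtt{j})}(M,\mathrm{F}N)$, $\mathrm{F}\in\mathcal{C}(\mathtt{i},\mathtt{j})$, extends uniquely up to isomorphism to a left exact functor from $\underline{\mathcal{C}}(\mathtt{i},\mathtt{j})$ to finite dimensional vector spaces. This functor is representable, and $\underline{\mathrm{Hom}}(N,M)\in\underline{\mathcal{C}}(\mathtt{i},\mathtt{j})$ denotes the representing object, so $\mathrm{Hom}_{\mathbf{M}(\mathtt{j})}(M,\mathrm{F}N)\cong\mathrm{Hom}_{\underline{\mathcal{C}}(\mathtt{i},\mathtt{j})}(\underline{\mathrm{Hom}}(N,M),\mathrm{F})$ for $\mathrm{F}\in\mathcal{C}(\mathtt{i},\mathtt{j})$; the analogous isomorphism with $\mathrm{Hom}_{\underline{\mathbf{M}}(\mathtt{j})}(M,\mathrm{F}N)$ on the left holds for $\mathrm{F}\in\underline{\mathcal{C}}(\mathtt{i},\mathtt{j})$.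 Let $\mathrm{coev}_{N,M}\colon M\to\underline{\mathrm{Hom}}(N,M)N$ correspond to $\mathrm{id}_{\underline{\mathrm{Hom}}(N,M)}$. Coalgebra $1$-morphisms. A coalgebra $1$-morphism in $\underline{\mathcal{C}}$ is $A\in\underline{\mathcal{C}}(\mathtt{i},\mathtt{i})$ with comultiplication $A\to A\circ A$ and counit $A\to\mathbb{1}_{\mathtt{i}}$ that are coassociative and counital. On $A^N=\underline{\mathrm{Hom}}(N,N)$ the comultiplication corresponds to $N\to A^NN\to A^NA^NN$ (iterated $\mathrm{coev}_{N,N}$) and the counit to $\mathrm{id}_N$. Right $A$-comodules are $1$-morphisms $X\in\coprod_{\mathtt{j}}\underline{\mathcal{C}}(\mathtt{i},\mathtt{j})$ with a coassociative, counital coaction $X\to X\circ A$; they form the category $\mathrm{comod}_{\underline{\mathcal{C}}}(A)$, whose full subcategory of injective objects is $\mathrm{inj}_{\underline{\mathcal{C}}}(A)$. Both are $2$-representations of $\mathcal{C}$ via left composition (the value at $\mathtt{j}$ being the comodules in $\underline{\mathcal{C}}(\mathtt{i},\mathtt{j})$). The right $A^N$-coaction on $\underline{\mathrm{Hom}}(N,M)$ corresponds to $M\to\underline{\mathrm{Hom}}(N,M)N\to\underline{\mathrm{Hom}}(N,M)A^NN$. The functor $\Theta$ is extended to $\coprod_{\mathtt{j}}\underline{\mathbf{M}}(\mathtt{j})$ as the left exact extension, unique up to isomorphism. *)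

(* Defs.v *)
From HB Require Import structures.
From mathcomp Require Import all_boot all_algebra.
From mathcomp Require Import boolp.

Set Implicit Arguments.
Unset Strict Implicit.
Unset Printing Implicit Defensive.

Import GRing.Theory.
Local Open Scope ring_scope.
Local Open Scope quotient_scope.

Declare Scope lincat_scope.
Delimit Scope lincat_scope with lincat.
Local Open Scope lincat_scope.

Record lincat (k : fieldType) := LinCat {
  ob :> Type;
  mor : ob -> ob -> lmodType k;
  idmor : forall X, mor X X;
  cmp : forall X Y Z, mor Y Z -> mor X Y -> mor X Z;
  cmp_linl : forall X Y Z (f : mor X Y), linear (fun g : mor Y Z => cmp g f);
  cmp_linr : forall X Y Z (g : mor Y Z), linear (fun f : mor X Y => cmp g f);
  cmpA : forall X Y Z W (h : mor Z W) (g : mor Y Z) (f : mor X Y),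
    cmp h (cmp g f) = cmp (cmp h g) f;
  cmp1l : forall X Y (f : mor X Y), cmp (idmor Y) f = f;
  cmp1r : forall X Y (f : mor X Y), cmp f (idmor X) = f }.

Arguments mor {k l} X Y.
Arguments idmor {k l} X.
Arguments cmp {k l X Y Z} g f.

Notation "g \oc f" := (cmp g f) (at level 40, left associativity) : lincat_scope.

Section LinCatTheory.
Variables (k : fieldType) (A : lincat k).
Implicit Types X Y Z W : A.

Lemma cmpDl X Y Z (g g' : mor Y Z) (f : mor X Y) :
  (g + g') \oc f = g \oc f + g' \oc f.
Proof. by have := cmp_linl f 1 g g'; rewrite !scale1r. Qed.

Lemma cmpDr X Y Z (g : mor Y Z) (f f' : mor X Y) :
  g \oc (f + f') = g \oc f + g \oc f'.
Proof. by have := cmp_linr g 1 f f'; rewrite !scale1r. Qed.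

Lemma cmp0l X Y Z (f : mor X Y) : (0 : mor Y Z) \oc f = 0.
Proof. by apply: (@addrI _ (0 \oc f)); rewrite -cmpDl !addr0. Qed.

Lemma cmp0r X Y Z (g : mor Y Z) : g \oc (0 : mor X Y) = 0.
Proof. by apply: (@addrI _ (g \oc 0)); rewrite -cmpDr !addr0. Qed.

Lemma cmpZl X Y Z a (g : mor Y Z) (f : mor X Y) : (a *: g) \oc f = a *: (g \oc f).
Proof. by have := cmp_linl f a g 0; rewrite cmp0l !addr0. Qed.

Lemma cmpZr X Y Z a (g : mor Y Z) (f : mor X Y) : g \oc (a *: f) = a *: (g \oc f).
Proof. by have := cmp_linr g a f 0; rewrite cmp0r !addr0. Qed.

Lemma cmpNl X Y Z (g : mor Y Z) (f : mor X Y) : (- g) \oc f = - (g \oc f).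
Proof. by rewrite -scaleN1r cmpZl scaleN1r. Qed.

Lemma cmpNr X Y Z (g : mor Y Z) (f : mor X Y) : g \oc (- f) = - (g \oc f).
Proof. by rewrite -scaleN1r cmpZr scaleN1r. Qed.

Lemma cmp_suml X Y Z (I : Type) (r : seq I) (P : pred I) (g : I -> mor Y Z)
    (f : mor X Y) :
  (\sum_(i <- r | P i) g i) \oc f = \sum_(i <- r | P i) (g i \oc f).
Proof.
by apply: (big_morph (fun g => g \oc f)) => [x y|]; rewrite ?cmpDl ?cmp0l.
Qed.

Lemma cmp_sumr X Y Z (I : Type) (r : seq I) (P : pred I) (g : mor Y Z)
    (f : I -> mor X Y) :
  g \oc (\sum_(i <- r | P i) f i) = \sum_(i <- r | P i) (g \oc f i).
Proof.
by apply: (big_morph (fun f => g \oc f)) => [x y|]; rewrite ?cmpDr ?cmp0r.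
Qed.

Record iso X Y := Iso {
  isomor :> mor X Y;
  isoV : mor Y X;
  isoVK : isoV \oc isomor = idmor X;
  isomK : isomor \oc isoV = idmor Y }.

Definition iso_id X : iso X X := Iso (cmp1l (idmor X)) (cmp1l (idmor X)).

Definition iso_sym X Y (u : iso X Y) : iso Y X := Iso (isomK u) (isoVK u).

Lemma iso_comp_subproof1 X Y Z (u : iso X Y) (v : iso Y Z) :
  (isoV u \oc isoV v) \oc (v \oc u) = idmor X.
Proof. by rewrite cmpA -(cmpA (isoV u)) isoVK cmp1r isoVK. Qed.
Definition iso_comp X Y Z (v : iso Y Z) (u : iso X Y) : iso X Z :=
  Iso (iso_comp_subproof1 u v) (iso_comp_subproof1 (iso_sym v) (iso_sym u)).

Lemma iso_moveL X Y Z (u : iso Y Z) (f : mor X Y) (g : mor X Z) :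
  u \oc f = g <-> f = isoV u \oc g.
Proof.
by split=> [<-|->]; rewrite cmpA ?isoVK ?isomK cmp1l.
Qed.

Lemma iso_moveR X Y Z (u : iso X Y) (f : mor Y Z) (g : mor X Z) :
  f \oc u = g <-> f = g \oc isoV u.
Proof.
by split=> [<-|->]; rewrite -cmpA ?isoVK ?isomK cmp1r.
Qed.

Lemma iso_injl X Y Z (u : iso Y Z) (f g : mor X Y) : u \oc f = u \oc g -> f = g.
Proof. by move/iso_moveL ->; rewrite cmpA isoVK cmp1l. Qed.

Lemma iso_injr X Y Z (u : iso X Y) (f g : mor Y Z) : f \oc u = g \oc u -> f = g.
Proof. by move/iso_moveR ->; rewrite -cmpA isomK cmp1r. Qed.

Definition eq_hom X Y (e : X = Y) : mor X Y :=
  match e in _ = Y' return mor X Y' with erefl => idmor X end.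

Definition is_zero X : Prop := idmor X = 0.

Definition is_biproduct n (Z : 'I_n -> A) (S : A) : Prop :=
  exists (s : forall a, mor (Z a) S) (r : forall a, mor S (Z a)),
    [/\ forall a, r a \oc s a = idmor (Z a),
        forall a b, a != b -> r a \oc s b = 0
      & \sum_a (s a \oc r a) = idmor S].

Definition is_biproduct2 X Y (S : A) : Prop :=
  exists (s1 : mor X S) (s2 : mor Y S) (r1 : mor S X) (r2 : mor S Y),
    [/\ r1 \oc s1 = idmor X, r2 \oc s2 = idmor Y, r1 \oc s2 = 0, r2 \oc s1 = 0
      & s1 \oc r1 + s2 \oc r2 = idmor S].

Definition indecomposable X : Prop :=
  ~ is_zero X /\ forall Y Z, is_biproduct2 Y Z X -> is_zero Y \/ is_zero Z.

Definition monomorphism X Y (m : mor X Y) : Prop :=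
  forall W (u v : mor W X), m \oc u = m \oc v -> u = v.

Definition injective_ob X : Prop :=
  forall Y Z (m : mor Y Z) (g : mor Y X), monomorphism m ->
    exists g' : mor Z X, g' \oc m = g.

Definition is_kernel X Y (f : mor X Y) K (i : mor K X) : Prop :=
  f \oc i = 0 /\
  forall W (g : mor W X), f \oc g = 0 -> exists! u : mor W K, i \oc u = g.

End LinCatTheory.

Arguments isoV {k A X Y}.

Definition finite_dimensional (k : fieldType) (V : lmodType k) : Prop :=
  exists n (b : 'I_n -> V), forall v, exists c : 'I_n -> k,
    v = \sum_a c a *: b a.

Definition finitary_cat (k : fieldType) (A : lincat k) : Prop :=
  [/\ (exists Z : A, is_zero Z) /\ (forall X Y : A, exists S, is_biproduct2 X Y S),
      forall (X : A) (e : mor X X), e \oc e = e ->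
        exists (Y : A) (r : mor X Y) (s : mor Y X), r \oc s = idmor Y /\ s \oc r = e,
      exists n (Z : 'I_n -> A), forall X : A, indecomposable X ->
        exists a, inhabited (iso X (Z a))
    & forall X Y : A, finite_dimensional (mor X Y)].

Record linfunctor (k : fieldType) (A B : lincat k) := LinFun {
  fo :> A -> B;
  fh : forall X Y, mor X Y -> mor (fo X) (fo Y);
  fh_lin : forall X Y, linear (@fh X Y);
  fh_id : forall X, fh (idmor X) = idmor (fo X);
  fh_cmp : forall X Y Z (g : mor Y Z) (f : mor X Y),
    fh (g \oc f) = fh g \oc fh f }.
Arguments fh {k A B} l {X Y} f.

Section LinFunTheory.
Variables (k : fieldType).

Lemma fhD (A B : lincat k) (F : linfunctor A B) X Y (f g : mor X Y) :
  fh F (f + g) = fh F f + fh F g.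
Proof. by have := fh_lin F 1 f g; rewrite !scale1r. Qed.

Lemma fh0 (A B : lincat k) (F : linfunctor A B) (X Y : A) :
  fh F (0 : mor X Y) = 0.
Proof. by apply: (@addrI _ (fh F 0)); rewrite -fhD !addr0. Qed.

Lemma fhZ (A B : lincat k) (F : linfunctor A B) (X Y : A) a (f : mor X Y) :
  fh F (a *: f) = a *: fh F f.
Proof. by have := fh_lin F a f 0; rewrite fh0 !addr0. Qed.

Lemma fh_sum (A B : lincat k) (F : linfunctor A B) (X Y : A) (I : Type) (r : seq I)
    (P : pred I) (f : I -> mor X Y) :
  fh F (\sum_(i <- r | P i) f i) = \sum_(i <- r | P i) fh F (f i).
Proof. by apply: (big_morph (fh F)) => [x y|]; rewrite ?fhD ?fh0. Qed.

Definition fh_iso (A B : lincat k) (F : linfunctor A B) X Y (u : iso X Y) :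
  iso (F X) (F Y).
Proof.
by exists (fh F u) (fh F (isoV u)); rewrite -fh_cmp ?isoVK ?isomK fh_id.
Defined.

Definition linfunctor_id (A : lincat k) : linfunctor A A.
Proof. by exists (fun X => X) (fun X Y f => f). Defined.

Definition linfunctor_comp (A B D : lincat k) (G : linfunctor B D) (F : linfunctor A B) :
  linfunctor A D.
Proof.
exists (fun X => G (F X)) (fun X Y f => fh G (fh F f)).
- by move=> X Y a f g; rewrite !fh_lin.
- by move=> X; rewrite !fh_id.
- by move=> X Y Z g f; rewrite !fh_cmp.
Defined.

Definition nat_isomorphic (A B : lincat k) (F G : linfunctor A B) : Prop :=
  exists t : forall X, iso (F X) (G X),
    forall X Y (f : mor X Y), t Y \oc fh F f = fh G f \oc t X.

Definition cat_equivalence (A B : lincat k) (F : linfunctor A B) : Prop :=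
  exists G : linfunctor B A,
    nat_isomorphic (linfunctor_comp G F) (linfunctor_id A) /\
    nat_isomorphic (linfunctor_comp F G) (linfunctor_id B).

Definition left_exact (A B : lincat k) (F : linfunctor A B) : Prop :=
  forall (X Y : A) (f : mor X Y) K (i : mor K X),
    is_kernel f i -> is_kernel (fh F f) (fh F i).

End LinFunTheory.

Section FullSub.
Variables (k : fieldType) (A : lincat k) (P : A -> Prop).

Definition fullsub : lincat k.
Proof.
exists {X : A | P X} (fun X Y => mor (sval X) (sval Y)) (fun X => idmor (sval X))
  (fun X Y Z g f => g \oc f).
- by move=> X Y Z f; apply: cmp_linl.
- by move=> X Y Z f; apply: cmp_linr.
- by move=> *; apply: cmpA.
- by move=> *; apply: cmp1l.
- by move=> *; apply: cmp1r.
Defined.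

End FullSub.

Record bifun (k : fieldType) (A B D : lincat k) := BiFun {
  bo :> A -> B -> D;
  bh : forall X X' Y Y', mor X X' -> mor Y Y' -> mor (bo X Y) (bo X' Y');
  bh_linl : forall X X' Y Y' (g : mor Y Y'),
    linear (fun f : mor X X' => bh f g);
  bh_linr : forall X X' Y Y' (f : mor X X'),
    linear (fun g : mor Y Y' => bh f g);
  bh_id : forall X Y, bh (idmor X) (idmor Y) = idmor (bo X Y);
  bh_cmp : forall X X' X'' Y Y' Y'' (f' : mor X' X'') (f : mor X X')
      (g' : mor Y' Y'') (g : mor Y Y'),
    bh (f' \oc f) (g' \oc g) = bh f' g' \oc bh f g }.
Arguments bh {k A B D} b {X X' Y Y'} f g.

Section BiFunTheory.
Variables (k : fieldType) (A B D : lincat k) (T : bifun A B D).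
Implicit Types (X : A) (Y : B).

Lemma bhDl X X' Y Y' (f f' : mor X X') (g : mor Y Y') :
  bh T (f + f') g = bh T f g + bh T f' g.
Proof. by have := bh_linl T g 1 f f'; rewrite !scale1r. Qed.

Lemma bhDr X X' Y Y' (f : mor X X') (g g' : mor Y Y') :
  bh T f (g + g') = bh T f g + bh T f g'.
Proof. by have := bh_linr T f 1 g g'; rewrite !scale1r. Qed.

Lemma bh0l X X' Y Y' (g : mor Y Y') : bh T (0 : mor X X') g = 0.
Proof. by apply: (@addrI _ (bh T 0 g)); rewrite -bhDl !addr0. Qed.

Lemma bh0r X X' Y Y' (f : mor X X') : bh T f (0 : mor Y Y') = 0.
Proof. by apply: (@addrI _ (bh T f 0)); rewrite -bhDr !addr0. Qed.

Lemma bhZl X X' Y Y' a (f : mor X X') (g : mor Y Y') :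
  bh T (a *: f) g = a *: bh T f g.
Proof. by have := bh_linl T g a f 0; rewrite bh0l !addr0. Qed.

Lemma bhZr X X' Y Y' a (f : mor X X') (g : mor Y Y') :
  bh T f (a *: g) = a *: bh T f g.
Proof. by have := bh_linr T f a g 0; rewrite bh0r !addr0. Qed.

Lemma bh_suml X X' Y Y' (I : Type) (r : seq I) (P : pred I) (f : I -> mor X X')
    (g : mor Y Y') :
  bh T (\sum_(i <- r | P i) f i) g = \sum_(i <- r | P i) bh T (f i) g.
Proof.
by apply: (big_morph (fun f => bh T f g)) => [x y|]; rewrite ?bhDl ?bh0l.
Qed.

Lemma bh_sumr X X' Y Y' (I : Type) (r : seq I) (P : pred I) (f : mor X X')
    (g : I -> mor Y Y') :
  bh T f (\sum_(i <- r | P i) g i) = \sum_(i <- r | P i) bh T f (g i).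
Proof.
by apply: (big_morph (fun g => bh T f g)) => [x y|]; rewrite ?bhDr ?bh0r.
Qed.

Definition bh_iso X X' Y Y' (u : iso X X') (v : iso Y Y') :
  iso (T X Y) (T X' Y').
Proof.
by exists (bh T u v) (bh T (isoV u) (isoV v));
   rewrite -bh_cmp ?isoVK ?isomK bh_id.
Defined.

Lemma bh_split X X' Y Y' (f : mor X X') (g : mor Y Y') :
  bh T f g = bh T (idmor X') g \oc bh T f (idmor Y).
Proof. by rewrite -bh_cmp cmp1l cmp1r. Qed.

Lemma bh_split' X X' Y Y' (f : mor X X') (g : mor Y Y') :
  bh T f g = bh T f (idmor Y') \oc bh T (idmor X) g.
Proof. by rewrite -bh_cmp cmp1l cmp1r. Qed.

Lemma bh_cmpl X X' X'' Y (f' : mor X' X'') (f : mor X X') :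
  bh T (f' \oc f) (idmor Y) = bh T f' (idmor Y) \oc bh T f (idmor Y).
Proof. by rewrite -bh_cmp cmp1l. Qed.

Lemma bh_cmpr X Y Y' Y'' (g' : mor Y' Y'') (g : mor Y Y') :
  bh T (idmor X) (g' \oc g) = bh T (idmor X) g' \oc bh T (idmor X) g.
Proof. by rewrite -bh_cmp cmp1l. Qed.

Definition bh_fix X : linfunctor B D.
Proof.
exists (fun Y => T X Y) (fun Y Y' g => bh T (idmor X) g).
- by move=> Y Y' a g g'; rewrite bh_linr.
- by move=> Y; rewrite bh_id.
- by move=> Y Y' Y'' g' g; rewrite bh_cmpr.
Defined.

End BiFunTheory.

(* Only the objects Y_1, ..., Y_k of a tuple are recorded; the objects Y_i with
   i > k are zero and carry no information. *)
Record abob (k : fieldType) (A : lincat k) := AbOb {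
  abX : A;
  abk : nat;
  abY : 'I_abk -> A;
  abf : forall a, mor abX (abY a) }.
Arguments abY {k A} a0 a.
Arguments abf {k A} a0 a.

Record abpre (k : fieldType) (A : lincat k) (P Q : abob A) := AbPre {
  abg : mor (abX P) (abX Q);
  abh : forall a b, mor (abY P a) (abY Q b);
  abP : forall b, abf Q b \oc abg = \sum_a abh a b \oc abf P a }.

Section AbHom.
Variables (k : fieldType) (A : lincat k).
Implicit Types P Q R S : abob A.

Definition ab_null (P Q : abob A) (g : mor (abX P) (abX Q)) : Prop :=
  exists q : forall a, mor (abY P a) (abX Q), \sum_a q a \oc abf P a = g.

Lemma ab_nullD P Q (g g' : mor (abX P) (abX Q)) :
  ab_null g -> ab_null g' -> ab_null (g + g').
Proof.
move=> [q <-] [q' <-]; exists (fun a => q a + q' a).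
by rewrite -big_split; apply: eq_bigr => a _; rewrite cmpDl.
Qed.

Lemma ab_nullZ P Q (c : k) (g : mor (abX P) (abX Q)) :
  ab_null g -> ab_null (c *: g).
Proof.
move=> [q <-]; exists (fun a => c *: q a).
by rewrite scaler_sumr; apply: eq_bigr => a _; rewrite cmpZl.
Qed.

Lemma ab_null0 P Q : ab_null (0 : mor (abX P) (abX Q)).
Proof. by exists (fun=> 0); rewrite big1 // => a _; rewrite cmp0l. Qed.

Lemma ab_nullN P Q (g : mor (abX P) (abX Q)) : ab_null g -> ab_null (- g).
Proof. by rewrite -scaleN1r; apply: ab_nullZ. Qed.

Lemma ab_null_cmpl P Q R (f : mor (abX Q) (abX R)) (g : mor (abX P) (abX Q)) :
  ab_null g -> ab_null (f \oc g).
Proof.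
move=> [q <-]; exists (fun a => f \oc q a).
by rewrite cmp_sumr; apply: eq_bigr => a _; rewrite cmpA.
Qed.

Lemma ab_null_cmpr P Q R (f : mor (abX Q) (abX R)) (g : abpre P Q) :
  ab_null f -> ab_null (f \oc abg g).
Proof.
move=> [q <-]; exists (fun a => \sum_b q b \oc abh g a b).
rewrite cmp_suml; under [RHS]eq_bigr => b _.
  rewrite -cmpA abP cmp_sumr; under eq_bigr => a _ do rewrite cmpA; over.
by rewrite exchange_big; apply: eq_bigr => a _; rewrite cmp_suml.
Qed.

(* The difference of two tuples (g, h) is null iff the difference of their
   first components is of the form \sum_a q_a f_a, whatever h is. *)
Definition ab_rel (P Q : abob A) : rel (abpre P Q) :=
  fun u v => `[< ab_null (abg u - abg v) >].

Lemma ab_relP P Q (u v : abpre P Q) :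
  reflect (ab_null (abg u - abg v)) (ab_rel u v).
Proof. exact: asboolP. Qed.

Lemma ab_rel_equiv P Q : equiv_class_of (@ab_rel P Q).
Proof.
split=> [u | u v | v u w].
- by apply/ab_relP; rewrite subrr; apply: ab_null0.
- by apply/ab_relP/ab_relP => /ab_nullN; rewrite opprB.
- move/ab_relP => uv /ab_relP vw; apply/ab_relP.
  by have := ab_nullD uv vw; rewrite addrA subrK.
Qed.

HB.instance Definition _ (P Q : abob A) := gen_eqMixin (abpre P Q).
HB.instance Definition _ (P Q : abob A) := gen_choiceMixin (abpre P Q).

Canonical ab_equiv P Q := EquivRelPack (@ab_rel_equiv P Q).

Definition abhom (P Q : abob A) := {eq_quot (@ab_rel P Q)}%qT.
HB.instance Definition _ P Q := Choice.on (abhom P Q).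
HB.instance Definition _ P Q := EqQuotient.on (abhom P Q).

Definition abcl P Q (u : abpre P Q) : abhom P Q := \pi u.

Lemma abcl_eq P Q (u v : abpre P Q) :
  ab_null (abg u - abg v) -> abcl u = abcl v.
Proof. by move=> uv; apply/eqmodP/ab_relP. Qed.

Lemma abcl_eqg P Q (u v : abpre P Q) : abg u = abg v -> abcl u = abcl v.
Proof. by move=> uv; apply: abcl_eq; rewrite uv subrr; apply: ab_null0. Qed.

Lemma abcl_repr P Q (u : abpre P Q) : ab_null (abg (repr (abcl u)) - abg u).
Proof. by apply/ab_relP/eqmodP; rewrite reprK. Qed.

Lemma abcl_ind P Q (R : abhom P Q -> Prop) :
  (forall u, R (abcl u)) -> forall x, R x.
Proof. by move=> Ru x; rewrite -[x]reprK; apply: Ru. Qed.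

Definition abpre_lin P Q (c : k) (u v : abpre P Q) : abpre P Q.
Proof.
exists (c *: abg u + abg v) (fun a b => c *: abh u a b + abh v a b) => b.
rewrite cmpDr cmpZr !abP scaler_sumr -big_split; apply: eq_bigr => a _ /=.
by rewrite cmpDl cmpZl.
Defined.

Definition abpre0 P Q : abpre P Q.
Proof.
exists 0 (fun a b => 0) => b; rewrite cmp0r big1 // => a _; exact: cmp0l.
Defined.

Definition abhom_add P Q (x y : abhom P Q) : abhom P Q :=
  abcl (abpre_lin 1 (repr x) (repr y)).
Definition abhom_opp P Q (x : abhom P Q) : abhom P Q :=
  abcl (abpre_lin (- 1) (repr x) (abpre0 P Q)).
Definition abhom_scale P Q (c : k) (x : abhom P Q) : abhom P Q :=
  abcl (abpre_lin c (repr x) (abpre0 P Q)).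

Lemma abcl_lin P Q (c : k) (u v : abpre P Q) :
  abcl (abpre_lin c (repr (abcl u)) (repr (abcl v))) = abcl (abpre_lin c u v).
Proof.
apply: abcl_eq => /=; rewrite opprD addrACA -scalerBr.
by apply: ab_nullD; [apply: ab_nullZ|]; apply: abcl_repr.
Qed.

Lemma abhom_addE P Q (u v : abpre P Q) :
  abhom_add (abcl u) (abcl v) = abcl (abpre_lin 1 u v).
Proof. exact: abcl_lin. Qed.

Lemma abhom_scaleE P Q (c : k) (u : abpre P Q) :
  abhom_scale c (abcl u) = abcl (abpre_lin c u (abpre0 P Q)).
Proof.
apply: abcl_eq => /=; rewrite !addr0 -scalerBr.
by apply: ab_nullZ; apply: abcl_repr.
Qed.

Lemma abhom_oppE P Q (u : abpre P Q) :
  abhom_opp (abcl u) = abcl (abpre_lin (- 1) u (abpre0 P Q)).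
Proof. exact: abhom_scaleE. Qed.

Section Zmod.
Variables P Q : abob A.

Lemma abhom_addA : associative (@abhom_add P Q).
Proof.
elim/abcl_ind => u; elim/abcl_ind => v; elim/abcl_ind => w.
by rewrite !abhom_addE; apply: abcl_eqg; rewrite /= !scale1r addrA.
Qed.
Lemma abhom_addC : commutative (@abhom_add P Q).
Proof.
elim/abcl_ind => u; elim/abcl_ind => v.
by rewrite !abhom_addE; apply: abcl_eqg; rewrite /= !scale1r addrC.
Qed.
Lemma abhom_add0 : left_id (abcl (abpre0 P Q)) (@abhom_add P Q).
Proof.
elim/abcl_ind => u.
by rewrite !abhom_addE; apply: abcl_eqg; rewrite /= !scale1r add0r.
Qed.
Lemma abhom_addN :
  left_inverse (abcl (abpre0 P Q)) (@abhom_opp P Q) (@abhom_add P Q).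
Proof.
elim/abcl_ind => u.
rewrite abhom_oppE !abhom_addE; apply: abcl_eqg => /=.
by rewrite scale1r addr0 scaleN1r addNr.
Qed.

HB.instance Definition _ :=
  GRing.isZmodule.Build (abhom P Q) abhom_addA abhom_addC abhom_add0 abhom_addN.

Lemma abhom_scaleA c d (x : abhom P Q) :
  abhom_scale c (abhom_scale d x) = abhom_scale (c * d) x.
Proof.
elim/abcl_ind: x => u.
by rewrite !abhom_scaleE; apply: abcl_eqg; rewrite /= !addr0 scalerA.
Qed.
Lemma abhom_scale1 : left_id 1 (@abhom_scale P Q).
Proof.
elim/abcl_ind => u.
by rewrite !abhom_scaleE; apply: abcl_eqg; rewrite /= !addr0 scale1r.
Qed.
Lemma abhom_scaleDr : right_distributive (@abhom_scale P Q) +%R.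
Proof.
move=> c; elim/abcl_ind => u; elim/abcl_ind => v.
rewrite [_ + _]abhom_addE !abhom_scaleE [RHS]abhom_addE; apply: abcl_eqg.
by rewrite /= !addr0 !scale1r scalerDr.
Qed.
Lemma abhom_scaleDl (x : abhom P Q) :
  {morph (@abhom_scale P Q)^~ x : c d / c + d}.
Proof.
elim/abcl_ind: x => u c d /=.
rewrite !abhom_scaleE [RHS]abhom_addE; apply: abcl_eqg.
by rewrite /= !addr0 !scale1r scalerDl.
Qed.

HB.instance Definition _ :=
  GRing.Zmodule_isLmodule.Build k (abhom P Q)
    abhom_scaleA abhom_scale1 abhom_scaleDr abhom_scaleDl.

Lemma abcl_linE (c : k) (u v : abpre P Q) :
  c *: abcl u + abcl v = abcl (abpre_lin c u v).
Proof.
rewrite [c *: _]abhom_scaleE [LHS]abhom_addE; apply: abcl_eqg => /=.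
by rewrite scale1r addr0.
Qed.

End Zmod.

Definition abpre_id P : abpre P P.
Proof.
exists (idmor (abX P))
  (fun a b => if a =P b is ReflectT e then eq_hom (congr1 (abY P) e) else 0) => b.
rewrite cmp1r (bigD1 b) //= big1 => [|a ab]; last first.
  by case: eqP => [e | _]; [rewrite e eqxx in ab | rewrite cmp0l].
case: eqP => // e; rewrite addr0.
by rewrite (Prop_irrelevance e erefl) /= cmp1l.
Defined.

Definition abpre_cmp P Q R (v : abpre Q R) (u : abpre P Q) : abpre P R.
Proof.
exists (abg v \oc abg u) (fun a c => \sum_b abh v b c \oc abh u a b) => c.
rewrite cmpA abP cmp_suml; under eq_bigr => b _.
  rewrite -cmpA abP cmp_sumr; under eq_bigr => a _ do rewrite cmpA; over.
by rewrite exchange_big; apply: eq_bigr => a _; rewrite cmp_suml.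
Defined.

Definition abcmp P Q R (y : abhom Q R) (x : abhom P Q) : abhom P R :=
  abcl (abpre_cmp (repr y) (repr x)).

Lemma abcmpE P Q R (v : abpre Q R) (u : abpre P Q) :
  abcmp (abcl v) (abcl u) = abcl (abpre_cmp v u).
Proof.
apply: abcl_eq => /=; have nu := abcl_repr u; have nv := abcl_repr v.
have := ab_nullD (ab_null_cmpr (repr (abcl u)) nv) (ab_null_cmpl (abg v) nu).
by rewrite cmpDl cmpDr cmpNl cmpNr addrA subrK.
Qed.

Definition ab : lincat k.
Proof.
exists (abob A) (fun P Q => abhom P Q : lmodType k) (fun P => abcl (abpre_id P))
  abcmp.
- move=> P Q R; elim/abcl_ind => u c; elim/abcl_ind => v; elim/abcl_ind => w.
  rewrite abcl_linE !abcmpE abcl_linE; apply: abcl_eqg => /=.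
  by rewrite cmpDl cmpZl.
- move=> P Q R; elim/abcl_ind => u c; elim/abcl_ind => v; elim/abcl_ind => w.
  rewrite abcl_linE !abcmpE abcl_linE; apply: abcl_eqg => /=.
  by rewrite cmpDr cmpZr.
- move=> P Q R S; elim/abcl_ind => u; elim/abcl_ind => v; elim/abcl_ind => w.
  by rewrite !abcmpE; apply: abcl_eqg => /=; rewrite cmpA.
- move=> P Q; elim/abcl_ind => u.
  by rewrite !abcmpE; apply: abcl_eqg => /=; rewrite cmp1l.
- move=> P Q; elim/abcl_ind => u.
  by rewrite !abcmpE; apply: abcl_eqg => /=; rewrite cmp1r.
Defined.

End AbHom.

Section AbEmbedding.
Variables (k : fieldType) (A : lincat k).

Definition ab_emb_ob (X : A) : ab A := @AbOb k A X 0 (fun=> X) (fun=> 0).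

Definition ab_emb_pre X Y (f : mor X Y) : abpre (ab_emb_ob X) (ab_emb_ob Y).
Proof. by exists f (fun _ _ => 0) => -[]. Defined.

Definition ab_emb : linfunctor A (ab A).
Proof.
exists ab_emb_ob (fun X Y f => abcl (ab_emb_pre f)).
- by move=> X Y a f g; rewrite abcl_linE; apply: abcl_eqg.
- by move=> X; apply: abcl_eqg.
- by move=> X Y Z g f; rewrite [RHS]abcmpE; apply: abcl_eqg.
Defined.

Definition ab_sel (P Q : abob A) (g : mor (abX P) (abX Q)) : Type :=
  forall b, {a : 'I_(abk P) & {u : mor (abY P a) (abY Q b) |
    abf Q b \oc g = u \oc abf P a}}.

Definition ab_sel_pre (P Q : abob A) (g : mor (abX P) (abX Q))
  (s : ab_sel g) : abpre P Q.
Proof.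
exists g (fun a b =>
  if a =P tag (s b) is ReflectT e
  then sval (tagged (s b)) \oc eq_hom (congr1 (abY P) e) else 0) => b.
rewrite (bigD1 (tag (s b))) //= big1 => [|a ab]; last first.
  by case: eqP => [e | _]; [rewrite e eqxx in ab | rewrite cmp0l].
case: eqP => // e; rewrite addr0.
rewrite (Prop_irrelevance e erefl) /= cmp1r.
by case: (s b) => a [u].
Defined.

Definition ab_iso (P Q : abob A) (w : iso (abX P) (abX Q))
  (s : ab_sel w) (t : ab_sel (P := Q) (Q := P) (isoV w)) : iso (P : ab A) (Q : ab A).
Proof.
exists (abcl (ab_sel_pre s)) (abcl (ab_sel_pre t)).
- by rewrite [LHS]abcmpE; apply: abcl_eqg; rewrite /= isoVK.
- by rewrite [LHS]abcmpE; apply: abcl_eqg; rewrite /= isomK.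
Defined.

End AbEmbedding.

Arguments ab_emb {k} A.

Section AbBiFun.
Variables (k : fieldType) (A B D : lincat k) (T : bifun A B D).
Implicit Types (P : abob A) (Q : abob B).

(* For P = (F, k, G) and Q = (F', k', G') the first k' entries of the composite
   are the F G'_b and the last k entries are the G_a F'. *)
Definition ab_bifun_Y P Q (s : 'I_(abk Q) + 'I_(abk P)) : D :=
  match s with
  | inl b => T (abX P) (abY Q b)
  | inr a => T (abY P a) (abX Q)
  end.

Definition ab_bifun_f P Q (s : 'I_(abk Q) + 'I_(abk P)) :
    mor (T (abX P) (abX Q)) (ab_bifun_Y s) :=
  match s with
  | inl b => bh T (idmor (abX P)) (abf Q b)
  | inr a => bh T (abf P a) (idmor (abX Q))
  end.

Definition ab_bifun_ob P Q : abob D :=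
  AbOb (fun c : 'I_(abk Q + abk P) => ab_bifun_f (split c)).

Definition ab_bifun_h P P' Q Q' (u : abpre P P') (v : abpre Q Q')
    (s : 'I_(abk Q) + 'I_(abk P)) (s' : 'I_(abk Q') + 'I_(abk P')) :
    mor (ab_bifun_Y s) (ab_bifun_Y s') :=
  match s, s' with
  | inl b, inl b' => bh T (abg u) (abh v b b')
  | inr a, inr a' => bh T (abh u a a') (abg v)
  | _, _ => 0
  end.

Lemma sum_split (V : zmodType) m n (F : 'I_m + 'I_n -> V) :
  \sum_(c < m + n) F (split c) = \sum_b F (inl b) + \sum_a F (inr a).
Proof.
rewrite big_split_ord; congr (_ + _); apply: eq_bigr => c _.
  by rewrite -[lshift _ _]/(unsplit (inl c)) unsplitK.
by rewrite -[rshift _ _]/(unsplit (inr c)) unsplitK.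
Qed.

Definition ab_bifun_pre P P' Q Q' (u : abpre P P') (v : abpre Q Q') :
  abpre (ab_bifun_ob P Q) (ab_bifun_ob P' Q').
Proof.
exists (bh T (abg u) (abg v))
  (fun c c' => ab_bifun_h u v (split c) (split c')) => c'.
rewrite /= (sum_split (fun s => ab_bifun_h u v s (split c') \oc ab_bifun_f s)).
case: (split c') => [b|a] /=.
- rewrite -bh_cmp cmp1l abP bh_sumr [X in _ = _ + X]big1 ?addr0 => [|a _];
    last by rewrite cmp0l.
  by apply: eq_bigr => b' _; rewrite -bh_cmp cmp1r.
- rewrite -bh_cmp cmp1l abP bh_suml [X in _ = X + _]big1 ?add0r => [|b _];
    last by rewrite cmp0l.
  by apply: eq_bigr => a' _; rewrite -bh_cmp cmp1r.
Defined.

Lemma ab_bifun_nulll P P' Q Q' (f : mor (abX P) (abX P')) (g : mor (abX Q) (abX Q')) :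
  ab_null f -> ab_null (P := ab_bifun_ob P Q) (Q := ab_bifun_ob P' Q') (bh T f g).
Proof.
move=> [q <-].
pose q' (s : 'I_(abk Q) + 'I_(abk P)) : mor (ab_bifun_Y s) (T (abX P') (abX Q')) :=
  match s with inl _ => 0 | inr a => bh T (q a) g end.
exists (fun c => q' (split c)).
rewrite /= (sum_split (fun s => q' s \oc ab_bifun_f s)) /=.
rewrite big1 ?add0r => [|b _]; last by rewrite cmp0l.
by rewrite bh_suml; apply: eq_bigr => a _; rewrite -bh_cmp cmp1r.
Qed.

Lemma ab_bifun_nullr P P' Q Q' (f : mor (abX P) (abX P')) (g : mor (abX Q) (abX Q')) :
  ab_null g -> ab_null (P := ab_bifun_ob P Q) (Q := ab_bifun_ob P' Q') (bh T f g).
Proof.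
move=> [q <-].
pose q' (s : 'I_(abk Q) + 'I_(abk P)) : mor (ab_bifun_Y s) (T (abX P') (abX Q')) :=
  match s with inr _ => 0 | inl b => bh T f (q b) end.
exists (fun c => q' (split c)).
rewrite /= (sum_split (fun s => q' s \oc ab_bifun_f s)) /= addrC.
rewrite big1 ?add0r => [|b _]; last by rewrite cmp0l.
by rewrite bh_sumr; apply: eq_bigr => a _; rewrite -bh_cmp cmp1r.
Qed.

Definition ab_bifun_hom P P' Q Q' (x : abhom P P') (y : abhom Q Q') :
    abhom (ab_bifun_ob P Q) (ab_bifun_ob P' Q') :=
  abcl (ab_bifun_pre (repr x) (repr y)).

Lemma ab_bifun_homE P P' Q Q' (u : abpre P P') (v : abpre Q Q') :
  ab_bifun_hom (abcl u) (abcl v) = abcl (ab_bifun_pre u v).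
Proof.
apply: abcl_eq => /=; have nu := abcl_repr u; have nv := abcl_repr v.
have := ab_nullD (ab_bifun_nulll (abg v) nu)
  (ab_bifun_nullr (abg (repr (abcl u))) nv).
rewrite -[- abg u]scaleN1r -[- abg v]scaleN1r bhDl bhDr bhZl bhZr !scaleN1r.
by rewrite addrC addrA subrK.
Qed.

Definition ab_bifun : bifun (ab A) (ab B) (ab D).
Proof.
exists (ab_bifun_ob : ab A -> ab B -> ab D) ab_bifun_hom.
- move=> P P' Q Q'; elim/abcl_ind => v c; elim/abcl_ind => u; elim/abcl_ind => u'.
  rewrite abcl_linE !ab_bifun_homE abcl_linE; apply: abcl_eqg => /=.
  by rewrite bhDl bhZl.
- move=> P P' Q Q'; elim/abcl_ind => v c; elim/abcl_ind => u; elim/abcl_ind => u'.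
  rewrite abcl_linE !ab_bifun_homE abcl_linE; apply: abcl_eqg => /=.
  by rewrite bhDr bhZr.
- by move=> P Q; rewrite ab_bifun_homE; apply: abcl_eqg; rewrite /= bh_id.
- move=> P P' P'' Q Q' Q''; elim/abcl_ind => u'; elim/abcl_ind => u.
  elim/abcl_ind => v'; elim/abcl_ind => v.
  rewrite [_ \oc _]abcmpE [X in ab_bifun_hom _ X]abcmpE !ab_bifun_homE.
  by rewrite [RHS]abcmpE; apply: abcl_eqg; rewrite /= bh_cmp.
Defined.

End AbBiFun.

Lemma split_lshift m n (a : 'I_m) : split (lshift n a) = inl a.
Proof. exact: (unsplitK (inl a)). Qed.

Lemma split_rshift m n (a : 'I_n) : split (rshift m a) = inr a.
Proof. exact: (unsplitK (inr a)). Qed.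

Section AbAssoc.
Variables (k : fieldType) (A B D E F G : lincat k).
Variables (T1 : bifun A E F) (T2 : bifun B D E) (T3 : bifun G D F) (T4 : bifun A B G).
Variable a : forall X Y Z, iso (T1 X (T2 Y Z)) (T3 (T4 X Y) Z).
Hypothesis a_nat : forall X X' Y Y' Z Z' (f : mor X X') (g : mor Y Y') (h : mor Z Z'),
  a X' Y' Z' \oc bh T1 f (bh T2 g h) = bh T3 (bh T4 f g) h \oc a X Y Z.

Lemma aV_nat X X' Y Y' Z Z' (f : mor X X') (g : mor Y Y') (h : mor Z Z') :
  isoV (a X' Y' Z') \oc bh T3 (bh T4 f g) h = bh T1 f (bh T2 g h) \oc isoV (a X Y Z).
Proof. by apply/esym/iso_moveL; rewrite cmpA a_nat -cmpA isomK cmp1r. Qed.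

Definition ab_assoc_sel P Q S :
  ab_sel (P := ab_bifun T1 P (ab_bifun T2 Q S)) (Q := ab_bifun T3 (ab_bifun T4 P Q) S)
    (a (abX P) (abX Q) (abX S)).
Proof.
move=> c /=; case: (split c) => [s|d] /=.
  exists (lshift _ (lshift _ s)); rewrite !split_lshift /= !split_lshift /=.
  by exists (a _ _ _); rewrite a_nat bh_id.
case: (split d) => [q|p] /=.
  exists (lshift _ (rshift _ q)); rewrite !split_lshift /= !split_rshift /=.
  by exists (a _ _ _); rewrite a_nat.
exists (rshift _ p); rewrite !split_rshift /=.
by exists (a _ _ _); rewrite -a_nat bh_id.
Defined.

Definition ab_assocV_sel P Q S :
  ab_sel (Q := ab_bifun T1 P (ab_bifun T2 Q S)) (P := ab_bifun T3 (ab_bifun T4 P Q) S)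
    (isoV (a (abX P) (abX Q) (abX S))).
Proof.
move=> c /=; case: (split c) => [d|p] /=; last first.
  exists (rshift _ (rshift _ p)); rewrite !split_rshift /= !split_rshift /=.
  by exists (isoV (a _ _ _)); rewrite aV_nat bh_id.
case: (split d) => [s|q] /=.
  exists (lshift _ s); rewrite !split_lshift /=.
  by exists (isoV (a _ _ _)); rewrite -aV_nat bh_id.
exists (rshift _ (lshift _ q)); rewrite !split_rshift /= !split_lshift /=.
by exists (isoV (a _ _ _)); rewrite aV_nat.
Defined.

Definition ab_assoc P Q S :
    iso (ab_bifun T1 P (ab_bifun T2 Q S)) (ab_bifun T3 (ab_bifun T4 P Q) S) :=
  ab_iso (@ab_assoc_sel P Q S) (@ab_assocV_sel P Q S).

Lemma ab_assoc_nat P P' Q Q' S S' (f : mor P P') (g : mor Q Q') (h : mor S S') :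
  ab_assoc P' Q' S' \oc bh (ab_bifun T1) f (bh (ab_bifun T2) g h) =
  bh (ab_bifun T3) (bh (ab_bifun T4) f g) h \oc ab_assoc P Q S.
Proof.
elim/abcl_ind: f => f; elim/abcl_ind: g => g; elim/abcl_ind: h => h /=.
rewrite !ab_bifun_homE [LHS]abcmpE [RHS]abcmpE; apply: abcl_eqg; exact: a_nat.
Qed.

End AbAssoc.

Section AbUnit.
Variables (k : fieldType) (A B : lincat k).

Section Left.
Variables (T : bifun A B B) (U : A) (l : forall Y, iso (T U Y) Y).
Hypothesis l_nat : forall Y Y' (f : mor Y Y'), l Y' \oc bh T (idmor U) f = f \oc l Y.

Definition ab_lunit_sel Q :
  ab_sel (P := ab_bifun T (ab_emb A U) Q) (Q := Q) (l (abX Q)).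
Proof.
move=> b; exists (lshift _ b); rewrite /= split_lshift /=.
by exists (l _); rewrite l_nat.
Defined.

Definition ab_lunitV_sel Q :
  ab_sel (Q := ab_bifun T (ab_emb A U) Q) (P := Q) (isoV (l (abX Q))).
Proof.
move=> c /=; case: (split c) => [b|[]//] /=; exists b.
by exists (isoV (l _)); apply/esym/iso_moveR; rewrite -cmpA -l_nat cmpA isoVK cmp1l.
Defined.

Definition ab_lunit Q : iso (ab_bifun T (ab_emb A U) Q) Q :=
  ab_iso (@ab_lunit_sel Q) (@ab_lunitV_sel Q).

Lemma ab_lunit_nat Q Q' (f : mor Q Q') :
  ab_lunit Q' \oc bh (ab_bifun T) (idmor (ab_emb A U)) f = f \oc ab_lunit Q.
Proof.
elim/abcl_ind: f => f /=.
by rewrite !ab_bifun_homE [LHS]abcmpE [RHS]abcmpE; apply: abcl_eqg; exact: l_nat.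
Qed.
End Left.

Section Right.
Variables (T : bifun A B A) (U : B) (r : forall X, iso (T X U) X).
Hypothesis r_nat : forall X X' (f : mor X X'), r X' \oc bh T f (idmor U) = f \oc r X.

Definition ab_runit_sel P :
  ab_sel (P := ab_bifun T P (ab_emb B U)) (Q := P) (r (abX P)).
Proof.
move=> b; exists (rshift 0 b); rewrite /= split_rshift /=.
by exists (r _); rewrite r_nat.
Defined.

Definition ab_runitV_sel P :
  ab_sel (Q := ab_bifun T P (ab_emb B U)) (P := P) (isoV (r (abX P))).
Proof.
move=> c /=; case: (split c) => [[]//|b] /=; exists b.
by exists (isoV (r _)); apply/esym/iso_moveR; rewrite -cmpA -r_nat cmpA isoVK cmp1l.
Defined.

Definition ab_runit P : iso (ab_bifun T P (ab_emb B U)) P :=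
  ab_iso (@ab_runit_sel P) (@ab_runitV_sel P).

Lemma ab_runit_nat P P' (f : mor P P') :
  ab_runit P' \oc bh (ab_bifun T) f (idmor (ab_emb B U)) = f \oc ab_runit P.
Proof.
elim/abcl_ind: f => f /=.
by rewrite !ab_bifun_homE [LHS]abcmpE [RHS]abcmpE; apply: abcl_eqg; exact: r_nat.
Qed.
End Right.

End AbUnit.

(* [bcomp F G] is the composite FG (first G, then F).  A strict 2-category is a
   [bicat] whose structural isomorphisms are identities; see [strict_bicat]. *)
Record bicat (k : fieldType) := BiCat {
  b0 :> Type;
  b1 : b0 -> b0 -> lincat k;
  bunit : forall i, b1 i i;
  bcomp : forall i j l, bifun (b1 j l) (b1 i j) (b1 i l);
  basc : forall i j l m (F : b1 l m) (G : b1 j l) (H : b1 i j),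
    iso (bcomp i l m F (bcomp i j l G H)) (bcomp i j m (bcomp j l m F G) H);
  blun : forall i j (F : b1 i j), iso (bcomp i j j (bunit j) F) F;
  brun : forall i j (F : b1 i j), iso (bcomp i i j F (bunit i)) F;
  basc_nat : forall i j l m (F F' : b1 l m) (G G' : b1 j l) (H H' : b1 i j)
      (f : mor F F') (g : mor G G') (h : mor H H'),
    basc F' G' H' \oc bh (bcomp i l m) f (bh (bcomp i j l) g h) =
    bh (bcomp i j m) (bh (bcomp j l m) f g) h \oc basc F G H;
  blun_nat : forall i j (F F' : b1 i j) (f : mor F F'),
    blun F' \oc bh (bcomp i j j) (idmor (bunit j)) f = f \oc blun F;
  brun_nat : forall i j (F F' : b1 i j) (f : mor F F'),
    brun F' \oc bh (bcomp i i j) f (idmor (bunit i)) = f \oc brun F;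
  bpentagon : forall i j l m n (F : b1 m n) (G : b1 l m) (H : b1 j l) (K : b1 i j),
    basc (bcomp l m n F G) H K \oc basc F G (bcomp i j l H K) =
    bh (bcomp i j n) (basc F G H) (idmor K)
      \oc (basc F (bcomp j l m G H) K
      \oc bh (bcomp i m n) (idmor F) (basc G H K));
  btriangle : forall i j l (F : b1 j l) (G : b1 i j),
    bh (bcomp i j l) (brun F) (idmor G) \oc basc F (bunit j) G =
    bh (bcomp i j l) (idmor F) (blun G) }.

Arguments b1 {k} b i j.
Arguments bunit {k} b i.
Arguments bcomp {k b} {i j l}.
Arguments basc {k b i j l m} F G H.
Arguments blun {k b i j} F.
Arguments brun {k b i j} F.

Definition strict_bicat (k : fieldType) (C : bicat k) : Prop :=
  [/\ forall (i j l m : C) (F : b1 C l m) (G : b1 C j l) (H : b1 C i j),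
        exists e : bcomp F (bcomp G H) = bcomp (bcomp F G) H,
          basc F G H = eq_hom e :> mor _ _,
      forall (i j : C) (F : b1 C i j),
        exists e : bcomp (bunit C j) F = F, blun F = eq_hom e :> mor _ _
    & forall (i j : C) (F : b1 C i j),
        exists e : bcomp F (bunit C i) = F, brun F = eq_hom e :> mor _ _].

(* A 2-representation as a pseudofunctor to linear categories: [ractn F X] is FX,
   and [bh ractn] records the functors M(F) and the natural transformations
   M(alpha).  Strict 2-functors are singled out by [strict_rep]. *)
Record tworep (k : fieldType) (C : bicat k) := TwoRep {
  r0 :> C -> lincat k;
  ractn : forall i j, bifun (b1 C i j) (r0 i) (r0 j);
  rasc : forall i j l (F : b1 C j l) (G : b1 C i j) (X : r0 i),
    iso (ractn j l F (ractn i j G X)) (ractn i l (bcomp F G) X);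
  run : forall i (X : r0 i), iso (ractn i i (bunit C i) X) X;
  rasc_nat : forall i j l (F F' : b1 C j l) (G G' : b1 C i j) (X X' : r0 i)
      (f : mor F F') (g : mor G G') (x : mor X X'),
    rasc F' G' X' \oc bh (ractn j l) f (bh (ractn i j) g x) =
    bh (ractn i l) (bh bcomp f g) x \oc rasc F G X;
  run_nat : forall i (X X' : r0 i) (x : mor X X'),
    run X' \oc bh (ractn i i) (idmor (bunit C i)) x = x \oc run X;
  rpentagon : forall i j l m (F : b1 C l m) (G : b1 C j l) (H : b1 C i j) (X : r0 i),
    rasc (bcomp F G) H X \oc rasc F G (ractn i j H X) =
    bh (ractn i m) (basc F G H) (idmor X)
      \oc (rasc F (bcomp G H) X \oc bh (ractn l m) (idmor F) (rasc G H X));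
  rtriangle : forall i j (F : b1 C i j) (X : r0 i),
    bh (ractn i j) (brun F) (idmor X) \oc rasc F (bunit C i) X =
    bh (ractn i j) (idmor F) (run X);
  rtrianglel : forall i j (F : b1 C i j) (X : r0 i),
    bh (ractn i j) (blun F) (idmor X) \oc rasc (bunit C j) F X = run (ractn i j F X) }.

Arguments ractn {k C} t {i j}.
Arguments rasc {k C} t {i j l} F G X.
Arguments run {k C} t {i} X.

Definition strict_rep (k : fieldType) (C : bicat k) (M : tworep C) : Prop :=
  (forall (i j l : C) (F : b1 C j l) (G : b1 C i j) (X : M i),
     exists e : ractn M F (ractn M G X) = ractn M (bcomp F G) X,
       rasc M F G X = eq_hom e :> mor _ _) /\
  (forall (i : C) (X : M i),
     exists e : ractn M (bunit C i) X = X, run M X = eq_hom e :> mor _ _).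

Section BiCatTheory.
Variables (k : fieldType) (C : bicat k).
Implicit Types i j l m : C.

Lemma bcomp_unit_faithful i j (F G : b1 C i j) (f g : mor F G) :
  bh bcomp (idmor (bunit C j)) f = bh bcomp (idmor (bunit C j)) g -> f = g.
Proof. by move=> fg; apply: (iso_injr (u := blun F)); rewrite -!blun_nat fg. Qed.

Lemma bcomp_unit_faithfulr i j (F G : b1 C i j) (f g : mor F G) :
  bh bcomp f (idmor (bunit C i)) = bh bcomp g (idmor (bunit C i)) -> f = g.
Proof. by move=> fg; apply: (iso_injr (u := brun F)); rewrite -!brun_nat fg. Qed.

Lemma btrianglel i j l (F : b1 C j l) (G : b1 C i j) :
  bh bcomp (blun F) (idmor G) \oc basc (bunit C l) F G = blun (bcomp F G).
Proof.
apply: bcomp_unit_faithful.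
apply: (iso_injl (u := basc (bunit C l) F G)).
rewrite bh_cmpr cmpA basc_nat.
have tF : bh bcomp (bh bcomp (idmor (bunit C l)) (blun F)) (idmor G) =
  bh bcomp (bh bcomp (brun (bunit C l)) (idmor F) \oc basc _ _ _) (idmor G).
  by rewrite btriangle.
rewrite tF bh_cmpl -!cmpA -bpentagon -btriangle [RHS]cmpA.
by rewrite -[in RHS](bh_id bcomp F G) basc_nat cmpA.
Qed.

Lemma btriangler i j l (F : b1 C j l) (G : b1 C i j) :
  brun (bcomp F G) \oc basc F G (bunit C i) = bh bcomp (idmor F) (brun G).
Proof.
apply: bcomp_unit_faithfulr.
rewrite bh_cmpl.
have H1 := btriangle (bcomp F G) (bunit C i).
have H2 := bpentagon F G (bunit C i) (bunit C i).
apply: (iso_injr (u := basc F (bcomp G (bunit C i)) (bunit C i))).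
apply: (iso_injr (u := bh_iso bcomp (iso_id F) (basc G (bunit C i) (bunit C i)))).
rewrite /= -!cmpA -H2 !cmpA H1 -basc_nat.
rewrite -cmpA -bh_cmp cmp1l btriangle.
by rewrite -bh_id basc_nat.
Qed.

End BiCatTheory.

Section AbBiCat.
Variables (k : fieldType) (C : bicat k).

Definition ab_bicat : bicat k.
Proof.
exists (b0 C) (fun i j => ab (b1 C i j)) (fun i => ab_emb _ (bunit C i))
  (fun i j l => ab_bifun bcomp)
  (fun i j l m => ab_assoc (@basc_nat k C i j l m))
  (fun i j => ab_lunit (@blun_nat k C i j))
  (fun i j => ab_runit (@brun_nat k C i j)).
- move=> i j l m *; exact: ab_assoc_nat.
- move=> i j *; exact: ab_lunit_nat.
- move=> i j *; exact: ab_runit_nat.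
- move=> i j l m n F G H K /=.
  rewrite !(ab_bifun_homE, abcmpE); apply: abcl_eqg => /=.
  exact: bpentagon.
- move=> i j l F G /=.
  rewrite !(ab_bifun_homE, abcmpE); apply: abcl_eqg => /=.
  exact: btriangle.
Defined.

Definition ab_rep (M : tworep C) : tworep ab_bicat.
Proof.
exists (fun i : ab_bicat => ab (M i)) (fun i j => ab_bifun (ractn M))
  (fun i j l => ab_assoc (@rasc_nat k C M i j l))
  (fun i => ab_lunit (@run_nat k C M i)).
- move=> i j l *; exact: ab_assoc_nat.
- move=> i *; exact: ab_lunit_nat.
- move=> i j l m F G H X /=.
  rewrite !(ab_bifun_homE, abcmpE); apply: abcl_eqg => /=.
  exact: rpentagon.
- move=> i j F X /=.
  rewrite !(ab_bifun_homE, abcmpE); apply: abcl_eqg => /=.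
  exact: rtriangle.
- move=> i j F X /=.
  rewrite !(ab_bifun_homE, abcmpE); apply: abcl_eqg => /=.
  exact: rtrianglel.
Defined.

End AbBiCat.

Record pfun (k : fieldType) (C D : bicat k) := PFun {
  pf0 : C -> D;
  pf1 : forall i j, linfunctor (b1 C i j) (b1 D (pf0 i) (pf0 j));
  pf_comp : forall i j l (F : b1 C j l) (G : b1 C i j),
    iso (bcomp (pf1 j l F) (pf1 i j G)) (pf1 i l (bcomp F G));
  pf_unit : forall i, iso (bunit D (pf0 i)) (pf1 i i (bunit C i));
  pf_comp_nat : forall i j l (F F' : b1 C j l) (G G' : b1 C i j)
      (f : mor F F') (g : mor G G'),
    pf_comp F' G' \oc bh bcomp (fh (pf1 j l) f) (fh (pf1 i j) g) =
    fh (pf1 i l) (bh bcomp f g) \oc pf_comp F G;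
  pf_assoc : forall i j l m (F : b1 C l m) (G : b1 C j l) (H : b1 C i j),
    fh (pf1 i m) (basc F G H)
      \oc (pf_comp F (bcomp G H) \oc bh bcomp (idmor (pf1 l m F)) (pf_comp G H)) =
    pf_comp (bcomp F G) H
      \oc (bh bcomp (pf_comp F G) (idmor (pf1 i j H)) \oc basc _ _ _);
  pf_lun : forall i j (F : b1 C i j),
    fh (pf1 i j) (blun F)
      \oc (pf_comp (bunit C j) F \oc bh bcomp (pf_unit j) (idmor (pf1 i j F))) =
    blun (pf1 i j F);
  pf_run : forall i j (F : b1 C i j),
    fh (pf1 i j) (brun F)
      \oc (pf_comp F (bunit C i) \oc bh bcomp (idmor (pf1 i j F)) (pf_unit i)) =
    brun (pf1 i j F) }.

Arguments pf0 {k C D} p i.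
Arguments pf1 {k C D} p {i j}.
Arguments pf_comp {k C D} p {i j l} F G.
Arguments pf_unit {k C D} p i.

Section Restriction.
Variables (k : fieldType).

Definition bifun_prel (A A' B D : lincat k) (F : linfunctor A A') (T : bifun A' B D) :
  bifun A B D.
Proof.
exists (fun X Y => T (F X) Y) (fun X X' Y Y' f g => bh T (fh F f) g).
- by move=> X X' Y Y' g a f f'; rewrite fh_lin bh_linl.
- by move=> X X' Y Y' f a g g'; rewrite bh_linr.
- by move=> X Y; rewrite fh_id bh_id.
- by move=> *; rewrite fh_cmp bh_cmp.
Defined.

Variables (C D : bicat k) (P : pfun C D) (R : tworep D).

Definition res : tworep C.
Proof.
exists (fun i => R (pf0 P i)) (fun i j => bifun_prel (pf1 P) (ractn R))
  (fun i j l F G X => iso_comp (bh_iso (ractn R) (pf_comp P F G) (iso_id X))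
                               (rasc R (pf1 P F) (pf1 P G) X))
  (fun i X => iso_comp (run R X)
     (bh_iso (ractn R) (iso_sym (pf_unit P i)) (iso_id X))).
- move=> i j l F F' G G' X X' f g x /=.
  by rewrite -cmpA rasc_nat !cmpA -!bh_cmp pf_comp_nat cmp1l cmp1r.
- move=> i X X' x /=.
  by rewrite fh_id -!cmpA -bh_split' cmpA -run_nat -cmpA -bh_cmp cmp1l cmp1r.
- move=> i j l m F G H X /=.
  rewrite fh_id bh_cmpr.
  set a1 := rasc R (pf1 P F) (pf1 P (bcomp G H)) X.
  have e1 : a1 \oc bh (ractn R) (idmor (pf1 P F)) (bh (ractn R) (pf_comp P G H) (idmor X)) =
     bh (ractn R) (bh bcomp (idmor (pf1 P F)) (pf_comp P G H)) (idmor X) \oc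
     rasc R (pf1 P F) (bcomp (pf1 P G) (pf1 P H)) X by rewrite rasc_nat.
  have e2 : rasc R (pf1 P (bcomp F G)) (pf1 P H) X \oc
     bh (ractn R) (pf_comp P F G) (idmor (ractn R (pf1 P H) X)) =
     bh (ractn R) (bh bcomp (pf_comp P F G) (idmor (pf1 P H))) (idmor X) \oc
     rasc R (bcomp (pf1 P F) (pf1 P G)) (pf1 P H) X by rewrite -rasc_nat bh_id.
  transitivity (bh (ractn R) (pf_comp P (bcomp F G) H \oc
     (bh bcomp (pf_comp P F G) (idmor (pf1 P H)) \oc basc _ _ _)) (idmor X) \oc
     (rasc R (pf1 P F) (bcomp (pf1 P G) (pf1 P H)) X \oc
      bh (ractn R) (idmor (pf1 P F)) (rasc R (pf1 P G) (pf1 P H) X))).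
    rewrite !bh_cmpl -!cmpA -rpentagon; congr (_ \oc _).
    by rewrite cmpA e2 -cmpA.
  rewrite -pf_assoc !bh_cmpl -!cmpA; congr (_ \oc (_ \oc _)).
  by rewrite !cmpA -e1.
- move=> i j F X /=.
  rewrite fh_id bh_cmpr -rtriangle.
  rewrite -pf_run !bh_cmpl -!cmpA.
  congr (_ \oc (_ \oc _)).
  rewrite cmpA -rasc_nat -cmpA -bh_cmpr -bh_cmpl isomK !bh_id cmp1r.
  by [].
- move=> i j F X /=.
  rewrite -rtrianglel -pf_lun !bh_cmpl -!cmpA.
  congr (_ \oc (_ \oc _)).
  rewrite [RHS]cmpA -rasc_nat -cmpA -bh_cmp isomK cmp1r.
  by rewrite !bh_id cmp1r.
Defined.

End Restriction.

Section AbPFun.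
Variables (k : fieldType) (C : bicat k).

Definition ab_pcomp_sel (i j l : C) (F : b1 C j l) (G : b1 C i j) :
  ab_sel (P := ab_bifun bcomp (ab_emb _ F) (ab_emb _ G))
         (Q := ab_emb _ (bcomp F G)) (idmor (bcomp F G)).
Proof. by case. Defined.

Definition ab_pcompV_sel (i j l : C) (F : b1 C j l) (G : b1 C i j) :
  ab_sel (Q := ab_bifun bcomp (ab_emb _ F) (ab_emb _ G))
         (P := ab_emb _ (bcomp F G)) (idmor (bcomp F G)).
Proof. by case. Defined.

Definition ab_pfun : pfun C (ab_bicat C).
Proof.
refine (@PFun k C (ab_bicat C) (fun i => i) (fun i j => ab_emb (b1 C i j))
  (fun i j l F G => @ab_iso _ _ (ab_bifun bcomp (ab_emb _ F) (ab_emb _ G))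
     (ab_emb _ (bcomp F G)) (iso_id (bcomp F G))
     (@ab_pcomp_sel i j l F G) (@ab_pcompV_sel i j l F G))
  (fun i => iso_id (ab_emb _ (bunit C i))) _ _ _ _).
- move=> i j l F F' G G' f g /=.
  by rewrite !(ab_bifun_homE, abcmpE); apply: abcl_eqg; rewrite /= cmp1l cmp1r.
- move=> i j l m F G H /=.
  rewrite !(ab_bifun_homE, abcmpE); apply: abcl_eqg => /=.
  by rewrite !bh_id !cmp1l !cmp1r.
- move=> i j F /=.
  rewrite !(ab_bifun_homE, abcmpE); apply: abcl_eqg => /=.
  by rewrite bh_id !cmp1r.
- move=> i j F /=.
  rewrite !(ab_bifun_homE, abcmpE); apply: abcl_eqg => /=.
  by rewrite bh_id !cmp1r.
Defined.

End AbPFun.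

Definition finitary_bicat (k : fieldType) (C : bicat k) : Prop :=
  [/\ exists n (e : 'I_n -> C), forall i, exists a, e a = i,
      forall i j : C, finitary_cat (b1 C i j)
    & forall i : C, indecomposable (bunit C i)].

(* A pseudofunctor C -> C^{co,op} that is the identity on objects, together with
   an isomorphism from its square to the identity. *)
Record involution (k : fieldType) (C : bicat k) := Involution {
  st :> forall i j, b1 C i j -> b1 C j i;
  sth : forall i j (F G : b1 C i j), mor F G -> mor (st G) (st F);
  st_comp : forall i j l (F : b1 C j l) (G : b1 C i j),
    iso (bcomp (st G) (st F)) (st (bcomp F G));
  st_unit : forall i, iso (bunit C i) (st (bunit C i));
  stst : forall i j (F : b1 C i j), iso (st (st F)) F;
  sth_lin : forall i j (F G : b1 C i j), linear (@sth i j F G);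
  sth_id : forall i j (F : b1 C i j), sth (idmor F) = idmor (st F);
  sth_cmp : forall i j (F G H : b1 C i j) (g : mor G H) (f : mor F G),
    sth (g \oc f) = sth f \oc sth g;
  st_comp_nat : forall i j l (F F' : b1 C j l) (G G' : b1 C i j)
      (f : mor F F') (g : mor G G'),
    st_comp F G \oc bh bcomp (sth g) (sth f) =
    sth (bh bcomp f g) \oc st_comp F' G';
  st_assoc : forall i j l m (F : b1 C l m) (G : b1 C j l) (H : b1 C i j),
    sth (basc F G H)
      \oc (st_comp (bcomp F G) H \oc bh bcomp (idmor (st H)) (st_comp F G)) =
    st_comp F (bcomp G H)
      \oc (bh bcomp (st_comp G H) (idmor (st F)) \oc basc (st H) (st G) (st F));
  st_lun : forall i j (F : b1 C i j),
    sth (brun F) \oc blun (st F) =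
    st_comp F (bunit C i) \oc bh bcomp (st_unit i) (idmor (st F));
  st_run : forall i j (F : b1 C i j),
    sth (blun F) \oc brun (st F) =
    st_comp (bunit C j) F \oc bh bcomp (idmor (st F)) (st_unit j);
  stst_nat : forall i j (F G : b1 C i j) (f : mor F G),
    stst G \oc sth (sth f) = f \oc stst F;
  stst_comp : forall i j l (F : b1 C j l) (G : b1 C i j),
    stst (bcomp F G) \oc (sth (isoV (st_comp F G)) \oc st_comp (st G) (st F)) =
    bh bcomp (stst F) (stst G);
  stst_unit : forall i,
    stst (bunit C i) \oc (sth (isoV (st_unit i)) \oc st_unit i) = idmor (bunit C i) }.

Arguments st {k C} i0 {i j} F : rename.

(* The zig-zag identities; [F] is left adjoint to [G]. *)
Record adjunction (k : fieldType) (C : bicat k) (i j : C)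
    (F : b1 C i j) (G : b1 C j i)
    (alpha : mor (bcomp F G) (bunit C j)) (beta : mor (bunit C i) (bcomp G F)) :
    Prop := Adjunction {
  zigzag1 : blun F \oc (bh bcomp alpha (idmor F) \oc (basc F G F
           \oc (bh bcomp (idmor F) beta \oc isoV (brun F)))) = idmor F;
  zigzag2 : brun G \oc (bh bcomp (idmor G) alpha \oc (isoV (basc G F G)
           \oc (bh bcomp beta (idmor G) \oc isoV (blun G)))) = idmor G }.

Definition fiat (k : fieldType) (C : bicat k) : Prop :=
  [/\ strict_bicat C, finitary_bicat C
    & exists s : involution C, forall (i j : C) (F : b1 C i j),
        exists alpha beta, adjunction (F := F) (G := s i j F) alpha beta].

Record repmor (k : fieldType) (C : bicat k) (R R' : tworep C) := RepMor {
  mf :> forall i, linfunctor (R i) (R' i);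
  mi : forall i j (F : b1 C i j) (X : R i),
    iso (mf j (ractn R F X)) (ractn R' F (mf i X));
  mi_nat : forall i j (F G : b1 C i j) (X Y : R i) (f : mor F G) (x : mor X Y),
    mi G Y \oc fh (mf j) (bh (ractn R) f x) =
    bh (ractn R') f (fh (mf i) x) \oc mi F X;
  mi_comp : forall i j l (F : b1 C j l) (G : b1 C i j) (X : R i),
    mi (bcomp F G) X \oc fh (mf l) (rasc R F G X) =
    rasc R' F G (mf i X) \oc (bh (ractn R') (idmor F) (mi G X) \oc mi F (ractn R G X));
  mi_unit : forall i (X : R i),
    run R' (mf i X) \oc mi (bunit C i) X = fh (mf i) (run R X) }.

Arguments mi {k C R R'} r {i j} F X.

Section RepTheory.
Variables (k : fieldType) (C : bicat k).

Definition rep_equivalence (R R' : tworep C) (Phi : repmor R R') : Prop :=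
  forall i, cat_equivalence (Phi i).

Definition rep_equivalent (R R' : tworep C) : Prop :=
  exists Phi : repmor R R', rep_equivalence Phi.

Definition finitary_rep (R : tworep C) : Prop := forall i, finitary_cat (R i).

Definition repmor_comp (R R' R'' : tworep C) (Psi : repmor R' R'')
  (Phi : repmor R R') : repmor R R''.
Proof.
exists (fun i => linfunctor_comp (Psi i) (Phi i))
  (fun i j F X => iso_comp (mi Psi F (Phi i X)) (fh_iso (Psi j) (mi Phi F X))).
- move=> i j F G X Y f x /=.
  by rewrite -cmpA -fh_cmp mi_nat fh_cmp cmpA mi_nat -cmpA.
- move=> i j l F G X /=.
  rewrite -cmpA -fh_cmp mi_comp !fh_cmp cmpA mi_comp bh_cmpr -!cmpA.
  congr (_ \oc (_ \oc _)).
  by rewrite cmpA mi_nat -cmpA.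
- by move=> i X /=; rewrite cmpA mi_unit -fh_cmp mi_unit.
Defined.

Section SubRep.
Variables (R : tworep C) (P : forall i, R i -> Prop).
Hypothesis P_act : forall i j (F : b1 C i j) (X : R i), P X -> P (ractn R F X).

Definition fullsub_iso (A : lincat k) (Q : A -> Prop) (X Y : fullsub Q)
    (u : iso (sval X) (sval Y)) : iso X Y :=
  @Iso k (fullsub Q) X Y u (isoV u) (isoVK u) (isomK u).

Definition subrep_act i j : bifun (b1 C i j) (fullsub (P (i := i))) (fullsub (P (i := j))).
Proof.
exists (fun F X => exist _ (ractn R F (sval X)) (P_act F (svalP X)))
  (fun F F' X X' f x => bh (ractn R) f x).
- by move=> *; apply: bh_linl.
- by move=> F F' X X' f a x y; apply: (bh_linr (ractn R) f).
- by move=> *; apply: bh_id.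
- by move=> *; apply: bh_cmp.
Defined.

Definition subrep : tworep C.
Proof.
refine (@TwoRep k C (fun i => fullsub (P (i := i))) subrep_act
  (fun i j l F G X => @fullsub_iso _ _ (subrep_act j l F (subrep_act i j G X))
     (subrep_act i l (bcomp F G) X) (rasc R F G (sval X)))
  (fun i X => @fullsub_iso _ _ (subrep_act i i (bunit C i) X) X (run R (sval X)))
  _ _ _ _ _).
- by move=> *; apply: rasc_nat.
- by move=> *; apply: run_nat.
- by move=> *; apply: rpentagon.
- by move=> *; apply: rtriangle.
- by move=> *; apply: rtrianglel.
Defined.

Variables (S : tworep C) (Phi : repmor S R).
Hypothesis P_Phi : forall i (X : S i), P (Phi i X).

Definition corestrict_fun i : linfunctor (S i) (subrep i).
Proof.
exists (fun X => exist _ (Phi i X) (P_Phi X) : subrep i) (fun X Y f => fh (Phi i) f).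
- by move=> *; apply: fh_lin.
- by move=> *; apply: fh_id.
- by move=> *; apply: fh_cmp.
Defined.

Definition corestrict : repmor S subrep.
Proof.
refine (@RepMor k C S subrep corestrict_fun
  (fun i j F X => @fullsub_iso _ _ (corestrict_fun j (ractn S F X))
     (ractn subrep F (corestrict_fun i X)) (mi Phi F X)) _ _ _).
- by move=> *; apply: mi_nat.
- by move=> *; apply: mi_comp.
- by move=> *; apply: mi_unit.
Defined.

End SubRep.

Definition rep_add (R : tworep C) i (X : R i) j (Y : R j) : Prop :=
  exists n (F : 'I_n -> b1 C i j) (S Y' : R j),
    is_biproduct (fun a => ractn R (F a) X) S /\ is_biproduct2 Y Y' S.

Lemma rep_add_act (R : tworep C) i (X : R i) j l (G : b1 C j l) (Y : R j) :
  rep_add X Y -> rep_add X (ractn R G Y).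
Proof.
move=> [n [F [S [Y' [[s [r [rs rs0 sr]]] [s1 [s2 [r1 [r2 [e1 e2 e12 e21 e]]]]]]]]]].
exists n, (fun a => bcomp G (F a)), (ractn R G S), (ractn R G Y'); split.
- exists (fun a => bh (ractn R) (idmor G) (s a) \oc isoV (rasc R G (F a) X)).
  exists (fun a => rasc R G (F a) X \oc bh (ractn R) (idmor G) (r a)).
  split=> [a|a b ab|].
  + by rewrite -cmpA [X in _ \oc X]cmpA -bh_cmpr rs bh_id cmp1l isomK.
  + by rewrite -cmpA [X in _ \oc X]cmpA -bh_cmpr rs0 // bh0r cmp0l cmp0r.
  + under eq_bigr => a _.
      rewrite -cmpA [X in _ \oc X]cmpA isoVK cmp1l -bh_cmpr; over.
    by rewrite -bh_sumr sr bh_id.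
- exists (bh (ractn R) (idmor G) s1), (bh (ractn R) (idmor G) s2).
  exists (bh (ractn R) (idmor G) r1), (bh (ractn R) (idmor G) r2).
  by split; rewrite -?bh_cmpr -?bhDr ?e1 ?e2 ?e12 ?e21 ?e ?bh_id ?bh0r.
Qed.

Definition transitive_rep (R : tworep C) : Prop :=
  forall i (X : R i), ~ is_zero X ->
    rep_equivalent (subrep (@rep_add_act R i X)) R.

Section Adjoint.
Variables (R : tworep C) (i j : C) (F : b1 C i j) (G : b1 C j i).
Variables (alpha : mor (bcomp F G) (bunit C j)) (beta : mor (bunit C i) (bcomp G F)).
Hypothesis adj : adjunction alpha beta.

Definition rcounit (Y : R j) : mor (ractn R F (ractn R G Y)) Y :=
  run R Y \oc (bh (ractn R) alpha (idmor Y) \oc rasc R F G Y).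
Definition runit (X : R i) : mor X (ractn R G (ractn R F X)) :=
  isoV (rasc R G F X) \oc (bh (ractn R) beta (idmor X) \oc isoV (run R X)).

Lemma rcounit_nat (Y Y' : R j) (y : mor Y Y') :
  rcounit Y' \oc bh (ractn R) (idmor F) (bh (ractn R) (idmor G) y) = y \oc rcounit Y.
Proof.
rewrite /rcounit -!cmpA rasc_nat bh_id [X in _ \oc X]cmpA -bh_cmp cmp1r cmp1l.
by rewrite (bh_split (ractn R) alpha) !cmpA run_nat.
Qed.

Lemma runit_nat (X X' : R i) (x : mor X X') :
  runit X' \oc x = bh (ractn R) (idmor G) (bh (ractn R) (idmor F) x) \oc runit X.
Proof.
rewrite /runit -!cmpA; apply/esym/iso_moveL.
rewrite !cmpA rasc_nat bh_id -(cmpA _ (rasc R G F X)) isomK cmp1r.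
rewrite -bh_cmp cmp1l cmp1r (bh_split' (ractn R) beta) -!cmpA; congr (_ \oc _).
by apply/iso_moveL; rewrite cmpA run_nat -cmpA isomK cmp1r.
Qed.

Lemma rzigzag (Y : R j) :
  bh (ractn R) (idmor G) (rcounit Y) \oc runit (ractn R G Y) = idmor (ractn R G Y).
Proof.
have := congr1 (fun f => bh (ractn R) f (idmor Y)) (zigzag2 adj).
rewrite !bh_cmpl bh_id => <-; rewrite /rcounit /runit !bh_cmpr.
rewrite -rtriangle -!cmpA; congr (_ \oc _).
rewrite cmpA rasc_nat -!cmpA; congr (_ \oc _).
have pent := rpentagon G F G Y.
rewrite [X in _ \oc X]cmpA; rewrite [LHS]cmpA.
have -> : rasc R G (bcomp F G) Y \oc (bh (ractn R) (idmor G) (rasc R F G Y)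
    \oc isoV (rasc R G F (ractn R G Y))) =
  bh (ractn R) (isoV (basc G F G)) (idmor Y) \oc rasc R (bcomp G F) G Y.
  apply: (iso_injr (u := rasc R G F (ractn R G Y))).
  rewrite -!cmpA isoVK cmp1r pent cmpA.
  by rewrite -bh_cmpl isoVK bh_id cmp1l.
rewrite -cmpA; congr (_ \oc _).
rewrite cmpA -[X in bh _ beta X](bh_id (ractn R)) rasc_nat -cmpA; congr (_ \oc _).
by apply/esym/iso_moveR; rewrite -rtrianglel cmpA -bh_cmpl isoVK bh_id cmp1l.
Qed.

Lemma ract_mono (Y Y' : R j) (m : mor Y Y') :
  monomorphism m -> monomorphism (bh (ractn R) (idmor G) m).
Proof.
move=> mm W u v uv.
have E (w : mor W (ractn R G Y)) : w = bh (ractn R) (idmor G)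
    (rcounit Y \oc bh (ractn R) (idmor F) w) \oc runit W.
  by rewrite bh_cmpr -cmpA -runit_nat cmpA rzigzag cmp1l.
rewrite (E u) (E v); congr (bh _ _ _ \oc _); apply: mm.
by rewrite [LHS]cmpA [RHS]cmpA -rcounit_nat -[LHS]cmpA -[RHS]cmpA -!bh_cmpr uv.
Qed.

Lemma ract_injective (I : R j) :
  (forall (Y Y' : R i) (m : mor Y Y'), monomorphism m ->
     monomorphism (bh (ractn R) (idmor F) m)) ->
  injective_ob I -> injective_ob (ractn R G I).
Proof.
move=> mF inI Y Z m g mm.
have [t tP] := inI _ _ _ (rcounit I \oc bh (ractn R) (idmor F) g) (mF _ _ _ mm).
exists (bh (ractn R) (idmor G) t \oc runit Z).
by rewrite -cmpA runit_nat cmpA -bh_cmpr tP bh_cmpr -cmpA -runit_nat cmpA rzigzag cmp1l.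
Qed.

End Adjoint.

Lemma injective_iso (A : lincat k) (X Y : A) (u : iso X Y) :
  injective_ob X -> injective_ob Y.
Proof.
move=> inX V W m g mm; have [t tP] := inX _ _ _ (isoV u \oc g) mm.
by exists (u \oc t); rewrite -cmpA tP cmpA isomK cmp1l.
Qed.

Lemma fiat_injective (R : tworep C) (hC : fiat C) i j (F : b1 C i j) (X : R i) :
  injective_ob X -> injective_ob (ractn R F X).
Proof.
case: hC => _ _ [s adj] inX.
have [alpha [beta adjF]] := adj _ _ F.
have [alpha' [beta' adjF']] := adj _ _ (s _ _ F).
apply: (injective_iso (bh_iso (ractn R) (stst s F) (iso_id X))).
apply: (ract_injective adjF' _ inX) => Y Y' m.
exact: (ract_mono adjF).
Qed.

Definition inj_rep (hC : fiat C) (R : tworep C) : tworep C :=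
  subrep (fun i j F X => @fiat_injective R hC i j F X).

Definition corestrict_inj (hC : fiat C) (S R : tworep C) (Phi : repmor S R)
    (hInj : forall i (X : S i), injective_ob (Phi i X)) : repmor S (inj_rep hC R) :=
  corestrict (fun i j F X => @fiat_injective R hC i j F X) hInj.

End RepTheory.

Record coalg (k : fieldType) (B : bicat k) (i : B) := Coalg {
  ca :> b1 B i i;
  cdelta : mor ca (bcomp ca ca);
  ceps : mor ca (bunit B i);
  coassoc : basc ca ca ca \oc (bh bcomp (idmor ca) cdelta \oc cdelta) =
            bh bcomp cdelta (idmor ca) \oc cdelta;
  counitl : blun ca \oc (bh bcomp ceps (idmor ca) \oc cdelta) = idmor ca;
  counitr : brun ca \oc (bh bcomp (idmor ca) ceps \oc cdelta) = idmor ca }.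

Record comod_ob (k : fieldType) (B : bicat k) (i : B) (A : coalg i) (j : B) := ComodOb {
  cx :> b1 B i j;
  crho : mor cx (bcomp cx A);
  crho_coassoc : basc cx A A \oc (bh bcomp (idmor cx) (cdelta A) \oc crho) =
                 bh bcomp crho (idmor (ca A)) \oc crho;
  crho_counit : brun cx \oc (bh bcomp (idmor cx) (ceps A) \oc crho) = idmor cx }.
Arguments crho {k B i A j} X : rename.

Section Comodules.
Variables (k : fieldType) (B : bicat k) (i : B) (A : coalg i).

Section Hom.
Variable j : B.
Implicit Types X Y Z : comod_ob A j.

Definition comod_morphism X Y : {pred mor (cx X) (cx Y)} :=
  fun f => crho Y \oc f == bh bcomp f (idmor (ca A)) \oc crho X.
Arguments comod_morphism : clear implicits.

Lemma comod_morphism_submod X Y : submod_closed (comod_morphism X Y).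
Proof.
split=> [|a f g /eqP ef /eqP eg]; apply/eqP.
  by rewrite cmp0r bh0l cmp0l.
by rewrite cmpDr cmpZr ef eg bhDl bhZl cmpDl cmpZl.
Qed.

Record comod_hom X Y := ComodHom {
  chv :> mor (cx X) (cx Y);
  chvP : chv \in comod_morphism X Y }.

HB.instance Definition _ X Y := [isSub for @chv X Y].
HB.instance Definition _ X Y := [Choice of comod_hom X Y by <:].
HB.instance Definition _ X Y :=
  GRing.SubChoice_isSubLmodule.Build k (mor (cx X) (cx Y)) (comod_morphism X Y)
    (comod_hom X Y) (GRing.submod_closed_semi (comod_morphism_submod X Y)).

Lemma comod_hom_inj X Y (f g : comod_hom X Y) : chv f = chv g -> f = g.
Proof. exact: val_inj. Qed.

Lemma comod_homE X Y (f : comod_hom X Y) :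
  crho Y \oc f = bh bcomp (chv f) (idmor (ca A)) \oc crho X.
Proof. exact/eqP/(chvP f). Qed.

Lemma comod_idP X : idmor (cx X) \in comod_morphism X X.
Proof. by apply/eqP; rewrite bh_id cmp1l cmp1r. Qed.

Lemma comod_cmpP X Y Z (g : comod_hom Y Z) (f : comod_hom X Y) :
  chv g \oc chv f \in comod_morphism X Z.
Proof. by apply/eqP; rewrite cmpA comod_homE -cmpA comod_homE cmpA bh_cmpl. Qed.

Definition comod_cat : lincat k.
Proof.
exists (comod_ob A j) (fun X Y => comod_hom X Y : lmodType k)
  (fun X => ComodHom (comod_idP X)) (fun X Y Z g f => ComodHom (comod_cmpP g f)).
- by move=> X Y Z f a g g'; apply: comod_hom_inj; apply: cmp_linl.
- by move=> X Y Z f a g g'; apply: comod_hom_inj; apply: cmp_linr.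
- by move=> *; apply: comod_hom_inj; apply: cmpA.
- by move=> *; apply: comod_hom_inj; apply: cmp1l.
- by move=> *; apply: comod_hom_inj; apply: cmp1r.
Defined.

Lemma comod_isoVP X Y (u : iso (cx X) (cx Y)) :
  isomor u \in comod_morphism X Y -> isoV u \in comod_morphism Y X.
Proof.
move=> /eqP uP; apply/eqP; apply: (iso_injr (u := u)).
by rewrite -!cmpA isoVK cmp1r uP cmpA -bh_cmpl isoVK bh_id cmp1l.
Qed.

Definition comod_iso X Y (u : iso (cx X) (cx Y))
  (uP : isomor u \in comod_morphism X Y) : iso (X : comod_cat) (Y : comod_cat).
Proof.
by exists (ComodHom uP) (ComodHom (comod_isoVP uP)); apply: comod_hom_inj;
   rewrite /= ?isoVK ?isomK.
Defined.

End Hom.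
Arguments comod_morphism {j} X Y.

Lemma comod_act_nat j l (F : b1 B j l) (X : comod_ob A j) (G : b1 B i i)
    (g : mor (ca A) G) :
  bh bcomp (idmor (bcomp F X)) g \oc (basc F X A \oc bh bcomp (idmor F) (crho X)) =
  basc F X G \oc bh bcomp (idmor F) (bh bcomp (idmor (cx X)) g \oc crho X).
Proof. by rewrite cmpA bh_cmpr [RHS]cmpA basc_nat bh_id. Qed.

Definition comod_act_ob j l (F : b1 B j l) (X : comod_ob A j) : comod_ob A l.
Proof.
exists (bcomp F X) (basc F X A \oc bh bcomp (idmor F) (crho X)).
- rewrite comod_act_nat [LHS]cmpA bpentagon -!cmpA -bh_cmpr crho_coassoc.
  by rewrite [bh bcomp (_ \oc _) (idmor _)]bh_cmpl -cmpA bh_cmpr !cmpA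
     -(cmpA _ (basc F (bcomp X A) A)) basc_nat !cmpA.
- by rewrite comod_act_nat cmpA btriangler -bh_cmpr crho_counit bh_id.
Defined.

Lemma comod_actP j l (F F' : b1 B j l) (X X' : comod_ob A j) (f : mor F F')
    (x : comod_hom X X') :
  bh bcomp f (chv x) \in comod_morphism (comod_act_ob F X) (comod_act_ob F' X').
Proof.
apply/eqP; rewrite /= -cmpA -bh_cmp cmp1l comod_homE.
by rewrite [RHS]cmpA -basc_nat -cmpA -bh_cmp cmp1r.
Qed.

Definition comod_act j l : bifun (b1 B j l) (comod_cat j) (comod_cat l).
Proof.
exists (fun F (X : comod_cat j) => comod_act_ob F X : comod_cat l)
  (fun F F' (X X' : comod_cat j) f x => ComodHom (comod_actP f x)).
- by move=> F F' X X' g a f f'; apply: comod_hom_inj; apply: (bh_linl bcomp (chv g)).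
- by move=> F F' X X' f a g g'; apply: comod_hom_inj; apply: (bh_linr bcomp f).
- by move=> *; apply: comod_hom_inj; apply: bh_id.
- by move=> *; apply: comod_hom_inj; apply: bh_cmp.
Defined.

Lemma comod_ascP j l m (F : b1 B l m) (G : b1 B j l) (X : comod_ob A j) :
  isomor (basc F G (cx X)) \in
    comod_morphism (comod_act_ob F (comod_act_ob G X)) (comod_act_ob (bcomp F G) X).
Proof.
apply/eqP; rewrite /= bh_cmpr.
rewrite -[idmor (bcomp F G)]bh_id -cmpA -basc_nat !cmpA; congr (_ \oc _).
by rewrite bpentagon -!cmpA.
Qed.

Lemma comod_unP j (X : comod_ob A j) :
  isomor (blun (cx X)) \in comod_morphism (comod_act_ob (bunit B j) X) X.
Proof. by apply/eqP; rewrite /= cmpA btrianglel blun_nat. Qed.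

Definition comod_rep : tworep B.
Proof.
exists comod_cat comod_act
  (fun j l m F G X => comod_iso (comod_ascP F G X)) (fun j X => comod_iso (comod_unP X)).
- by move=> *; apply: comod_hom_inj; apply: basc_nat.
- by move=> *; apply: comod_hom_inj; apply: blun_nat.
- by move=> *; apply: comod_hom_inj; apply: bpentagon.
- by move=> *; apply: comod_hom_inj; apply: btriangle.
- by move=> *; apply: comod_hom_inj; apply: btrianglel.
Defined.

End Comodules.
Arguments comod_morphism {k B i A j} X Y.

(* A representation of F |-> Hom(M, FN) on B(i,j).  Applied to the 2-category
   and the 2-representation obtained by injective abelianization, where this
   functor is the left exact extension of its restriction to C(i,j). *)
Record inthom (k : fieldType) (B : bicat k) (R : tworep B) (i j : B)
    (N : R i) (M : R j) := IntHom {
  ihob :> b1 B i j;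
  ihto : forall F : b1 B i j, mor ihob F -> mor M (ractn R F N);
  ihof : forall F : b1 B i j, mor M (ractn R F N) -> mor ihob F;
  ihtoK : forall F, cancel (@ihto F) (@ihof F);
  ihofK : forall F, cancel (@ihof F) (@ihto F);
  ihto_nat : forall (F G : b1 B i j) (f : mor F G) (u : mor ihob F),
    ihto (f \oc u) = bh (ractn R) f (idmor N) \oc ihto u }.
Arguments ihto {k B R i j N M} i0 {F} : rename.
Arguments ihof {k B R i j N M} i0 {F} : rename.

Section InternalHom.
Variables (k : fieldType) (B : bicat k) (R : tworep B) (i : B) (N : R i).

Section Coev.
Variables (j : B) (M : R j) (H : inthom N M).

Definition coev : mor M (ractn R H N) := ihto H (idmor (ihob H)).

Lemma ihtoE (F : b1 B i j) (u : mor (ihob H) F) :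
  ihto H u = bh (ractn R) u (idmor N) \oc coev.
Proof. by rewrite -ihto_nat cmp1r. Qed.

Lemma ihofE (F : b1 B i j) (x : mor M (ractn R F N)) :
  bh (ractn R) (ihof H x) (idmor N) \oc coev = x.
Proof. by rewrite -ihtoE ihofK. Qed.

Lemma ih_inj (F : b1 B i j) (u v : mor (ihob H) F) :
  bh (ractn R) u (idmor N) \oc coev = bh (ractn R) v (idmor N) \oc coev -> u = v.
Proof. by rewrite -!ihtoE => /(can_inj (@ihtoK _ _ _ _ _ _ _ H F)). Qed.

End Coev.

Variable HN : inthom N N.

(* The coaction on Hom(N,M), corresponding to M -> Hom(N,M) N -> Hom(N,M) A^N N. *)
Definition ih_coact j (M : R j) (H : inthom N M) : mor (ihob H) (bcomp H HN) :=
  ihof H (rasc R H HN N \oc (bh (ractn R) (idmor (ihob H)) (coev HN) \oc coev H)).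

(* The counit corresponds to id_N : N -> N = 1N. *)
Definition ih_counit : mor (ihob HN) (bunit B i) := ihof HN (isoV (run R N)).

Lemma ih_coassoc j (M : R j) (H : inthom N M) :
  basc H HN HN \oc (bh bcomp (idmor (ihob H)) (ih_coact HN) \oc ih_coact H) =
  bh bcomp (ih_coact H) (idmor (ihob HN)) \oc ih_coact H.
Proof.
apply: ih_inj; rewrite !bh_cmpl -!cmpA !ihofE.
rewrite [X in _ \oc X]cmpA -rasc_nat -[X in _ \oc X]cmpA.
rewrite [X in _ \oc (_ \oc X)]cmpA -bh_cmpr ihofE [in LHS]bh_cmpr.
rewrite !cmpA -(cmpA _ _ (bh (ractn R) (idmor (ihob H)) (rasc _ _ _ _))) -rpentagon.
rewrite -rasc_nat bh_id -!cmpA; congr (_ \oc _).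
rewrite bh_cmpr [RHS]cmpA -bh_split'.
rewrite (bh_split (ractn R) (ih_coact H)) -[RHS]cmpA ihofE.
by rewrite [RHS]cmpA -[in RHS](bh_id bcomp) -rasc_nat -!cmpA.
Qed.

Lemma ih_counitr j (M : R j) (H : inthom N M) :
  brun H \oc (bh bcomp (idmor (ihob H)) ih_counit \oc ih_coact H) = idmor (ihob H).
Proof.
apply: ih_inj; rewrite !bh_cmpl -!cmpA ihofE.
rewrite [X in _ \oc X]cmpA -rasc_nat -[X in _ \oc X]cmpA.
rewrite [X in _ \oc (_ \oc X)]cmpA -bh_cmpr ihofE [LHS]cmpA rtriangle.
by rewrite cmpA -bh_cmpr isomK.
Qed.

Lemma ih_counitl :
  blun HN \oc (bh bcomp ih_counit (idmor (ihob HN)) \oc ih_coact HN) = idmor (ihob HN).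
Proof.
apply: ih_inj; rewrite !bh_cmpl -!cmpA ihofE.
rewrite [X in _ \oc X]cmpA -rasc_nat -[X in _ \oc X]cmpA [LHS]cmpA rtrianglel.
rewrite bh_id [X in _ \oc X]cmpA -bh_split' (bh_split (ractn R) ih_counit).
rewrite -[X in _ \oc X]cmpA ihofE cmpA run_nat -cmpA isomK.
by rewrite cmp1l cmp1r.
Qed.

Definition ih_coalg : coalg i :=
  Coalg (ih_coassoc HN) ih_counitl (ih_counitr HN).

Definition ih_comod j (M : R j) (H : inthom N M) : comod_ob ih_coalg j :=
  @ComodOb k B i ih_coalg j H (ih_coact H) (ih_coassoc H) (ih_counitr H).

Definition ih_map j (M M' : R j) (H : inthom N M) (H' : inthom N M') (m : mor M M') :
  mor (ihob H) (ihob H') := ihof H (coev H' \oc m).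

Lemma ih_mapP j (M M' : R j) (H : inthom N M) (H' : inthom N M') (m : mor M M') :
  ih_map H H' m \in comod_morphism (ih_comod H) (ih_comod H').
Proof.
apply/eqP => /=; apply: ih_inj; rewrite !bh_cmpl -!cmpA !ihofE.
rewrite [LHS]cmpA ihofE [RHS]cmpA -rasc_nat bh_id -!cmpA; congr (_ \oc _).
by rewrite [RHS]cmpA -bh_split' (bh_split (ractn R) (ih_map H H' m)) -[RHS]cmpA ihofE.
Qed.

Definition theta j (D : lincat k) (J : linfunctor D (R j)) (H : forall X : D, inthom N (J X)) :
  linfunctor D (comod_rep ih_coalg j).
Proof.
exists (fun X => ih_comod (H X) : comod_rep ih_coalg j)
  (fun X Y f => ComodHom (ih_mapP (H X) (H Y) (fh J f))).
- move=> X Y a f g; apply: comod_hom_inj => /=; apply: ih_inj.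
  rewrite bhDl bhZl cmpDl cmpZl !ihofE.
  by rewrite fh_lin cmpDr cmpZr.
- move=> X; apply: comod_hom_inj => /=; apply: ih_inj.
  by rewrite ihofE fh_id cmp1r bh_id cmp1l.
- move=> X Y Z g f; apply: comod_hom_inj => /=; apply: ih_inj.
  by rewrite ihofE bh_cmpl -cmpA ihofE cmpA ihofE fh_cmp cmpA.
Defined.

End InternalHom.

Definition ab_unit_mor (k : fieldType) (C : bicat k) (M : tworep C) :
  repmor M (res (ab_pfun C) (ab_rep M)).
Proof.
unshelve refine (@RepMor k C M (res (ab_pfun C) (ab_rep M))
  (fun i => ab_emb (M i))
  (fun i j F X => @ab_iso _ _ (ab_emb _ (ractn M F X))
     (ab_bifun (ractn M) (ab_emb _ F) (ab_emb _ X)) (iso_id (ractn M F X)) _ _)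
  _ _ _).
- by case.
- by case.
- move=> i j F G X Y f x /=.
  by rewrite !(ab_bifun_homE, abcmpE); apply: abcl_eqg; rewrite /= cmp1l cmp1r.
- move=> i j l F G X /=.
  rewrite !(ab_bifun_homE, abcmpE); apply: abcl_eqg => /=.
  by rewrite !bh_id !cmp1l !cmp1r.
- move=> i X /=.
  rewrite !(ab_bifun_homE, abcmpE); apply: abcl_eqg => /=.
  by rewrite !bh_id !cmp1r.
Defined.

(* The representability that makes [inthom] non-vacuous. *)
Section Representability.
Variable k : fieldType.

Fixpoint in_span (V : lmodType k) (b : seq V) (v : V) : Prop :=
  if b is x :: b' then exists c : k, in_span b' (v - c *: x) else v = 0.

Lemma in_span_sum (V : lmodType k) n (b : 'I_n -> V) (c : 'I_n -> k) :
  in_span [seq b a | a <- enum 'I_n] (\sum_a c a *: b a).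
Proof.
rewrite -[\sum_a _]big_enum /=; elim: (enum _) => [|a s IH] /=; first by rewrite big_nil.
by exists (c a); rewrite big_cons addrAC subrr add0r.
Qed.

Lemma span_sub (V : lmodType k) (b : seq V) (P : V -> Prop) :
  P 0 -> (forall a u v, P u -> P v -> P (a *: u + v)) ->
  (forall v, P v -> in_span b v) ->
  exists l : seq V, (forall v, v \in l -> P v) /\ (forall v, P v -> in_span l v).
Proof.
elim: b P => [|x b IH] P P0 PD Pb; first by exists [::].
have inb0 : in_span b 0 by elim: {IH Pb} b => //= y b IHb; exists 0; rewrite scale0r subr0.
have inbD a u v : in_span b u -> in_span b v -> in_span b (a *: u + v).
  elim: {IH Pb inb0} b u v => [|y b IHb] u v /=; first by move=> -> ->; rewrite scaler0 addr0.
  move=> [c cu] [d dv]; exists (a * c + d); have := IHb _ _ cu dv.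
  by rewrite scalerBr scalerDl scalerA addrACA opprD.
have [||v []//|l [lP Pl]] := IH (fun v => P v /\ in_span b v).
- by split.
- by move=> a u v [Pu bu] [Pv bv]; split; [apply: PD | apply: inbD].
have [[w [c [Pw c0 wc]]]|nw] :=
    pselect (exists w c, [/\ P w, c != 0 & in_span b (w - c *: x)]).
- exists (w :: l); split=> [v|v Pv].
    by rewrite inE => /orP[/eqP ->//|/lP[]].
  have [d vd] := Pb v Pv; exists (d / c); apply: Pl; split.
    by rewrite -scaleNr addrC; apply: PD.
  have := inbD (- (d / c)) _ _ wc vd.
  by rewrite scalerBr scalerA mulNr divfK // !scaleNr opprK addrC addrACA addNr addr0.
- exists l; split=> [v /lP[]//|v Pv]; apply: Pl; split=> //.
  have [d vd] := Pb v Pv; have [d0|d0] := eqVneq d 0.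
    by rewrite d0 scale0r subr0 in vd.
  by case: nw; exists v, d.
Qed.

Section Generation.
Variables (A D : lincat k) (hA : finitary_cat A) (hD : forall X Y : D, finite_dimensional (mor X Y)).

Lemma krull_schmidt n (Z : 'I_n -> A) :
  (forall X : A, indecomposable X -> exists a, inhabited (iso X (Z a))) ->
  forall X : A, exists l : seq {a : 'I_n & (mor (Z a) X * mor X (Z a))%type},
    \sum_(t <- l) (tagged t).1 \oc (tagged t).2 = idmor X.
Proof.
move=> hZ X; have [_ _ _ /(_ X X) [m [b bX]]] := hA.
elim: m X b bX => [|m IH] X b bX.
  by exists [::]; rewrite big_nil; have [c ->] := bX (idmor X); rewrite big_ord0.
have [zX|nzX] := pselect (is_zero X); first by exists [::]; rewrite big_nil.
have [[Y [Y' [[s [s' [r [r' [rs rs' e e' srX]]]]] nY nY']]]|nX] := pselect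
  (exists Y Y', [/\ is_biproduct2 Y Y' X, ~ is_zero Y & ~ is_zero Y']); last first.
  have [|a [u]] := hZ X.
    split=> // Y Y' bi; apply: contrapT => nYY; apply: nX; exists Y, Y'.
    by split=> // z; apply: nYY; [left | right].
  exists [:: Tagged (fun a => (mor (Z a) X * mor X (Z a))%type) (isoV u, isomor u)].
  by rewrite big_seq1 /= isoVK.
have down (U U' : A) (t : mor U X) (t' : mor U' X) (q : mor X U) (q' : mor X U') :
    q \oc t = idmor U -> q' \oc t' = idmor U' -> q \oc t' = 0 -> ~ is_zero U' ->
    exists b' : 'I_m -> mor U U, forall v, exists c, v = \sum_a c a *: b' a.
  move=> qt qt' qt0 nU'.
  have [c cE] := bX (t' \oc q').
  have [a0 ca0] : exists a, c a != 0.
    apply: contrapT => nc; apply: nU'; rewrite /is_zero -qt' -[q']cmp1l -qt'.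
    rewrite -!cmpA [X in _ \oc X]cmpA cE big1 ?cmp0l ?cmp0r // => a _.
    have [->|ca] := eqVneq (c a) 0; first by rewrite scale0r.
    by case: nc; exists a.
  pose p a := q \oc b a \oc t.
  have p0 : \sum_a c a *: p a = 0.
    transitivity (q \oc (t' \oc q') \oc t); last by rewrite cmpA qt0 !cmp0l.
    rewrite cE cmp_sumr cmp_suml; apply: eq_bigr => a _.
    by rewrite cmpZr cmpZl.
  exists (fun a => p (lift a0 a)) => v.
  have [d dE] := bX (t \oc v \oc q).
  exists (fun a => d (lift a0 a) - d a0 / c a0 * c (lift a0 a)).
  have vE : v = \sum_a d a *: p a.
    transitivity (q \oc (t \oc v \oc q) \oc t).
      by rewrite !cmpA qt cmp1l -cmpA qt cmp1r.
    rewrite dE cmp_sumr cmp_suml; apply: eq_bigr => a _.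
    by rewrite cmpZr cmpZl.
  transitivity (\sum_a (d a - d a0 / c a0 * c a) *: p a).
    under [RHS]eq_bigr do rewrite scalerBl -scalerA.
    by rewrite sumrB -scaler_sumr p0 scaler0 subr0.
  by rewrite (bigD1_ord a0) //= divfK // subrr scale0r add0r.
have [b1' bY] := down _ _ _ _ _ _ rs rs' e nY'.
have [b2' bY'] := down _ _ _ _ _ _ rs' rs e' nY.
have [l lY] := IH _ _ bY; have [l' lY'] := IH _ _ bY'.
pose up (U : A) (t : mor U X) (q : mor X U) (w : {a : 'I_n & (mor (Z a) U * mor U (Z a))%type}) :=
  Tagged (fun a => (mor (Z a) X * mor X (Z a))%type) (t \oc (tagged w).1, (tagged w).2 \oc q).
exists ([seq up Y s r w | w <- l] ++ [seq up Y' s' r' w | w <- l']).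
rewrite big_cat !big_map /= -srX -[X in X \oc r]cmp1r -[X in _ + X \oc r']cmp1r -lY -lY'.
by rewrite !cmp_sumr !cmp_suml; congr (_ + _); apply: eq_bigr => w _; rewrite !cmpA.
Qed.

Variables (J : linfunctor A D) (X : D) (P : forall F, mor X (J F) -> Prop).
Hypothesis P0 : forall F, P (0 : mor X (J F)).
Hypothesis PD : forall F a (u v : mor X (J F)), P u -> P v -> P (a *: u + v).
Hypothesis PJ : forall F G (f : mor F G) (u : mor X (J F)), P u -> P (fh J f \oc u).

Lemma generator_seq (T : eqType) (S : T -> A) (x : forall t, mor X (J (S t))) (l : seq T) :
  (forall t, t \in l -> P (x t)) ->
  exists (S0 : A) (x0 : mor X (J S0)), P x0 /\
    forall t, t \in l -> exists g : mor S0 (S t), fh J g \oc x0 = x t.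
Proof.
have [[[Z _] sums] _ _ _] := hA.
elim: l => [|t l IH] Pl; first by exists Z, 0.
have [|S0 [x0 [Px0 gx0]]] := IH; first by move=> u ul; apply: Pl; rewrite inE ul orbT.
have [S1 [s [s' [r [r' [rs rs' e e' _]]]]]] := sums (S t) S0.
exists S1, (1 *: (fh J s \oc x t) + fh J s' \oc x0); split.
  by apply: PD; apply: PJ => //; apply: Pl; rewrite inE eqxx.
move=> u; rewrite inE => /predU1P[->|ul].
  exists r; rewrite scale1r cmpDr !cmpA -!fh_cmp rs e fh_id fh0 cmp1l cmp0l.
  exact: addr0.
have [g gE] := gx0 u ul; exists (g \oc r').
by rewrite scale1r cmpDr !cmpA -!fh_cmp -!cmpA rs' e' cmp0r cmp1r fh0 cmp0l add0r.
Qed.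

Lemma weak_generator : exists (S : A) (x : mor X (J S)), P x /\
  forall F (y : mor X (J F)), P y -> exists g : mor S F, fh J g \oc x = y.
Proof.
have [_ _ [n [Z hZ]] _] := hA.
have KS := krull_schmidt hZ.
have genZ a : exists S : {S : A & mor X (J S)}, P (tagged S) /\
    forall y : mor X (J (Z a)), P y -> exists g : mor (tag S) (Z a), fh J g \oc tagged S = y.
  have [m [b bE]] := hD X (J (Z a)).
  have [|l [lP Pl]] := span_sub (b := [seq b c | c <- enum 'I_m]) (P0 (Z a)) (@PD (Z a)).
    by move=> v _; have [c ->] := bE v; apply: in_span_sum.
  have [S [x [Px gx]]] := generator_seq (S := fun=> Z a) (x := id) lP.
  exists (Tagged (fun S => mor X (J S)) x); split=> //= y Py.
  have {Py} := Pl y Py; elim: {lP Pl} l y gx => [|v l IH] y gx /=.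
    by move=> ->; exists 0; rewrite fh0 cmp0l.
  move=> [c yc].
  have [|g gE] := IH _ _ yc; first by move=> t tl; apply: gx; rewrite inE tl orbT.
  have [g' g'E] := gx v (mem_head v l).
  by exists (c *: g' + g); rewrite fh_lin cmpDl cmpZl gE g'E addrC subrK.
pose Sx a := sval (cid (genZ a)).
have SxP a : P (tagged (Sx a)) by exact: (proj1 (svalP (cid (genZ a)))).
have Sxg a y : P y -> exists g : mor (tag (Sx a)) (Z a), fh J g \oc tagged (Sx a) = y.
  exact: (proj2 (svalP (cid (genZ a)))).
have [|S [x [Px gx]]] := generator_seq (S := fun a => tag (Sx a))
  (x := fun a => tagged (Sx a)) (l := enum 'I_n); first by move=> a _; apply: SxP.
exists S, x; split=> // F y Py; have [l lE] := KS F.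
have -> : y = \sum_(t <- l) fh J ((tagged t).1 \oc (tagged t).2) \oc y.
  by rewrite -cmp_suml -fh_sum lE fh_id cmp1l.
elim: l {lE} => [|t l [g gE]].
  by exists 0; rewrite big_nil fh0 cmp0l.
rewrite big_cons -gE.
have [g1 g1E] := Sxg (tag t) _ (PJ (tagged t).2 Py).
have [g2 g2E] := gx (tag t) (mem_enum _ _).
exists ((tagged t).1 \oc (g1 \oc g2) + g).
by rewrite fhD cmpDl; congr (_ + _); rewrite !fh_cmp -!cmpA g2E g1E.
Qed.

End Generation.

Definition bh_fixr (A B D : lincat k) (T : bifun A B D) (Y : B) : linfunctor A D.
Proof.
exists (fun X => T X Y) (fun X X' f => bh T f (idmor Y)).
- by move=> X X' a f f'; rewrite bh_linl.
- by move=> X; rewrite bh_id.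
- by move=> X X' X'' f' f; rewrite bh_cmpl.
Defined.

Variables (C : bicat k) (M : tworep C).

Lemma inthom_exists (hC : finitary_bicat C) (hM : finitary_rep M) (i j : C)
    (N : M i) (X : M j) :
  inhabited (@inthom k (ab_bicat C) (ab_rep M) i j (ab_emb (M i) N) (ab_emb (M j) X)).
Proof.
have [_ fC _] := hC.
have fdM (Y Y' : M j) : finite_dimensional (mor Y Y') by have [] := hM j.
have fdC (F F' : b1 C i j) : finite_dimensional (mor F F') by have [] := fC i j.
have [S [x [_ gx]]] := @weak_generator _ _ (fC i j) fdM (bh_fixr (ractn M) N) X
  (fun _ _ => True) (fun _ => I) (fun _ _ _ _ _ _ => I) (fun _ _ _ _ _ => I).
have [|||Y [f [fx gf]]] := weak_generator (fC i j) fdC (J := linfunctor_id (b1 C i j)) (X := S)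
  (P := fun F g => bh (ractn M) g (idmor N) \oc x = 0).
- by move=> F; rewrite bh0l cmp0l.
- by move=> F a u v ux vx; rewrite bhDl bhZl cmpDl cmpZl ux vx scaler0 addr0.
- by move=> F G f u ux /=; rewrite bh_cmpl -cmpA ux cmp0r.
pose Q : ab (b1 C i j) := @AbOb k _ S 1 (fun=> Y) (fun=> f).
have xP : forall c, abf (ab_bifun (ractn M) Q (ab_emb (M i) N)) c \oc x =
    \sum_(a < 0) (0 : mor X _) \oc (0 : mor X X).
  by move=> c; rewrite big_ord0 /=; case: (split c) => [[]|].
pose co : mor (ab_emb (M j) X : ab (M j)) (ab_bifun (ractn M) Q (ab_emb (M i) N)) :=
  abcl (@AbPre k (M j) (ab_emb (M j) X) (ab_bifun (ractn M) Q (ab_emb (M i) N))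
    x (fun _ _ => 0) xP).
pose to (F : ab (b1 C i j)) (u : mor Q F) := bh (ab_bifun (ractn M)) u (idmor _) \oc co.
have to_inj F (u v : mor Q F) : to F u = to F v -> u = v.
  move=> uv; apply/subr0_eq; have {uv} : to F (u - v) = 0.
    by rewrite /to -scaleN1r addrC bh_linl cmpDl cmpZl -/(to F u) uv scaleN1r addNr.
  elim/abcl_ind: (u - v) => p; rewrite /to.
  rewrite /= ab_bifun_homE abcmpE => /eqmodP/ab_relP /= [q].
  rewrite big_ord0 subr0 => /esym /(gf _ (abg p)) [h hE]; apply: abcl_eq.
  by exists (fun=> h); rewrite big_ord1 /= subr0.
have to_surj F y : exists u, to F u = y.
  elim/abcl_ind: y => w; have [g gE] := gx _ (abg w) I.
  have hf b : exists h : mor Y (abY F b), h \oc f = abf F b \oc g.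
    apply: gf; rewrite bh_cmpl -cmpA -[X in _ \oc X]/(fh (bh_fixr (ractn M) N) g \oc x) gE.
    have := abP w (rshift 0 b); rewrite big_ord0 /=.
    by rewrite split_rshift.
  have pP b : abf F b \oc g = \sum_(a < 1) sval (cid (hf b)) \oc f.
    by rewrite big_ord1; case: (cid _).
  exists (abcl (@AbPre k _ Q F g (fun _ b => sval (cid (hf b))) pP)).
  by rewrite /to /= ab_bifun_homE abcmpE; apply: abcl_eqg.
split; exists Q to (fun F y => sval (cid (to_surj F y))).
- by move=> F u; apply: to_inj; case: (cid _).
- by move=> F y; case: (cid _).
- by move=> F G g u; rewrite /to bh_cmpl cmpA.
Qed.

End Representability.

(* Both are 2-representations of C through the embedding of C into its
   abelianization, F |-> (F,0,0,0). *)
Definition ab_rep_res (k : fieldType) (C : bicat k) (M : tworep C) : tworep C :=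
  res (ab_pfun C) (ab_rep M).

Definition comod_rep_res (k : fieldType) (C : bicat k) (i : C)
    (A : @coalg k (ab_bicat C) i) : tworep C :=
  res (ab_pfun C) (comod_rep A).

(* Internal homs between objects of M, identified with objects of its
   abelianization. *)
Definition ihom (k : fieldType) (C : bicat k) (M : tworep C) (i j : C)
    (N : M i) (X : M j) :=
  @inthom k (ab_bicat C) (ab_rep M) i j (ab_emb (M i) N) (ab_emb (M j) X).

(* Main.v *)
(* Write H for Hom(N,-) and A for H N.  The abelianization needs no exactness
   hypotheses: the kernel of P -> (Q_a)_a is P with the components (Q_a)_0 adjoined,
   and every functor X |-> X F, F an object of an abelianization, preserves these
   formal kernels.  As the objects of C(i,j) are injective, the kernel of
   H K_0 -> (H Y_a)_a represents F |-> Hom(K,FN) for each K = (K_0; Y_a, f_a), so H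
   extends to the abelianization of M and the extension turns the copresentation
   of K into a kernel.

   An adjunction between F and F^* gives H(FK) = F H(K) for F in C, and so H(FN) is
   the cofree comodule F A, whence
     Hom(K,FN) = Hom(H K,F) = Hom_A(H K,F A) = Hom_A(H K,H(FN)).
   By transitivity and a count of the indecomposables each object of M is a
   summand of some FN, so H is fully faithful, first into objects of M and then, by
   kernels, in general.  A comodule X is the kernel of a map between cofree
   comodules on objects of C; these are values of H, and so is X. *)
Require Import Defs.
From mathcomp Require Import all_boot all_algebra.
From mathcomp Require Import boolp.

Set Implicit Arguments.
Unset Strict Implicit.
Unset Printing Implicit Defensive.

Import GRing.Theory.
Local Open Scope ring_scope.
Local Open Scope quotient_scope.
Local Open Scope lincat_scope.

(** * Equivalences of linear categories and joint kernels *)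

Section Equivalences.
Variables (k : fieldType).
Implicit Types A B : lincat k.

Definition fully_faithful A B (F : linfunctor A B) : Prop :=
  forall X Y (g : mor (F X) (F Y)), exists! f : mor X Y, fh F f = g.

Definition essentially_surjective A B (F : linfunctor A B) : Prop :=
  forall Y, exists X, inhabited (iso (F X) Y).

Lemma ff_full A B (F : linfunctor A B) X Y (g : mor (F X) (F Y)) :
  fully_faithful F -> exists f : mor X Y, fh F f = g.
Proof. by move=> /(_ X Y g) [f [fg _]]; exists f. Qed.

Lemma ff_faithful A B (F : linfunctor A B) X Y (f f' : mor X Y) :
  fully_faithful F -> fh F f = fh F f' -> f = f'.
Proof. by move=> /(_ X Y (fh F f')) [f0 [_ uf0]] ff'; rewrite -(uf0 f) // -(uf0 f'). Qed.

Lemma iso_choice A B (F : linfunctor A B) :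
  essentially_surjective F -> exists G : B -> A, inhabited (forall Y, iso (F (G Y)) Y).
Proof.
move=> esF; exists (fun Y => sval (cid (esF Y))); split=> Y.
by have [v _] := cid (P := fun _ : iso _ _ => True)
  (let: inhabits v := svalP (cid (esF Y)) in ex_intro _ v I).
Qed.

Lemma ff_es_equivalence A B (F : linfunctor A B) :
  fully_faithful F -> essentially_surjective F -> cat_equivalence F.
Proof.
move=> ffF esF.
have [pre [u]] := iso_choice esF.
pose lift X Y (g : mor (F X) (F Y)) := sval (cid (ff_full g ffF)).
have liftK X Y (g : mor (F X) (F Y)) : fh F (lift X Y g) = g by rewrite /lift; case: (cid _).
have inj X Y (f f' : mor X Y) : fh F f = fh F f' -> f = f' by exact: ff_faithful.
pose Gh Y Y' (g : mor Y Y') := lift _ _ (isoV (u Y') \oc (g \oc u Y)).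
have Ghlin Y Y' : linear (@Gh Y Y').
  by move=> a g g'; apply: inj; rewrite fh_lin !liftK cmpDl cmpZl cmpDr cmpZr.
have Gh1 Y : Gh _ _ (idmor Y) = idmor (pre Y).
  by apply: inj; rewrite liftK fh_id cmp1l isoVK.
have Ghcmp Y Y' Y'' (g : mor Y' Y'') (g' : mor Y Y') :
    Gh _ _ (g \oc g') = Gh _ _ g \oc Gh _ _ g'.
  apply: inj; rewrite fh_cmp !liftK -!cmpA; congr (_ \oc (_ \oc _)).
  by rewrite [RHS]cmpA isomK cmp1l.
have unit1 X : lift _ _ (isoV (u (F X))) \oc lift _ _ (u (F X)) = idmor (pre (F X)).
  by apply: inj; rewrite fh_cmp !liftK isoVK fh_id.
have unit2 X : lift _ _ (u (F X) : mor (F _) _) \oc lift _ _ (isoV (u (F X))) = idmor X.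
  by apply: inj; rewrite fh_cmp !liftK isomK fh_id.
exists (LinFun Ghlin Gh1 Ghcmp); split; last first.
  by exists u => X Y f /=; rewrite liftK !cmpA isomK cmp1l.
exists (fun X => Iso (unit1 X) (unit2 X)) => X Y f /=.
by apply: inj; rewrite /= !fh_cmp !liftK !cmpA isomK cmp1l.
Qed.

Lemma equivalence_faithful A B (F : linfunctor A B) X Y (f f' : mor X Y) :
  cat_equivalence F -> fh F f = fh F f' -> f = f'.
Proof.
move=> [G [[t tn] _]] ff'; apply: (iso_injr (u := t X)).
by rewrite -[LHS](tn _ _ f) -[RHS](tn _ _ f') /= ff'.
Qed.

Lemma equivalence_es A B (F : linfunctor A B) :
  cat_equivalence F -> essentially_surjective F.
Proof. by move=> [G [_ [t _]]] Y; exists (G Y); split; apply: t. Qed.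

(** The kernel of the morphism from [X] to the product of the [Q a], without forming that
    product. *)
Definition joint_kernel A (I : Type) (X : A) (Q : I -> A) (f : forall a, mor X (Q a))
    K (i : mor K X) : Prop :=
  [/\ forall a, f a \oc i = 0, monomorphism i
    & forall W (g : mor W X), (forall a, f a \oc g = 0) -> exists u, i \oc u = g].

Lemma mono_cmp A (X Y Z : A) (n : mor Y Z) (m : mor X Y) :
  monomorphism n -> monomorphism m -> monomorphism (n \oc m).
Proof. by move=> hn hm W u v; rewrite -!cmpA => /hn/hm. Qed.

Lemma iso_mono A (X Y : A) (u : iso X Y) : monomorphism u.
Proof. by move=> W f g; apply: iso_injl. Qed.
Arguments iso_mono {A X Y} u.

Lemma split_mono A (X Y : A) (m : mor X Y) (r : mor Y X) :
  r \oc m = idmor X -> monomorphism m.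
Proof. by move=> rm W u v /(congr1 (cmp r)); rewrite !cmpA rm !cmp1l. Qed.

Lemma joint_kernel_unique A (I : Type) (X : A) (Q : I -> A) (f : forall a, mor X (Q a))
    K K' (i : mor K X) (i' : mor K' X) :
  joint_kernel f i -> joint_kernel f i' -> exists u : iso K K', i' \oc u = i.
Proof.
move=> [fi mi ki] [fi' mi' ki'].
have [u iu] := ki' _ _ fi; have [v iv] := ki _ _ fi'.
have vu : v \oc u = idmor K by apply: mi; rewrite cmpA iv iu cmp1r.
have uv : u \oc v = idmor K' by apply: mi'; rewrite cmpA iu iv cmp1r.
by exists (Iso vu uv).
Qed.

(** The complement of [Y] is obtained by splitting the idempotent [idmor S - s \oc r]. *)
Lemma retract_summand A (hA : finitary_cat A) (Y S : A)
    (s : mor Y S) (r : mor S Y) :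
  r \oc s = idmor Y -> exists Y', is_biproduct2 Y Y' S.
Proof.
have [_ split_idem _ _] := hA => rs.
pose e := idmor S - s \oc r.
have se : e \oc s = 0 by rewrite cmpDl cmpNl -cmpA rs cmp1l cmp1r subrr.
have re : r \oc e = 0 by rewrite cmpDr cmpNr cmpA rs cmp1l cmp1r subrr.
have [|Y' [r' [s' [rs' sr']]]] := split_idem S e.
  by rewrite {2}/e cmpDr cmpNr cmp1r cmpA se cmp0l subr0.
exists Y', s, s', r, r'; split=> //.
- by rewrite -[s']cmp1r -rs' (cmpA s') sr' cmpA re cmp0l.
- by rewrite -[r']cmp1l -rs' -(cmpA r') sr' -cmpA se cmp0r.
- by rewrite sr' addrC subrK.
Qed.

Section FullyFaithful.
Variables (A B : lincat k) (F : linfunctor A B).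
Hypotheses (ffF : fully_faithful F) (esF : essentially_surjective F).

(** Essential surjectivity replaces a test object by one in the image of [F], and full faithfulness
    moves the universal property back to [A]. *)
Lemma ff_es_left_exact : left_exact F.
Proof.
move=> X Y f K i [fi ki]; split; first by rewrite -fh_cmp fi fh0.
move=> W g fg; have [W' [w]] := esF W.
have [g' g'E] := ff_full (g \oc w) ffF.
have [|u [iu uu]] := ki W' g'.
  by apply: ff_faithful ffF _; rewrite fh_cmp g'E cmpA fg cmp0l fh0.
exists (fh F u \oc isoV w); split.
  by rewrite cmpA -fh_cmp iu g'E -cmpA isomK cmp1r.
move=> v iv; have [v' v'E] := ff_full (v \oc w) ffF.
rewrite (uu v'); first by rewrite v'E -cmpA isomK cmp1r.
by apply: ff_faithful ffF _; rewrite fh_cmp v'E cmpA iv g'E.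
Qed.

Lemma ff_es_mono X Y (m : mor X Y) : monomorphism m -> monomorphism (fh F m).
Proof.
move=> mm W u v uv; have [W' [w]] := esF W; apply: (iso_injr (u := w)).
have [u' u'E] := ff_full (u \oc w) ffF; have [v' v'E] := ff_full (v \oc w) ffF.
rewrite -u'E -v'E; congr (fh F _); apply: mm; apply: ff_faithful ffF _.
by rewrite !fh_cmp u'E v'E !cmpA uv.
Qed.

Lemma ff_reflect_mono X Y (m : mor X Y) : monomorphism (fh F m) -> monomorphism m.
Proof.
move=> mm W u v uv; apply: ff_faithful ffF _; apply: mm.
by rewrite -!fh_cmp uv.
Qed.

Lemma ff_es_injective X : injective_ob X -> injective_ob (F X).
Proof.
move=> inX Y Z m g mm; have [Y' [u]] := esF Y; have [Z' [v]] := esF Z.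
have [m' m'E] := ff_full (isoV v \oc (m \oc u)) ffF.
have [g' g'E] := ff_full (g \oc u) ffF.
have [|t tm] := inX _ _ m' g'.
  apply: ff_reflect_mono; rewrite m'E; apply: mono_cmp; first exact: (iso_mono (iso_sym v)).
  by apply: mono_cmp => //; apply: iso_mono.
exists (fh F t \oc isoV v); apply: (iso_injr (u := u)).
by rewrite -!cmpA -m'E -fh_cmp tm g'E.
Qed.

Lemma ff_es_reflect_injective X : injective_ob (F X) -> injective_ob X.
Proof.
move=> inX Y Z m g mm; have [t tm] := inX _ _ _ (fh F g) (ff_es_mono mm).
have [t' t'E] := ff_full t ffF; exists t'.
by apply: ff_faithful ffF _; rewrite fh_cmp t'E.
Qed.

End FullyFaithful.

End Equivalences.
Arguments iso_mono {k A X Y} u.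

(** * Morphisms, kernels and injective objects of the abelianization *)

Section AbObjects.
Variables (k : fieldType) (A : lincat k).
Implicit Types (P Q W : abob A) (X Y : A).

(* The morphisms W -> Q of the abelianization are the g : W_0 -> Q_0 all of whose
   composites with the maps of Q vanish on W, modulo those which vanish on W. *)
Definition vanishes W X (g : mor (abX W) X) : Prop := ab_null (Q := ab_emb_ob X) g.

Lemma vanishes0 W X : vanishes (0 : mor (abX W) X).
Proof. exact: ab_null0. Qed.

Lemma vanishes_cmpl W X Y (f : mor X Y) (g : mor (abX W) X) :
  vanishes g -> vanishes (f \oc g).
Proof. exact: (ab_null_cmpl (Q := ab_emb_ob X) (R := ab_emb_ob Y)). Qed.

Lemma vanishes_abP W Q (u : abpre W Q) b : vanishes (abf Q b \oc abg u).
Proof. by exists (fun a => abh u a b); rewrite abP. Qed.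

Lemma vanishes_abf W b : vanishes (abf W b).
Proof.
by exists (fun a => abh (abpre_id W) a b); rewrite -abP cmp1r.
Qed.

(** The components [abh] are chosen as witnesses of vanishing, so a morphism can be built from its
    first component alone. *)
Lemma abpre_exists W Q (g : mor (abX W) (abX Q)) :
  (forall b, vanishes (abf Q b \oc g)) -> exists u : abpre W Q, abg u = g.
Proof.
move=> vg; pose h b := cid (vg b).
have hP b : abf Q b \oc g = \sum_a sval (h b) a \oc abf W a by rewrite (svalP (h b)).
by exists (AbPre hP).
Qed.

Lemma abcl_inj W Q (u v : abpre W Q) :
  abcl u = abcl v -> vanishes (abg u - abg v).
Proof. by move/eqmodP/ab_relP. Qed.

Lemma abcl0_vanishes W Q (u : abpre W Q) :
  abcl u = 0 -> vanishes (abg u).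
Proof. by move/(@abcl_inj _ _ u (abpre0 W Q)); rewrite subr0. Qed.

Lemma vanishes_abcl0 W Q (u : abpre W Q) :
  vanishes (abg u) -> abcl u = 0.
Proof. by move=> vu; apply: (@abcl_eq _ _ _ _ u (abpre0 W Q)); rewrite subr0. Qed.

Lemma abmor_ind W Q (R : mor (W : ab A) (Q : ab A) -> Prop) :
  (forall u, R (abcl u)) -> forall x, R x.
Proof. exact: abcl_ind. Qed.

(** A retraction of first components suffices, even if it is no morphism of tuples: morphisms are
    compared modulo vanishing maps, and these are stable under composition with [r]. *)
Lemma ab_mono_split P Q (i : abpre P Q) (r : mor (abX Q) (abX P)) :
  r \oc abg i = idmor (abX P) -> monomorphism (abcl i : mor (P : ab A) (Q : ab A)).
Proof.
move=> ri W u v; elim/abmor_ind: u => u; elim/abmor_ind: v => v.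
rewrite [LHS]abcmpE [RHS]abcmpE => /abcl_inj /= /(@vanishes_cmpl _ _ _ r).
by rewrite cmpDr cmpNr !cmpA ri !cmp1l => uv; apply: abcl_eq.
Qed.

Lemma ab_can_subproof P b :
  abf (ab_emb_ob (abX P)) b \oc idmor (abX P) = \sum_(a < abk P) 0 \oc abf P a.
Proof. by case: b. Qed.

(** The embedding of [P] into its first component, with which the copresentation of [P] by the maps
    [abf P b] begins. *)
Definition ab_can P : mor (P : ab A) (ab_emb A (abX P)) :=
  abcl (AbPre (@ab_can_subproof P)).

Lemma ab_can_mono P : monomorphism (ab_can P).
Proof.
by apply: (@ab_mono_split P (ab_emb_ob (abX P)) _ (idmor (abX P))); rewrite cmp1l.
Qed.

Lemma ab_can_kernel P :
  joint_kernel (fun b => fh (ab_emb A) (abf P b)) (ab_can P).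
Proof.
split=> [b||W].
- rewrite [LHS]abcmpE; apply: vanishes_abcl0 => /=; rewrite cmp1r.
  exact: vanishes_abf.
- exact: ab_can_mono.
- elim/abmor_ind => g gP; have [|u ug] := @abpre_exists W P (abg g).
    move=> b; have := gP b; rewrite [LHS]abcmpE => /abcl0_vanishes; exact.
  by exists (abcl u); rewrite [LHS]abcmpE; apply: abcl_eqg; rewrite /= cmp1l.
Qed.

Lemma ab_emb_extend P X (y : mor (P : ab A) (ab_emb A X)) :
  exists g : mor (abX P) X, y = fh (ab_emb A) g \oc ab_can P.
Proof.
elim/abmor_ind: y => y; exists (abg y).
by rewrite [RHS]abcmpE; apply: abcl_eqg; rewrite /= cmp1r.
Qed.

Lemma ab_emb_faithful X Y (f g : mor X Y) :
  fh (ab_emb A) f = fh (ab_emb A) g -> f = g.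
Proof.
by move/abcl_inj => [q]; rewrite big_ord0 => /esym /subr0_eq.
Qed.

Lemma ab_emb_full X Y (y : mor (ab_emb A X) (ab_emb A Y)) :
  exists g : mor X Y, y = fh (ab_emb A) g.
Proof.
have [g ->] := ab_emb_extend y; exists g.
by rewrite [LHS]abcmpE; apply: abcl_eqg; rewrite /= cmp1r.
Qed.

Lemma ab_can_vanishes P X (g : mor (abX P) X) :
  fh (ab_emb A) g \oc ab_can P = 0 ->
  exists q : forall a, mor (abY P a) X, g = \sum_a q a \oc abf P a.
Proof.
by rewrite [X in X = _]abcmpE => /abcl0_vanishes /= [q]; rewrite cmp1r => <-; exists q.
Qed.

Section FormalKernel.
Variables (P : abob A) (n : nat) (Q : 'I_n -> abob A) (m : forall a, abpre P (Q a)).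

Definition jk_Y (s : 'I_(abk P) + 'I_n) : A :=
  match s with inl b => abY P b | inr a => abX (Q a) end.

Definition jk_f (s : 'I_(abk P) + 'I_n) : mor (abX P) (jk_Y s) :=
  match s with inl b => abf P b | inr a => abg (m a) end.

Definition jk_ob : abob A := AbOb (fun c : 'I_(abk P + n) => jk_f (split c)).

Lemma jk_vanishes W X (g : mor X (abX P)) (R : forall Y, mor X Y -> Prop) :
  (forall b, R _ (abf P b \oc g)) -> (forall a, R _ (abg (m a) \oc g)) ->
  forall c, R _ (abf jk_ob c \oc g).
Proof. by move=> Rb Ra c /=; case: (split c) => [b|a] /=. Qed.

Lemma jk_inc_vanishes b : vanishes (W := jk_ob) (abf P b \oc idmor (abX P)).
Proof.
rewrite cmp1r; have := @vanishes_abf jk_ob (lshift n b).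
by rewrite /= split_lshift.
Qed.

Definition jk_inc : abpre jk_ob P := sval (cid (abpre_exists jk_inc_vanishes)).

Lemma jk_incE : abg jk_inc = idmor (abX P).
Proof. by rewrite /jk_inc; case: (cid _). Qed.

Lemma jk_kernel : joint_kernel (fun a => abcl (m a) : mor (P : ab A) (Q a : ab A))
  (abcl jk_inc : mor (jk_ob : ab A) (P : ab A)).
Proof.
split=> [a||W].
- rewrite [LHS]abcmpE; apply: vanishes_abcl0; rewrite /= jk_incE cmp1r.
  have := @vanishes_abf jk_ob (rshift _ a).
  by rewrite /= split_rshift.
- by apply: (@ab_mono_split jk_ob P _ (idmor (abX P))); rewrite jk_incE cmp1l.
- elim/abmor_ind => g gP; have [|u ug] := @abpre_exists W jk_ob (abg g).
    apply: (jk_vanishes W (R := fun Y f => vanishes (X := Y) f)).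
      exact: vanishes_abP.
    by move=> a; have := gP a; rewrite [LHS]abcmpE => /abcl0_vanishes.
  by exists (abcl u); rewrite [LHS]abcmpE; apply: abcl_eqg; rewrite /= jk_incE cmp1l.
Qed.

End FormalKernel.

Lemma ab_kernel_exists (P : ab A) n (Q : 'I_n -> ab A) (m : forall a, mor P (Q a)) :
  exists (K : ab A) (i : mor K P), joint_kernel m i.
Proof.
exists (jk_ob (fun a => repr (m a : abhom _ _))), (abcl (jk_inc _)).
have := jk_kernel (fun a => repr (m a : abhom _ _)).
rewrite (_ : (fun a => abcl _) = m) //.
by apply: functional_extensionality_dep => a; apply: reprK.
Qed.

(** The formal kernel of a monomorphism [m] is zero, so the identity of the first component of [P]
    is a sum of maps through the [abf P b] and of one through [m]. After composition with [g] the
    former vanish on [P] and the latter gives the extension. *)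
Lemma ab_emb_injective X : injective_ob (ab_emb A X).
Proof.
move=> P Q; elim/abmor_ind => m; elim/abmor_ind => g mm.
pose K := jk_ob (fun _ : 'I_1 => m).
have [mi _ _] := jk_kernel (fun _ : 'I_1 => m).
have : abcl (jk_inc (fun _ : 'I_1 => m)) = 0 :> mor (K : ab A) (P : ab A).
  by apply: mm; rewrite (mi ord0) cmp0r.
move/abcl0_vanishes; rewrite jk_incE => -[q qE].
have [t tP] : exists t : mor (abX Q) X, vanishes (W := P) (abg g - t \oc abg m).
  rewrite -[abg g]cmp1r -qE cmp_sumr; apply: (big_ind (fun y =>
    exists t : mor (abX Q) X, vanishes (W := P) (y - t \oc abg m))).
  - by exists 0; rewrite cmp0l subr0; apply: vanishes0.
  - move=> y y' [t tP] [t' tP']; exists (t + t').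
    by rewrite cmpDl opprD addrACA; apply: ab_nullD.
  - move=> c _; rewrite cmpA; move: (abg g \oc q c) => {mi q qE} /=.
    case: (split c) => [b|a] r /=; last by exists r; rewrite subrr; apply: vanishes0.
    by exists 0; rewrite cmp0l subr0; apply: vanishes_cmpl; apply: vanishes_abf.
have [|u uE] := @abpre_exists Q (ab_emb_ob X) t; first by case.
exists (abcl u); rewrite [LHS]abcmpE; apply: abcl_eq.
by rewrite /= uE -[_ - _]opprB; apply: ab_nullN.
Qed.

(** The first component of a retraction of [ab_can P] has zero composites with the [abf P b]. It is
    therefore an idempotent of [A], and splitting it yields the object. *)
Lemma ab_injective_emb (hA : finitary_cat A) (P : ab A) :
  injective_ob P -> exists X, inhabited (iso (ab_emb A X) P).
Proof.
move=> inP; have [r rE] := inP _ _ _ (idmor P) (@ab_can_mono P).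
have [_ split_idem _ _] := hA.
elim/abmor_ind: r rE => r; rewrite [LHS]abcmpE => /abcl_inj /=; rewrite cmp1r => rv.
have fr b : abf P b \oc abg r = 0.
  by have [q] := vanishes_abP r b; rewrite big_ord0.
have rr : abg r \oc abg r = abg r.
  have [q qE] := rv; move: (congr1 (fun f => f \oc abg r) qE).
  rewrite /= cmp_suml big1 => [|a _]; last by rewrite -cmpA fr cmp0r.
  by rewrite cmpDl cmpNl cmp1l => /esym /subr0_eq.
have [X [p [s [ps sp]]]] := split_idem _ _ rr.
have fs b : abf P b \oc s = 0.
  by rewrite -[s]cmp1r -ps cmpA sp cmpA fr cmp0l.
have [b|u uE] := @abpre_exists (ab_emb_ob X) P s.
  by rewrite fs; apply: vanishes0.
have [|v vE] := @abpre_exists P (ab_emb_ob X) p; first by case.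
have vu : (abcl v : mor P (ab_emb A X)) \oc abcl u = idmor _.
  by rewrite [LHS]abcmpE; apply: abcl_eqg; rewrite /= vE uE.
have uv : (abcl u : mor (ab_emb A X) P) \oc abcl v = idmor _.
  by rewrite [LHS]abcmpE; apply: abcl_eq; rewrite /= vE uE sp.
by exists X; split; exists (abcl u) (abcl v).
Qed.

End AbObjects.

(** * Kernels under an abelianized bifunctor *)

Section AbBifunctor.
Variables (k : fieldType) (A B D : lincat k) (T : bifun A B D).

(* Both K T S and the formal kernel of P T S -> (Q_a T S)_a have the object
   P_0 T S_0 as first component, whence no exactness hypothesis is needed. *)
Lemma ab_bifun_formal_kernel (P : ab A) (S : ab B) n (Q : 'I_n -> ab A)
    (m : forall a, abpre P (Q a)) :
  joint_kernel
    (fun a => bh (ab_bifun T) (abcl (m a) : mor P (Q a)) (idmor S))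
    (bh (ab_bifun T) (abcl (jk_inc m) : mor (jk_ob m : ab A) P) (idmor S)).
Proof.
split=> [a||W].
- have [mi _ _] := jk_kernel m.
  by rewrite -bh_cmpl mi bh0l.
- rewrite [bh _ _ _]ab_bifun_homE.
  apply: (@ab_mono_split _ _ (ab_bifun_ob T (jk_ob m) S) (ab_bifun_ob T P S) _
    (idmor (T (abX P) (abX S)))).
  by rewrite /= jk_incE cmp1l bh_id.
- elim/abmor_ind => g gP.
  have [|u ug] := @abpre_exists _ _ W (ab_bifun_ob T (jk_ob m) S) (abg g).
    move=> c /=; case: (split c) => [b|d] /=.
      have := vanishes_abP g (lshift _ b); rewrite /= split_lshift; exact.
    move: d => /=; suff vg (s : 'I_(abk P) + 'I_n) :
        vanishes (bh T (jk_f m s) (idmor (abX S)) \oc abg g) by move=> d; apply: vg.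
    case: s => [b|a] /=.
      have := vanishes_abP g (rshift _ b); rewrite /= split_rshift; exact.
    have := gP a; rewrite [bh _ _ _]ab_bifun_homE [LHS]abcmpE => /abcl0_vanishes.
    exact.
  exists (abcl u); rewrite [bh _ _ _]ab_bifun_homE [LHS]abcmpE; apply: abcl_eqg.
  by rewrite /= jk_incE bh_id cmp1l.
Qed.

(** Every joint kernel is isomorphic to the formal one, which the bifunctor preserves. *)
Lemma ab_bifun_kernel (P : ab A) (S : ab B) n (Q : 'I_n -> ab A)
    (m : forall a, mor P (Q a)) K (i : mor K P) :
  joint_kernel m i ->
  joint_kernel (fun a => bh (ab_bifun T) (m a) (idmor S)) (bh (ab_bifun T) i (idmor S)).
Proof.
move=> ki; have mE : m = (fun a => abcl (repr (m a : abhom _ _))).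
  by apply: functional_extensionality_dep => a; apply/esym/reprK.
have := ab_bifun_formal_kernel S (fun a => repr (m a : abhom _ _)).
have := jk_kernel (fun a => repr (m a : abhom _ _)).
rewrite -mE => ki'; have [u uE] := joint_kernel_unique ki ki'.
move=> [fi mi ex]; split.
- by move=> a; rewrite -bh_cmpl (let: And3 mi0 _ _ := ki in mi0) bh0l.
- rewrite -uE bh_cmpl; apply: mono_cmp; first by rewrite mE in mi *.
  exact: (iso_mono (bh_iso (ab_bifun T) u (iso_id S))).
- move=> W g gP; have [|v vE] := ex W g; first by move=> a; rewrite -[RHS](gP a) {2}mE.
  exists (bh (ab_bifun T) (isoV u) (idmor S) \oc v).
  by rewrite cmpA -bh_cmpl -uE -cmpA isomK cmp1r.
Qed.

(** The formal kernel of [m] has zero inclusion, and this stays zero after applying the bifunctor;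
    the difference [u - v] factors through it. *)
Lemma ab_bifun_mono (P Q : ab A) (S : ab B) (m : mor P Q) :
  monomorphism m -> monomorphism (bh (ab_bifun T) m (idmor S)).
Proof.
elim/abmor_ind: m => m mm W u v /eqP; rewrite -subr_eq0 -cmpNr -cmpDr => /eqP uv.
have [mi _ _] := jk_kernel (fun _ : 'I_1 => m).
have i0 : abcl (jk_inc (fun _ : 'I_1 => m)) = 0 :> mor (jk_ob _ : ab A) P.
  by apply: mm; rewrite (mi ord0) cmp0r.
have [_ _ ex] := ab_bifun_formal_kernel S (fun _ : 'I_1 => m).
have [|w] := ex _ (u - v); first by move=> _.
by rewrite i0 bh0l cmp0l => /esym /subr0_eq.
Qed.

End AbBifunctor.

(** * Retracts of the objects FN in a transitive 2-representation *)

Section Transitivity.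
Variables (k : fieldType) (C : bicat k) (M : tworep C).
Hypotheses (hC : finitary_bicat C) (hM : finitary_rep M) (hT : transitive_rep M).
Variables (i : C) (N : M i) (hN : ~ is_zero N) (j : C).

(** These morphisms form an ideal, closed under sums because two 1-morphisms have a biproduct. The
    retracts of objects FN are the objects whose identity lies in it, so a decomposition of an
    identity can be treated termwise. *)
Definition factors (Z Z' : M j) (e : mor Z Z') : Prop :=
  exists (F : b1 C i j) (s : mor Z (ractn M F N)) (r : mor (ractn M F N) Z'), r \oc s = e.

Lemma factors_cmp (Z Z' Y Y' : M j) (e : mor Z Z') (a : mor Z' Y') (b : mor Y Z) :
  factors e -> factors (a \oc e \oc b).
Proof.
by move=> [F [s [r <-]]]; exists F, (s \oc b), (a \oc r); rewrite !cmpA.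
Qed.

Lemma factors0 (Z Z' : M j) : factors (0 : mor Z Z').
Proof.
have [_ /(_ i j) [[[F _] _] _ _ _] _] := hC.
by exists F, 0, 0; rewrite cmp0l.
Qed.

Lemma factorsD (Z Z' : M j) (e e' : mor Z Z') : factors e -> factors e' -> factors (e + e').
Proof.
have [_ /(_ i j) [[_ sums] _ _ _] _] := hC.
move=> [F [s [r <-]]] [F' [s' [r' <-]]].
have [S [s1 [s2 [r1 [r2 [e1 e2 e12 e21 _]]]]]] := sums F F'.
pose ev (G G' : b1 C i j) (f : mor G G') := bh (ractn M) f (idmor N).
exists S, (ev _ _ s1 \oc s + ev _ _ s2 \oc s'), (r \oc ev _ _ r1 + r' \oc ev _ _ r2).
rewrite cmpDl !cmpDr !cmpA -!(cmpA _ (ev _ _ r1)) -!(cmpA _ (ev _ _ r2)) /ev -!bh_cmpl.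
by rewrite e1 e2 e12 e21 !bh0l !bh_id !cmp0r !cmp0l !cmp1r addr0 add0r.
Qed.

Lemma factors_sum (Z Z' : M j) (T : Type) (l : seq T) (P : pred T) (e : T -> mor Z Z') :
  (forall t, factors (e t)) -> factors (\sum_(t <- l | P t) e t).
Proof.
move=> fe; apply: (big_ind (fun e => factors e)) => //; first exact: factors0.
exact: factorsD.
Qed.

Lemma factors_iso (Z Z' : M j) (u : iso Z Z') :
  factors (idmor Z) -> factors (idmor Z').
Proof.
by move=> /(factors_cmp u (isoV u)); rewrite cmp1r isomK.
Qed.

Lemma rep_add_factors (Y : M j) : rep_add N Y -> factors (idmor Y).
Proof.
move=> [n [F [S [Y' [[s [r [_ _ sr]]] [s1 [s2 [r1 [r2 [e1 _ _ _ _]]]]]]]]]].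
rewrite -e1 -[r1]cmp1r -sr; apply: factors_cmp; apply: factors_sum => a.
by exists (F a), (r a), (s a).
Qed.

Lemma rep_add_retract (Y S : M j) (s : mor Y S) (r : mor S Y) :
  r \oc s = idmor Y -> rep_add N S -> rep_add N Y.
Proof.
move=> rs [n [F [S0 [Y' [bF [s1 [s2 [r1 [r2 [e1 _ _ _ _]]]]]]]]]].
have [|Y'' bY] := retract_summand (hM j) (s := s1 \oc s) (r := r \oc r1).
  by rewrite -cmpA [X in _ \oc X]cmpA e1 cmp1l.
by exists n, F, S0, Y''.
Qed.

(* The inverse g of the equivalence from the additive closure of the F N to M
   embeds the isomorphism classes of indecomposables into themselves; there are
   finitely many, so X is isomorphic to some iterate g (g .. X), which lies in
   the additive closure. *)
Lemma indecomposable_factors (X : M j) : indecomposable X -> factors (idmor X).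
Proof.
have [Phi /(_ j) eqPhi] := hT hN; pose E := Phi j.
have [G [u]] := iso_choice (equivalence_es eqPhi).
have Einj Y Y' (f f' : mor Y Y') : fh E f = fh E f' -> f = f'.
  exact: equivalence_faithful.
pose g X := sval (G X) : M j.
have g_add Y : rep_add N (g Y) by exact: (svalP (G Y)).
have g_refl Y Y' : iso (g Y) (g Y') -> inhabited (iso Y Y').
  move=> v; split; apply: iso_comp (u Y') _; apply: iso_comp _ (iso_sym (u Y)).
  exact: (fh_iso E (@fullsub_iso _ _ _ (G Y) (G Y') v)).
have zeroE (Y : subrep (@rep_add_act k C M i N) j) : is_zero (E Y) -> is_zero (sval Y).
  move=> z; apply: (Einj Y Y (idmor Y) 0); by rewrite fh_id fh0.
(* The summands of [g Y] are retracts of it and so lie in the additive closure; [E] carries the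
   decomposition over to [Y]. *)
have g_ind Y : indecomposable Y -> indecomposable (g Y).
  move=> [nzY indY]; split=> [z|Y1 Y2 bi].
    apply: nzY; rewrite /is_zero -(isomK (u Y)) -[isomor (u Y)]cmp1r.
    have -> : idmor (E (G Y)) = 0; last by rewrite cmp0r cmp0l.
    by rewrite -fh_id -(fh0 E); congr (fh E _).
  have [s1 [s2 [r1 [r2 [e1 e2 e12 e21 e]]]]] := bi.
  pose S1 : subrep (@rep_add_act k C M i N) j := exist _ Y1 (rep_add_retract e1 (g_add Y)).
  pose S2 : subrep (@rep_add_act k C M i N) j := exist _ Y2 (rep_add_retract e2 (g_add Y)).
  have [] := indY (E S1) (E S2); last 2 first.
  - by move/zeroE; left.
  - by move/zeroE; right.
  exists (u Y \oc fh E (s1 : mor S1 (G Y))), (u Y \oc fh E (s2 : mor S2 (G Y))).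
  exists (fh E (r1 : mor (G Y) S1) \oc isoV (u Y)), (fh E (r2 : mor (G Y) S2) \oc isoV (u Y)).
  have K (V W : subrep (@rep_add_act k C M i N) j) (a : mor V (G Y)) (b : mor (G Y) W) :
      (fh E b \oc isoV (u Y)) \oc (u Y \oc fh E a) = fh E (b \oc a).
    by rewrite -cmpA [X in _ \oc X]cmpA isoVK cmp1l fh_cmp.
  split; rewrite ?K -?(fh_id E) -?(fh0 E); try by congr (fh E _).
  rewrite -!cmpA !(cmpA (fh E _)) -cmpDr -cmpDl -!fh_cmp -fhD.
  rewrite (_ : _ + _ = idmor (G Y)) //; by rewrite fh_id cmp1l isomK.
have [_ _ [n [Z hZ]] _] := hM j.
move=> indX; have iter_ind m : indecomposable (iter m g X) by elim: m => //= m /g_ind.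
pose c (m : 'I_n.+1) : 'I_n := sval (cid (hZ _ (iter_ind m))).
have cP (m : 'I_n.+1) : inhabited (iso (iter m g X) (Z (c m))).
  exact: (svalP (cid (hZ _ (iter_ind m)))).
(* The n + 1 iterates are distributed over n representatives, so two of them share one. *)
have [p [q [pq cpq]]] : exists p q : 'I_n.+1, (p < q)%N /\ c p = c q.
  apply: contrapT => nc; have: injective c.
    move=> p q cpq; apply: val_inj; case: (ltngtP p q) => // lt; case: nc; first by exists p, q.
    by exists q, p.
  by move/leq_card; rewrite !card_ord ltnn.
have [[v] [w]] := (cP p, cP q); move: w; rewrite -cpq => w.
have {v w} := iso_comp (iso_sym w) v.
(* Cancelling [g] p times leaves an isomorphism from [X] to an iterate with at least one application
   of [g], hence to an object of the additive closure. *)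
have : (q = p + (q - p).-1.+1 :> nat)%N by rewrite prednK ?subn_gt0 // subnKC // ltnW.
move: (q - p).-1 => d -> {q pq cpq c cP}; elim: (nat_of_ord p) => [|m IH] /=.
  move=> v; apply: (factors_iso (iso_sym v)); exact: rep_add_factors.
by move=> /g_refl [].
Qed.

Lemma transitive_retract (Z : M j) :
  exists (F : b1 C i j) (s : mor Z (ractn M F N)) (r : mor (ractn M F N) Z),
    r \oc s = idmor Z.
Proof.
have [[[Z0 z0] _] _ [n [Y hY]] _] := hM j.
(* Representatives whose identity is outside the ideal become a zero object; by
   [indecomposable_factors] no indecomposable object is lost. *)
pose Y' a := if `[< factors (idmor (Y a)) >] then Y a else Z0.
have fY' a : factors (idmor (Y' a)).
  rewrite /Y'; case: asboolP => // _; rewrite z0; exact: factors0.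
have [|l lE] := krull_schmidt (hM j) (Z := Y') _ Z.
  move=> X indX; have [a [u]] := hY _ indX; exists a; rewrite /Y'.
  have fYa : factors (idmor (Y a)).
    by apply: (factors_iso u); apply: indecomposable_factors.
  by rewrite asboolT.
change (factors (idmor Z)); rewrite -lE; apply: factors_sum => t.
by rewrite -[X in _ \oc X]cmp1l cmpA; apply: factors_cmp.
Qed.

End Transitivity.

(** * Adjunctions acting on 2-representations *)

Section Principal.
Variables (k : fieldType) (B : bicat k).

(** The left action on the categories B(i,-) makes the units and counits defined for
    2-representations available for 1-morphisms too. *)
Definition principal_rep (i : B) : tworep B :=
  @TwoRep k B (b1 B i) (fun j l => bcomp) (fun j l m F G X => basc F G X)
    (fun j X => blun X) (fun j l m => @basc_nat k B i j l m)
    (fun j => @blun_nat k B i j) (fun j l m n => @bpentagon k B i j l m n)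
    (fun j l => @btriangle k B i j l) (fun j l => @btrianglel k B i j l).

Section Adjunction.
Variables (R : tworep B) (j l : B) (F : b1 B j l) (G : b1 B l j).
Variables (alpha : mor (bcomp F G) (bunit B l)) (beta : mor (bunit B j) (bcomp G F)).
Hypothesis adj : adjunction alpha beta.

(** This is the identity [zigzag1] acting on [X], the companion of [rzigzag]. *)
Lemma rzigzag1 (X : R j) :
  rcounit alpha (ractn R F X) \oc bh (ractn R) (idmor F) (runit beta X) =
  idmor (ractn R F X).
Proof.
have := congr1 (fun f => bh (ractn R) f (idmor X)) (zigzag1 adj).
rewrite !bh_cmpl bh_id => <-; rewrite /rcounit /runit !bh_cmpr.
rewrite -rtrianglel -!cmpA; congr (_ \oc _).
rewrite [LHS]cmpA -[X in bh (ractn R) alpha X](bh_id (ractn R)) rasc_nat -cmpA; congr (_ \oc _).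
have pent := rpentagon F G F X.
(* The pentagon trades the inverse of the inner structural isomorphism of [R] for an associator of
   [B]. *)
have -> : rasc R F G (ractn R F X) \oc (bh (ractn R) (idmor F) (isoV (rasc R G F X))
    \oc (bh (ractn R) (idmor F) (bh (ractn R) beta (idmor X))
    \oc bh (ractn R) (idmor F) (isoV (run R X)))) = 
  isoV (rasc R (bcomp F G) F X) \oc (bh (ractn R) (basc F G F) (idmor X) \oc
   (rasc R F (bcomp G F) X \oc (bh (ractn R) (idmor F) (bh (ractn R) beta (idmor X))
    \oc bh (ractn R) (idmor F) (isoV (run R X))))).
  apply: (iso_injl (u := rasc R (bcomp F G) F X)).
  rewrite [LHS]cmpA pent [RHS]cmpA isomK cmp1l -!cmpA; congr (_ \oc (_ \oc _)).
  by rewrite cmpA -bh_cmpr isomK bh_id cmp1l.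
rewrite cmpA isomK cmp1l; congr (_ \oc _).
rewrite cmpA rasc_nat -cmpA; congr (_ \oc _).
apply: (iso_injr (u := bh_iso (ractn R) (iso_id F) (run R X))); rewrite /= -cmpA -bh_cmpr.
by rewrite isoVK bh_id cmp1r -rtriangle cmpA -bh_cmpl isoVK bh_id cmp1l.
Qed.

Section Evaluation.
Variables (i : B) (N : R i).

(** Evaluation at [N], sending [Y] to YN, respects the actions, so it carries the counit of the
    principal 2-representation to that of [R]. [runit_rasc] is the analogue for units. *)
Lemma rcounit_rasc (Y : b1 B i l) :
  bh (ractn R) (rcounit (R := principal_rep i) alpha Y) (idmor N)
    \oc (rasc R F (bcomp G Y) N \oc bh (ractn R) (idmor F) (rasc R G Y N)) =
  rcounit alpha (ractn R Y N).
Proof.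
rewrite /rcounit /= !bh_cmpl -!cmpA -rpentagon.
rewrite [X in _ \oc X]cmpA -rasc_nat bh_id -!cmpA [LHS]cmpA.
by rewrite rtrianglel.
Qed.

Lemma runit_rasc (X : b1 B i j) :
  rasc R G (bcomp F X) N \oc (bh (ractn R) (idmor G) (rasc R F X N)
    \oc runit beta (ractn R X N)) =
  bh (ractn R) (runit (R := principal_rep i) beta X) (idmor N).
Proof.
rewrite /runit /= !bh_cmpl.
have pent := rpentagon G F X N.
apply: (iso_injl (u := bh_iso (ractn R) (basc G F X) (iso_id N))); rewrite /=.
rewrite [RHS]cmpA -[in RHS]bh_cmpl isomK bh_id cmp1l.
rewrite [in LHS](cmpA (rasc R G (bcomp F X) N)) [LHS]cmpA -pent -[LHS]cmpA.
rewrite [X in _ \oc X]cmpA isomK cmp1l.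
rewrite [LHS]cmpA -[X in bh (ractn R) beta X](bh_id (ractn R)) rasc_nat -[LHS]cmpA.
congr (_ \oc _); apply: (iso_injr (u := run R (ractn R X N))).
by rewrite -cmpA isoVK cmp1r -rtrianglel cmpA -bh_cmpl isoVK bh_id cmp1l.
Qed.

End Evaluation.
End Adjunction.
End Principal.

(** * Internal homs and the action of 1-morphisms *)

Section InternalHomAction.
Variables (k : fieldType) (B : bicat k) (R : tworep B) (i : B) (N : R i).

Section Universal.
Variables (j : B) (M : R j) (Q : b1 B i j) (c : mor M (ractn R Q N)).
Hypothesis c_inj : forall (F : b1 B i j) (u v : mor Q F),
  bh (ractn R) u (idmor N) \oc c = bh (ractn R) v (idmor N) \oc c -> u = v.
Hypothesis c_sur : forall (F : b1 B i j) (y : mor M (ractn R F N)),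
  exists u : mor Q F, bh (ractn R) u (idmor N) \oc c = y.

Definition inthom_of_universal : inthom N M.
Proof.
exists Q (fun F u => bh (ractn R) u (idmor N) \oc c) (fun F y => sval (cid (c_sur y))).
- by move=> F u; apply: c_inj; case: (cid _).
- by move=> F y; case: (cid _).
- by move=> F G f u; rewrite bh_cmpl cmpA.
Defined.

Lemma coev_of_universal : coev inthom_of_universal = c.
Proof. by rewrite /coev /= bh_id cmp1l. Qed.

End Universal.

Section Canonical.
Variables (j l : B) (F : b1 B j l) (X : R j).
Variables (HX : inthom N X) (HFX : inthom N (ractn R F X)).

(* Hom(N,FX) -> F Hom(N,X); an isomorphism as soon as F has a right adjoint. *)
Definition ih_act : mor (ihob HFX) (bcomp F HX) :=
  ihof HFX (rasc R F HX N \oc bh (ractn R) (idmor F) (coev HX)).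

Lemma ih_actE : bh (ractn R) ih_act (idmor N) \oc coev HFX =
  rasc R F HX N \oc bh (ractn R) (idmor F) (coev HX).
Proof. exact: ihofE. Qed.

Section Inverse.
Variables (G : b1 B l j).
Variables (alpha : mor (bcomp F G) (bunit B l)) (beta : mor (bunit B j) (bcomp G F)).
Hypothesis adj : adjunction alpha beta.

Let lcounit := rcounit (R := principal_rep i) alpha.
Let lunit := runit (R := principal_rep i) beta.

(** Corresponds to X -> GFX -> G Hom(N,FX) N; its mate under the adjunction is [ih_actV]. *)
Let tr : mor (ihob HX) (bcomp G (ihob HFX)) :=
  ihof HX (rasc R G HFX N \oc (bh (ractn R) (idmor G) (coev HFX) \oc runit beta X)).

Definition ih_actV : mor (bcomp F HX) (ihob HFX) :=
  lcounit (ihob HFX) \oc bh bcomp (idmor F) tr.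

(** On the coevaluation, [rcounit_rasc] turns the counit of the principal 2-representation into that
    of [R]. Naturality moves the coevaluation outside, and [rzigzag1] remains. *)
Lemma ih_actVK : ih_actV \oc ih_act = idmor (ihob HFX).
Proof.
apply: ih_inj; rewrite bh_id cmp1l bh_cmpl -cmpA ih_actE bh_cmpl -cmpA.
rewrite (cmpA _ (rasc R F HX N)) -rasc_nat -cmpA -bh_cmpr ihofE.
rewrite bh_cmpr [X in _ \oc X]cmpA [LHS]cmpA (rcounit_rasc alpha N).
by rewrite bh_cmpr [LHS]cmpA rcounit_nat -cmpA rzigzag1 // cmp1r.
Qed.

Lemma ih_actK : ih_act \oc ih_actV = idmor (bcomp F HX).
Proof.
(* Applying [G] to [ih_act] turns [tr] into the unit at Hom(N,X), which leaves a zig-zag identity of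
   the principal 2-representation. *)
have trE : bh bcomp (idmor G) ih_act \oc tr = lunit (ihob HX).
  apply: ih_inj; rewrite bh_cmpl -cmpA ihofE /lunit -runit_rasc.
  rewrite [LHS]cmpA -rasc_nat -!cmpA; congr (_ \oc _).
  rewrite [LHS]cmpA -bh_cmpr ih_actE bh_cmpr -!cmpA; congr (_ \oc _).
  by rewrite -runit_nat /runit -!cmpA.
rewrite /ih_actV cmpA /lcounit -[ih_act \oc _]rcounit_nat -cmpA.
rewrite -[X in _ \oc X](bh_cmpr (ractn (principal_rep i))) trE.
exact: (rzigzag1 (R := principal_rep i) adj).
Qed.

Definition ih_act_iso : iso (ihob HFX) (bcomp F HX) := Iso ih_actVK ih_actK.

End Inverse.

Variable HN : inthom N N.

Lemma ih_act_comod :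
  ih_act \in comod_morphism (ih_comod HN HFX)
    (comod_act_ob F (ih_comod HN HX) : comod_ob (ih_coalg HN) l).
Proof.
apply/eqP => /=; apply: ih_inj; rewrite !bh_cmpl -!cmpA !ihofE.
rewrite [X in _ \oc X]cmpA -rasc_nat -[X in _ \oc X]cmpA -bh_cmpr ihofE.
rewrite [in LHS]bh_cmpr [X in _ \oc X]cmpA [LHS]cmpA -rpentagon.
rewrite [in LHS]bh_cmpr [RHS]cmpA -rasc_nat bh_id -!cmpA; congr (_ \oc _).
rewrite [RHS]cmpA -bh_split' (bh_split (ractn R) ih_act) -[RHS]cmpA ih_actE.
by rewrite [RHS]cmpA -[in RHS](bh_id bcomp) -rasc_nat -cmpA.
Qed.

End Canonical.

Lemma ih_act_nat j l (F G : b1 B j l) (f : mor F G) (X Y : R j) (x : mor X Y)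
    (HX : inthom N X) (HFX : inthom N (ractn R F X))
    (HY : inthom N Y) (HGY : inthom N (ractn R G Y)) :
  ih_act HY HGY \oc ih_map HFX HGY (bh (ractn R) f x) =
  bh bcomp f (ih_map HX HY x) \oc ih_act HX HFX.
Proof.
apply: ih_inj; rewrite !bh_cmpl -!cmpA !ihofE.
rewrite [LHS]cmpA ih_actE -cmpA -bh_cmp cmp1l.
by rewrite [RHS]cmpA -rasc_nat -cmpA -bh_cmp cmp1r ihofE.
Qed.

Lemma ih_act_comp j l m (F : b1 B l m) (G : b1 B j l) (X : R j)
    (HX : inthom N X) (HGX : inthom N (ractn R G X))
    (HFGX : inthom N (ractn R F (ractn R G X))) (HcX : inthom N (ractn R (bcomp F G) X)) :
  ih_act HX HcX \oc ih_map HFGX HcX (rasc R F G X) =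
  basc F G HX \oc (bh bcomp (idmor F) (ih_act HX HGX) \oc ih_act HGX HFGX).
Proof.
apply: ih_inj; rewrite !bh_cmpl -!cmpA !ihofE.
rewrite [LHS]cmpA ih_actE -cmpA -(bh_id bcomp) -rasc_nat.
rewrite [LHS]cmpA rpentagon -!cmpA; congr (_ \oc _).
by rewrite [RHS]cmpA -rasc_nat -[RHS]cmpA -[in RHS]bh_cmpr ih_actE bh_cmpr.
Qed.

Lemma ih_act_unit j (X : R j) (HX : inthom N X) (H1X : inthom N (ractn R (bunit B j) X)) :
  blun HX \oc ih_act HX H1X = ih_map H1X HX (run R X).
Proof.
apply: ih_inj; rewrite !bh_cmpl -!cmpA !ihofE cmpA rtrianglel.
by rewrite run_nat.
Qed.

End InternalHomAction.

(** * Internal homs for objects of the abelianization *)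

Section AbAction.
Variables (k : fieldType) (C : bicat k) (M : tworep C).

Lemma emb_adjunction (j l : C) (F : b1 C j l) (G : b1 C l j) alpha beta :
  adjunction (F := F) (G := G) alpha beta ->
  exists alpha' beta', @adjunction k (ab_bicat C) j l (ab_emb _ F) (ab_emb _ G) alpha' beta'.
Proof.
move=> [z1 z2].
exists (fh (ab_emb _) alpha \oc pf_comp (ab_pfun C) F G).
exists (isoV (pf_comp (ab_pfun C) G F) \oc fh (ab_emb _) beta).
split.
- rewrite -[RHS](fh_id (ab_emb _)) -z1 /=.
  rewrite !(ab_bifun_homE, abcmpE); apply: abcl_eqg => /=.
  by rewrite !cmp1r !cmp1l.
- rewrite -[RHS](fh_id (ab_emb _)) -z2 /=.
  rewrite !(ab_bifun_homE, abcmpE); apply: abcl_eqg => /=.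
  by rewrite !cmp1r !cmp1l.
Qed.

Lemma ab_ract_kernel (i j : C) (S : ab (M i)) (P : ab (b1 C i j)) n
    (Q : 'I_n -> ab (b1 C i j)) (m : forall a, mor P (Q a)) K (q : mor K P) :
  joint_kernel m q ->
  @joint_kernel k (ab_rep M j) _ _ _ (fun a => bh (ractn (ab_rep M)) (m a) (idmor S))
    _ (bh (ractn (ab_rep M)) q (idmor S)).
Proof. exact: ab_bifun_kernel. Qed.

Lemma ab_ract_mono (i j : C) (S : ab (M i)) (P Q : ab (b1 C i j)) (m : mor P Q) :
  monomorphism m ->
  @monomorphism k (ab_rep M j) _ _ (bh (ractn (ab_rep M)) m (idmor S)).
Proof. exact: ab_bifun_mono. Qed.

Lemma ab_comp_kernel (i j l : C) (S : ab (b1 C i j)) (P : ab (b1 C j l)) n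
    (Q : 'I_n -> ab (b1 C j l)) (m : forall a, mor P (Q a)) K (q : mor K P) :
  joint_kernel m q ->
  @joint_kernel k (b1 (ab_bicat C) i l) _ _ _
    (fun a => bh (bcomp (b := ab_bicat C)) (m a) (idmor S))
    _ (bh (bcomp (b := ab_bicat C)) q (idmor S)).
Proof. exact: ab_bifun_kernel. Qed.

Lemma ab_comp_mono (i j l : C) (S : ab (b1 C i j)) (P Q : ab (b1 C j l)) (m : mor P Q) :
  monomorphism m ->
  @monomorphism k (b1 (ab_bicat C) i l) _ _ (bh (bcomp (b := ab_bicat C)) m (idmor S)).
Proof. exact: ab_bifun_mono. Qed.

Section InternalHoms.
Variables (i : C) (N : M i).
Hypothesis H : forall (j : C) (X : M j), ihom N X.

Let B := ab_bicat C.
Let R := ab_rep M.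
Let N' : R i := ab_emb (M i) N.

Section Kernel.
Variables (j : C) (K : ab (M j)).

Definition ih_copres a : mor (ihob (H (abX K))) (ihob (H (abY K a))) :=
  ih_map (H (abX K)) (H (abY K a)) (fh (ab_emb (M j)) (abf K a)).

Variables (L : b1 B i j) (io : mor L (ihob (H (abX K)))).
Hypothesis kio : joint_kernel ih_copres io.
Variable co : mor (K : R j) (ractn R L N').
Hypothesis coE : bh (ractn R) io (idmor N') \oc co = coev (H (abX K)) \oc ab_can K.

Let e (F : b1 C i j) : iso (ab_emb (M j) (ractn M F N)) (ractn R (ab_emb _ F : b1 B i j) N') :=
  mi (ab_unit_mor M) F N.

(** As [F] is injective, [u] extends along [io] to Hom(N,K_0). By hypothesis the corresponding map
    K_0 -> FN vanishes on [K], so it factors through the [abf K a]. The extension is then a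
    combination of the [ih_copres a], which [io] kills. *)
Lemma ih_kernel_inj_emb (F : b1 C i j) (u : mor L (ab_emb _ F : b1 B i j)) :
  bh (ractn R) u (idmor N') \oc co = 0 -> u = 0.
Proof.
have [ioK io_mono _] := kio.
have [u' <-] := ab_emb_injective u io_mono.
rewrite bh_cmpl -cmpA coE => u'0.
have [g gE] := ab_emb_full (isoV (e F) \oc (bh (ractn R) u' (idmor N') \oc coev (H (abX K)))).
have [|q qE] := @ab_can_vanishes _ _ K _ g.
  by rewrite -gE -!cmpA u'0 cmp0r.
pose q' a : mor (ihob (H (abY K a))) (ab_emb _ F : b1 B i j) :=
  ihof (H (abY K a)) (e F \oc fh (ab_emb (M j)) (q a)).
suff -> : u' = \sum_a q' a \oc ih_copres a.
  by rewrite cmp_suml big1 // => a _; rewrite -cmpA ioK cmp0r.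
apply: (@ih_inj _ B R i N' j _ (H (abX K))); rewrite bh_suml cmp_suml.
under eq_bigr => a _ do rewrite bh_cmpl -cmpA ihofE cmpA ihofE -cmpA -fh_cmp.
rewrite -cmp_sumr -fh_sum -qE -gE cmpA isomK cmp1l.
by [].
Qed.

Lemma ih_kernel_sur_emb (F : b1 C i j) (y : mor (K : R j) (ractn R (ab_emb _ F : b1 B i j) N')) :
  exists u : mor L (ab_emb _ F : b1 B i j), bh (ractn R) u (idmor N') \oc co = y.
Proof.
have [g gE] := ab_emb_extend (isoV (e F) \oc y).
exists (ihof (H (abX K)) (e F \oc fh (ab_emb (M j)) g) \oc io).
by rewrite bh_cmpl -cmpA coE cmpA ihofE -cmpA -gE cmpA isomK cmp1l.
Qed.

(** [F] embeds into its first component, to which [ih_kernel_inj_emb] applies. *)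
Lemma ih_kernel_inj (F : b1 B i j) (u v : mor L F) :
  bh (ractn R) u (idmor N') \oc co = bh (ractn R) v (idmor N') \oc co -> u = v.
Proof.
move=> uv; apply: subr0_eq; apply: (@ab_can_mono _ _ F); rewrite cmp0r.
apply: ih_kernel_inj_emb; rewrite bh_cmpl -cmpA.
by rewrite -scaleN1r addrC bhDl bhZl cmpDl cmpZl uv scaleN1r addNr cmp0r.
Qed.

(** The solution for the first component of [F] is killed by the [abf F b], by [ih_kernel_inj_emb],
    and so lifts to [F]. *)
Lemma ih_kernel_sur (F : b1 B i j) (y : mor (K : R j) (ractn R F N')) :
  exists u : mor L F, bh (ractn R) u (idmor N') \oc co = y.
Proof.
have [canK _ can_lift] := ab_can_kernel F.
have [u0 u0E] := ih_kernel_sur_emb (bh (ractn R) (ab_can F) (idmor N') \oc y).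
have [b|u uE] := can_lift _ u0.
  apply: ih_kernel_inj_emb.
  by rewrite bh_cmpl -cmpA u0E cmpA -bh_cmpl canK bh0l cmp0l.
exists u; apply: (@ab_ract_mono i j N' _ _ _ (@ab_can_mono _ _ F)).
by rewrite cmpA -bh_cmpl uE.
Qed.

End Kernel.

(* Hom(N,K) is the kernel of Hom(N,K_0) -> Hom(N,Y_a): it represents the
   functor Hom(K, -N) because the objects of C(i,j) are injective. *)
Lemma ih_kernel_exists (j : C) (K : ab (M j)) :
  exists h : @inthom k B R i j N' K,
    joint_kernel (@ih_copres j K) (ih_map h (H (abX K)) (ab_can K)).
Proof.
have [L [io kio]] := ab_kernel_exists (@ih_copres j K).
have [_ _ ex] := ab_ract_kernel N' kio.
(* Evaluation at [N] preserves the kernel [L], so the coevaluation of K_0, restricted to [K],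
   factors through LN. *)
have [a|co coE] := ex _ (coev (H (abX K)) \oc ab_can K).
  have [canK _ _] := ab_can_kernel K.
  by rewrite cmpA ihofE -cmpA canK cmp0r.
pose h := inthom_of_universal (ih_kernel_inj kio coE) (ih_kernel_sur kio coE); exists h.
suff -> : ih_map h (H (abX K)) (ab_can K) = io :> mor (ihob h) (ihob (H (abX K))) by [].
by apply: (@ih_inj _ B R); rewrite ihofE coev_of_universal.
Qed.

End InternalHoms.
End AbAction.

(** * Cofree comodules *)

Section Cofree.
Variables (k : fieldType) (B : bicat k) (i : B) (A : coalg i).

Definition regular_comod : comod_ob A i := ComodOb (coassoc A) (counitr A).

Variable j : B.
Implicit Types (F G : b1 B i j) (X Y : comod_ob A j).

Definition cofree F : comod_ob A j := comod_act_ob F regular_comod.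

Definition cofree_counit F : mor (bcomp F A) F := brun F \oc bh bcomp (idmor F) (ceps A).

(** Inverse to composition with [cofree_counit F]: comodule morphisms from [X] to the cofree
    comodule FA are the same as 2-morphisms from [X] to [F]. *)
Definition cofree_lift X F (v : mor (cx X) F) : mor (cx X) (bcomp F A) :=
  bh bcomp v (idmor (ca A)) \oc crho X.

Lemma comod_morphismE X Y (f : mor (cx X) (cx Y)) :
  f \in comod_morphism X Y -> crho Y \oc f = bh bcomp f (idmor (ca A)) \oc crho X.
Proof. by move/eqP. Qed.

Lemma comod_morphism_cmp X Y Z (g : mor (cx Y) (cx Z)) (f : mor (cx X) (cx Y)) :
  g \in comod_morphism Y Z -> f \in comod_morphism X Y ->
  g \oc f \in comod_morphism X Z.
Proof. by move=> gP fP; apply: (comod_cmpP (ComodHom gP) (ComodHom fP)). Qed.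

Lemma cofree_lift_cmp X Y F (v : mor (cx Y) F) (f : mor (cx X) (cx Y)) :
  f \in comod_morphism X Y -> cofree_lift v \oc f = cofree_lift (v \oc f).
Proof. by move=> /comod_morphismE fP; rewrite /cofree_lift -cmpA fP cmpA -bh_cmpl. Qed.

Lemma cofree_liftP X F (v : mor (cx X) F) :
  cofree_lift v \in comod_morphism X (cofree F).
Proof.
apply/eqP; rewrite /= /cofree_lift bh_cmpl -!cmpA -crho_coassoc.
by rewrite [RHS]cmpA -basc_nat bh_id -!cmpA; congr (_ \oc _); rewrite !cmpA -bh_split -bh_split'.
Qed.

Lemma cofree_lift_counit X F (v : mor (cx X) F) :
  cofree_counit F \oc cofree_lift v = v.
Proof.
rewrite /cofree_counit /cofree_lift -cmpA [X in _ \oc X]cmpA -bh_split.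
rewrite (bh_split' bcomp v) !cmpA brun_nat -!cmpA crho_counit.
by rewrite cmp1r.
Qed.

Lemma cofree_counit_lift X F (w : mor (cx X) (bcomp F A)) :
  w \in comod_morphism X (cofree F) -> cofree_lift (cofree_counit F \oc w) = w.
Proof.
move=> /comod_morphismE wP; rewrite /cofree_lift bh_cmpl -cmpA -wP /=.
rewrite /cofree_counit bh_cmpl -!cmpA (cmpA (bh bcomp (bh _ _ _) _)) -basc_nat -cmpA.
rewrite [LHS]cmpA btriangle [X in _ \oc X]cmpA -!bh_cmpr [LHS]cmpA -bh_cmpr.
by rewrite counitl bh_id cmp1l.
Qed.

Lemma cofree_inj X F (w w' : mor (cx X) (bcomp F A)) :
  w \in comod_morphism X (cofree F) -> w' \in comod_morphism X (cofree F) ->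
  cofree_counit F \oc w = cofree_counit F \oc w' -> w = w'.
Proof. by move=> wP wP' ww'; rewrite -(cofree_counit_lift wP) ww' cofree_counit_lift. Qed.

Lemma crho_morphism X : crho X \in comod_morphism X (cofree X).
Proof. by have := cofree_liftP (idmor (cx X)); rewrite /cofree_lift bh_id cmp1l. Qed.

Lemma cofree_mapP F G (f : mor F G) :
  bh bcomp f (idmor (ca A)) \in comod_morphism (cofree F) (cofree G).
Proof. exact: (comod_actP f (ComodHom (comod_idP regular_comod))). Qed.

Lemma crho_counitE X : cofree_counit X \oc crho X = idmor (cx X).
Proof. by rewrite /cofree_counit -cmpA crho_counit. Qed.

(** The two sides of the comodule condition for [f] agree after composition with the monomorphism
    induced by [m]. This promotes morphisms found between underlying 1-morphisms to comodule
    morphisms. *)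
Lemma comod_morphism_lift X Y Z (m : mor (cx Y) (cx Z)) (f : mor (cx X) (cx Y)) :
  m \in comod_morphism Y Z -> m \oc f \in comod_morphism X Z ->
  monomorphism (bh bcomp m (idmor (ca A))) -> f \in comod_morphism X Y.
Proof.
move=> /comod_morphismE mP /comod_morphismE mfP mm; apply/eqP; apply: mm.
by rewrite cmpA -mP -cmpA mfP bh_cmpl -cmpA.
Qed.

End Cofree.

(** * Functoriality of internal homs *)

Section InternalHomMaps.
Variables (k : fieldType) (B : bicat k) (R : tworep B) (i : B) (N : R i).
Variable j : B.

Lemma ih_mapE (X Y : R j) (HX : inthom N X) (HY : inthom N Y) (m : mor X Y) :
  bh (ractn R) (ih_map HX HY m) (idmor N) \oc coev HX = coev HY \oc m.
Proof. exact: ihofE. Qed.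

Lemma ih_map_cmp (X Y Z : R j) (HX : inthom N X) (HY : inthom N Y) (HZ : inthom N Z)
    (g : mor Y Z) (f : mor X Y) :
  ih_map HY HZ g \oc ih_map HX HY f = ih_map HX HZ (g \oc f).
Proof.
by apply: ih_inj; rewrite bh_cmpl -cmpA !ih_mapE !cmpA ih_mapE.
Qed.

Lemma ih_map_id (X : R j) (HX : inthom N X) : ih_map HX HX (idmor X) = idmor (ihob HX).
Proof. by apply: ih_inj; rewrite ih_mapE bh_id cmp1l cmp1r. Qed.

Lemma ih_map_iso_subproof (X Y : R j) (HX : inthom N X) (HY : inthom N Y) (u : iso X Y) :
  ih_map HY HX (isoV u) \oc ih_map HX HY u = idmor (ihob HX).
Proof. by rewrite ih_map_cmp isoVK ih_map_id. Qed.

Definition ih_map_iso (X Y : R j) (HX : inthom N X) (HY : inthom N Y) (u : iso X Y) :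
    iso (ihob HX) (ihob HY) :=
  Iso (ih_map_iso_subproof HX HY u) (ih_map_iso_subproof HY HX (iso_sym u)).

(** Composed with the cofree adjunction, the passage from Hom(K,FN) to comodule morphisms Hom(N,K)
    -> FA is the bijection defining Hom(N,K), so it is itself bijective. *)
Lemma ih_act_counit (HN : inthom N N) (F : b1 B i j) (HFN : inthom N (ractn R F N))
    (K : R j) (HK : inthom N K) (m : mor K (ractn R F N)) :
  cofree_counit (ih_coalg HN) F \oc (ih_act HN HFN \oc ih_map HK HFN m) = ihof HK m.
Proof.
apply: ih_inj; rewrite ihofE !bh_cmpl -!cmpA ih_mapE (cmpA _ (coev HFN)) ih_actE.
rewrite -[in LHS](cmpA (rasc _ _ _ _)) [X in _ \oc X]cmpA -rasc_nat -cmpA [LHS]cmpA rtriangle.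
rewrite [X in _ \oc X]cmpA -bh_cmpr ihofE [LHS]cmpA -bh_cmpr isomK.
by rewrite bh_id cmp1l.
Qed.

End InternalHomMaps.

(** * Full faithfulness and essential surjectivity of the comparison *)

Section Comparison.
Variables (k : fieldType) (C : bicat k) (M : tworep C) (hC : fiat C).
Variables (i : C) (N : M i).
Hypothesis H : forall (j : C) (X : M j), ihom N X.
Hypothesis retractN : forall (j : C) (Z : M j),
  exists (F : b1 C i j) (s : mor Z (ractn M F N)) (r : mor (ractn M F N) Z),
    r \oc s = idmor Z.

Let B := ab_bicat C.
Let R := ab_rep M.
Let N' : R i := ab_emb (M i) N.
Let A := ih_coalg (H N).
Let e j (F : b1 C i j) : iso (ab_emb (M j) (ractn M F N)) (ractn R (ab_emb _ F : b1 B i j) N') :=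
  mi (ab_unit_mor M) F N.

Variable Th : forall (j : C) (K : ab (M j)), @inthom k B R i j N' K.
Hypothesis ThP : forall (j : C) (K : ab (M j)),
  joint_kernel (@ih_copres k C M i N H j K) (ih_map (Th K) (H (abX K)) (ab_can K)).

Lemma ih_act_iso_exists (j l : C) (F : b1 C j l) (X : R j)
    (HX : inthom N' X) (HFX : inthom N' (ractn R (ab_emb _ F : b1 B j l) X)) :
  exists u : iso (ihob HFX) (bcomp (ab_emb _ F : b1 B j l) (ihob HX)),
    isomor u = ih_act HX HFX.
Proof.
have [_ _ [s adj]] := hC; have [alpha [beta adjF]] := adj _ _ F.
have [alpha' [beta' adjF']] := emb_adjunction adjF.
by exists (ih_act_iso HX HFX adjF').
Qed.

Section AtObject.
Variable j : C.

(** FN occurs both as an embedded object of [M] and as the embedded [F] acting on [N]. The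
    isomorphism passes from the first to the second along [e F] and then applies [ih_act]; the last
    clause records this for the proof of naturality. *)
Lemma kappa_exists (F : b1 C i j) :
  exists u : iso (ihob (H (ractn M F N))) (bcomp (ab_emb _ F : b1 B i j) (ihob (H N))),
  [/\ isomor u \in comod_morphism (ih_comod (H N) (H (ractn M F N)))
        (cofree A (ab_emb _ F : b1 B i j)),
      (forall K (h : @inthom k B R i j N' K) (m : mor K (ab_emb (M j) (ractn M F N))),
         cofree_counit A (ab_emb _ F) \oc (u \oc ih_map h (H (ractn M F N)) m) =
         ihof h (e F \oc m))
    & isomor u = ih_act (H N) (Th (ractn R (ab_emb _ F : b1 B i j) N')) \oc
        ih_map (H (ractn M F N)) (Th _) (e F)].
Proof.
pose T := Th (ractn R (ab_emb _ F : b1 B i j) N').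
have [u uE] := ih_act_iso_exists (H N) T.
pose v := iso_comp u (ih_map_iso (H (ractn M F N)) T (e F)).
have vE : isomor v = ih_act (H N) T \oc ih_map (H (ractn M F N)) T (e F) by rewrite -uE.
exists v; rewrite vE; split=> //.
- apply: (@comod_morphism_cmp _ _ _ A j _ (ih_comod (H N) T)); last exact: ih_mapP.
  exact: ih_act_comod.
- move=> K h m; rewrite -(cmpA (ih_act (H N) T)) ih_map_cmp.
  exact: ih_act_counit.
Qed.

(* Hom(N,FN) is the cofree comodule F A^N. *)
Definition kappa (F : b1 C i j) := sval (cid (kappa_exists F)).

Lemma kappaP (F : b1 C i j) :
  isomor (kappa F) \in comod_morphism (ih_comod (H N) (H (ractn M F N)))
    (cofree A (ab_emb _ F : b1 B i j)).
Proof. by have [] := svalP (cid (kappa_exists F)). Qed.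

Lemma kappa_counit (F : b1 C i j) K (h : @inthom k B R i j N' K)
    (m : mor K (ab_emb (M j) (ractn M F N))) :
  cofree_counit A (ab_emb _ F) \oc (kappa F \oc ih_map h (H (ractn M F N)) m) =
  ihof h (e F \oc m).
Proof. by have [_ + _] := svalP (cid (kappa_exists F)); apply. Qed.

Lemma kappa_nat (F G : b1 C i j) (f : mor F G) :
  kappa G \oc ih_map (H _) (H _) (fh (ab_emb (M j)) (bh (ractn M) f (idmor N))) =
  bh bcomp (fh (ab_emb _) f : mor (ab_emb _ F : b1 B i j) (ab_emb _ G)) (idmor (ca A))
    \oc kappa F.
Proof.
have [_ _ EF] := svalP (cid (kappa_exists F)).
have [_ _ EG] := svalP (cid (kappa_exists G)).
rewrite /kappa EF EG -cmpA ih_map_cmp.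
have := mi_nat (ab_unit_mor M) f (idmor N).
rewrite -[isomor (mi _ G N)]/(isomor (e G)) -[isomor (mi _ F N)]/(isomor (e F)) => ->.
rewrite -(ih_map_cmp _ (Th (ractn R (ab_emb _ F : b1 B i j) N'))) cmpA.
rewrite fh_id [RHS]cmpA.
have := @ih_act_nat k B R i N' i j (ab_emb _ F) (ab_emb _ G) (fh (ab_emb _) f) N' N'
  (idmor N') (H N) (Th _) (H N) (Th _).
rewrite ih_map_id => actE.
exact: (congr1 (fun w => w \oc ih_map (H _) (Th _) (e F)) actE).
Qed.

Section OnHoms.
Variables (K : ab (M j)) (h : @inthom k B R i j N' K) (Z : M j).
Let X : comod_ob A j := ih_comod (H N) h.

(** Injectivity passes from FN to its retract [Z], and for FN [kappa_counit] turns the map into the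
    bijection [ihof]. *)
Lemma ih_map_emb_inj (m m' : mor (K : R j) (ab_emb (M j) Z)) :
  ih_map h (H Z) m = ih_map h (H Z) m' -> m = m'.
Proof.
have [F [s [r rs]]] := retractN Z => mm'.
have: ih_map h (H (ractn M F N)) (fh (ab_emb _) s \oc m) =
      ih_map h (H (ractn M F N)) (fh (ab_emb _) s \oc m').
  by rewrite -!(ih_map_cmp _ (H Z)) mm'.
move=> /(congr1 (fun w => cofree_counit A (ab_emb _ F) \oc (kappa F \oc w))).
rewrite !kappa_counit => /(can_inj (ihofK h (F := _))) /iso_injl.
move=> /(congr1 (fun w => fh (ab_emb _) r \oc w)).
by rewrite !cmpA -!fh_cmp rs fh_id !cmp1l.
Qed.

Lemma ih_map_emb_surj (w : mor (ihob h) (ihob (H Z))) :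
  w \in comod_morphism X (ih_comod (H N) (H Z)) ->
  exists m : mor (K : R j) (ab_emb (M j) Z), ih_map h (H Z) m = w.
Proof.
have [F [s [r rs]]] := retractN Z => wP.
pose HF := H (ractn M F N).
pose v := kappa F \oc (ih_map (H Z) HF (fh (ab_emb _) s) \oc w).
have vP : v \in comod_morphism X (cofree A (ab_emb _ F : b1 B i j)).
  apply: comod_morphism_cmp (kappaP F) _.
  by apply: comod_morphism_cmp wP; apply: ih_mapP.
(* The map K -> FN that corresponds to [v] under the cofree adjunction and the internal hom. *)
pose y := isoV (e F) \oc ihto h (cofree_counit A (ab_emb _ F) \oc v).
have yE : kappa F \oc ih_map h HF y = v.
  apply: (@cofree_inj _ _ _ A j X (ab_emb _ F)); last 2 first.
  - exact: vP.
  - by rewrite kappa_counit cmpA isomK cmp1l ihtoK.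
  by apply: comod_morphism_cmp (kappaP F) _; apply: ih_mapP.
exists (fh (ab_emb _) r \oc y).
rewrite -(ih_map_cmp _ HF) (iso_injl yE) cmpA ih_map_cmp -fh_cmp rs fh_id ih_map_id.
exact: cmp1l.
Qed.

End OnHoms.

Let Theta : linfunctor (ab (M j)) (comod_cat A j) :=
  theta (H N) (J := linfunctor_id (R j)) (@Th j).

Lemma ThetaE (K K' : ab (M j)) (m : mor K K') :
  chv (fh Theta m) = ih_map (Th K) (Th K') (m : mor (K : R j) K').
Proof. by []. Qed.

Lemma ih_mono_mono (K : ab (M j)) :
  monomorphism (ih_map (Th K) (H (abX K)) (ab_can K)).
Proof. by have [] := ThP K. Qed.

(** By [ih_map_emb_surj] the composite of [w] with the inclusion into Hom(N,K'_0) comes from a map K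
    -> K'_0. By [ih_map_emb_inj] the copresentation of [K'] kills this map, so it lifts to [K']. *)
Lemma Theta_ff : fully_faithful Theta.
Proof.
move=> K K' w.
have [mz _ lift] := ab_can_kernel K'.
have [m mE] : exists m : mor (K : R j) (ab_emb (M j) (abX K')),
    ih_map (Th K) (H (abX K')) m = ih_map (Th K') (H (abX K')) (ab_can K') \oc chv w.
  apply: ih_map_emb_surj.
  by apply: comod_morphism_cmp (chvP w); apply: ih_mapP.
have [b|m' m'E] := lift _ m.
  apply: (@ih_map_emb_inj _ (Th K)).
  have [cz _ _] := ThP K'.
  rewrite -(ih_map_cmp _ (H (abX K'))) mE cmpA [X in X \oc _](cz b) cmp0l.
  by apply: ih_inj; rewrite bh0l cmp0l ih_mapE cmp0r.
exists m'; split.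
  apply: comod_hom_inj; apply: (@ih_mono_mono K').
  by rewrite -mE ThetaE ih_map_cmp m'E.
move=> m'' mw; have m''E : ih_map (Th K) (H (abX K')) m =
    ih_map (Th K) (H (abX K')) (ab_can K' \oc m'' : mor (K : R j) _).
  by rewrite mE -mw ThetaE ih_map_cmp.
by apply: (@ab_can_mono _ _ K'); rewrite m'E (ih_map_emb_inj m''E).
Qed.

Section EssentialImage.
Variable X : comod_ob A j.

Let X0 : b1 C i j := abX (cx X : ab (b1 C i j)).
Let XA : b1 B i j := bcomp (cx X) (ca A).
Let I' : b1 C i j := abX (XA : ab (b1 C i j)).
Let can : mor (cx X) (ab_emb _ X0 : b1 B i j) := ab_can (cx X : ab (b1 C i j)).
Let canXA : mor XA (ab_emb _ I' : b1 B i j) := ab_can (XA : ab (b1 C i j)).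

(* X -> X_0 A is a kernel of the X_0 A -> X_b A and of a map X_0 A -> I' A which
   extends the composite of the embedding XA -> I' A with the difference of the
   two maps XA -> XAA. *)
Lemma comod_copresentation :
  exists theta : mor (bcomp (ab_emb _ X0 : b1 B i j) (ca A))
                     (bcomp (ab_emb _ I' : b1 B i j) (ca A)),
  [/\ theta \in comod_morphism (cofree A (ab_emb _ X0)) (cofree A (ab_emb _ I')),
      theta \oc cofree_lift can = 0,
      monomorphism (cofree_lift can)
    & forall W (w : mor W (bcomp (ab_emb _ X0 : b1 B i j) (ca A))),
        (forall b, bh bcomp (fh (ab_emb _) (abf (cx X : ab (b1 C i j)) b)
           : mor (ab_emb _ X0 : b1 B i j) _) (idmor (ca A)) \oc w = 0) ->
        theta \oc w = 0 -> exists u, cofree_lift can \oc u = w].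
Proof.
(* Under the cofree adjunction the two maps XA -> XAA, given by the coaction of [X] and the
   comultiplication of [A], correspond to the two terms of [g]. *)
pose g : mor XA XA := crho X \oc cofree_counit A (cx X) - idmor XA.
pose canA : mor XA (bcomp (ab_emb _ X0 : b1 B i j) (ca A)) := bh bcomp can (idmor (ca A)).
have canA_mono : monomorphism canA by apply: ab_comp_mono; apply: ab_can_mono.
have [v' v'E] :=
  ab_emb_injective (canXA \oc g : mor (XA : ab (b1 C i j)) (ab_emb _ I')) canA_mono.
pose theta := cofree_lift (X := cofree A (ab_emb _ X0))
  (v' : mor (bcomp (ab_emb _ X0 : b1 B i j) (ca A)) (ab_emb _ I' : b1 B i j)).
have thetaE : theta \oc canA = cofree_lift (X := cofree A (cx X)) (canXA \oc g).
  rewrite -v'E; refine (@cofree_lift_cmp _ B i A j (cofree A (cx X)) (cofree A (ab_emb _ X0))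
    (ab_emb _ I') v' canA _).
  exact: cofree_mapP.
have canA_rho : cofree_lift can = canA \oc crho X by [].
exists theta; split.
- exact: (@cofree_liftP _ B i A j (cofree A (ab_emb _ X0)) (ab_emb _ I') v').
- rewrite canA_rho cmpA thetaE.
  rewrite (cofree_lift_cmp _ (crho_morphism X)) -cmpA.
  rewrite cmpDl cmpNl -cmpA crho_counitE cmp1r cmp1l subrr cmp0r.
  by rewrite /cofree_lift bh0l cmp0l.
- rewrite canA_rho; apply: mono_cmp canA_mono _.
  by apply: split_mono (crho_counitE X).
- move=> W w wb tw.
  have [_ _ lift] := ab_comp_kernel (ca A : ab (b1 C i i))
    (ab_can_kernel (cx X : ab (b1 C i j))).
  have [u uE] := lift _ w wb.
  exists (cofree_counit A (cx X) \oc u); rewrite canA_rho -uE -cmpA; congr (_ \oc _).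
  (* [theta] kills [w], which is [canA \oc u]; the transpose of this equation says that [u] is its
     own image under the coaction after the counit, the factorization sought. *)
  have gu : g \oc u = 0.
    apply: (@ab_can_mono _ _ (XA : ab (b1 C i j))); rewrite cmp0r.
    have := congr1 (fun f => cofree_counit A (ab_emb _ I') \oc f) tw.
    rewrite cmp0r -uE -[X in theta \oc X]/(canA \oc u) (cmpA theta) thetaE cmpA.
    by rewrite (cofree_lift_counit (X := cofree A (cx X))) -cmpA.
  by move: gu; rewrite cmpDl cmpNl cmp1l -cmpA => /subr0_eq.
Qed.

(** The copresentation of [X] lifts to [M]: [K] has first component X_0 N, with maps to the X_b N
    and a map [t] to I'N that corresponds to [theta]. Up to [kappa], Hom(N,K) and [X] are kernels of
    the same maps. *)
Lemma Theta_es : exists K : ab (M j), inhabited (iso (Theta K) (X : comod_cat A j)).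
Proof.
have [theta [thetaP theta_can can_mono can_lift]] := comod_copresentation.
pose Z0 := ractn M X0 N; pose Z' := ractn M I' N.
have kV : isoV (kappa X0) \in comod_morphism (cofree A (ab_emb _ X0 : b1 B i j))
    (ih_comod (H N) (H Z0)).
  exact: comod_isoVP (kappaP X0).
have kV' : isoV (kappa I') \in comod_morphism (cofree A (ab_emb _ I' : b1 B i j))
    (ih_comod (H N) (H Z')).
  exact: comod_isoVP (kappaP I').
have [t tE] : exists t : mor Z0 Z',
    ih_map (H Z0) (H Z') (fh (ab_emb (M j)) t) = isoV (kappa I') \oc (theta \oc kappa X0).
  have [|t' t'E] := @ih_map_emb_surj (ab_emb (M j) Z0) (H Z0) Z'
    (isoV (kappa I') \oc (theta \oc kappa X0)); last first.
    by have [t tE] := ab_emb_full t'; exists t; rewrite -tE.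
  by apply: comod_morphism_cmp kV' _; apply: comod_morphism_cmp thetaP _; apply: kappaP.
pose Y (s : 'I_(abk (cx X : ab (b1 C i j))) + 'I_1) : M j :=
  match s with inl b => ractn M (abY (cx X : ab (b1 C i j)) b) N | inr _ => Z' end.
pose f (s : 'I_(abk (cx X : ab (b1 C i j))) + 'I_1) : mor Z0 (Y s) :=
  match s with
  | inl b => bh (ractn M) (abf (cx X : ab (b1 C i j)) b) (idmor N)
  | inr _ => t
  end.
pose K : ab (M j) := AbOb (fun c => f (split c)).
exists K.
pose x : mor (cx X) (ihob (H Z0)) := isoV (kappa X0) \oc cofree_lift can.
have xP : x \in comod_morphism X (ih_comod (H N) (H Z0)).
  by apply: comod_morphism_cmp kV _; apply: cofree_liftP.
(* Through [kappa], each [f s] becomes the corresponding map in the copresentation of [X]. *)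
have fE s : ih_map (H Z0) (H (Y s)) (fh (ab_emb (M j)) (f s)) \oc isoV (kappa X0) =
  match s return mor _ (ihob (H (Y s))) with
  | inl b => isoV (kappa (abY (cx X : ab (b1 C i j)) b)) \oc
      bh bcomp (fh (ab_emb _) (abf (cx X : ab (b1 C i j)) b)
           : mor (ab_emb _ X0 : b1 B i j) _) (idmor (ca A))
  | inr _ => isoV (kappa I') \oc theta
  end.
  case: s => [b|a].
    apply: (iso_injl (u := kappa (abY (cx X : ab (b1 C i j)) b))).
    rewrite [RHS]cmpA isomK cmp1l [LHS]cmpA.
    by rewrite [X in X \oc _]kappa_nat -cmpA isomK cmp1r.
  by rewrite [X in X \oc _]tE -!cmpA isomK cmp1r.
have kx : joint_kernel (@ih_copres k C M i N H j K) x.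
  split.
  - move=> c.
    change (ih_map (H Z0) (H (Y (split c))) (fh (ab_emb (M j)) (f (split c))) \oc x = 0).
    move: (split c) => s; rewrite /x cmpA fE; case: s => [b|a].
      have [fcan _ _] := ab_can_kernel (cx X : ab (b1 C i j)).
      rewrite -cmpA [X in _ \oc X]cmpA -bh_cmpl [X in bh _ X _](fcan b).
      by rewrite bh0l cmp0l cmp0r.
    by rewrite -cmpA theta_can cmp0r.
  - by apply: mono_cmp can_mono; apply: (iso_mono (iso_sym (kappa X0))).
  - move=> W w wc.
    have ws s : ih_map (H Z0) (H (Y s)) (fh (ab_emb (M j)) (f s)) \oc w = 0.
      rewrite -[s]unsplitK; exact: wc (unsplit s).
    have wE : w = isoV (kappa X0) \oc (kappa X0 \oc w) by rewrite cmpA isoVK cmp1l.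
    have [b||u uE] := can_lift _ (kappa X0 \oc w).
    + apply: (iso_injl (u := iso_sym (kappa (abY (cx X : ab (b1 C i j)) b)))).
      by rewrite cmpA -(fE (inl b)) -cmpA -wE (ws (inl b)) cmp0r.
    + apply: (iso_injl (u := iso_sym (kappa I'))).
      by rewrite cmpA -(fE (inr ord0)) -cmpA -wE (ws (inr ord0)) cmp0r.
    + by exists u; rewrite /x -cmpA uE -wE.
have [u uE] := joint_kernel_unique (ThP K) kx.
(* So far [u] is an isomorphism of 1-morphisms only; its compatibility with the coactions is tested
   after the monomorphism [x]. *)
have uP : isomor u \in comod_morphism (ih_comod (H N) (Th K)) X.
  apply: (comod_morphism_lift xP).
    by rewrite uE; apply: ih_mapP.
  by apply: ab_comp_mono; case: kx.
by split; apply: (comod_iso uP).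
Qed.

End EssentialImage.
End AtObject.
End Comparison.

(** * The comparison as a morphism of 2-representations *)

Section ThetaMorphism.
Variables (k : fieldType) (C : bicat k) (M : tworep C) (hC : fiat C).
Variables (i : C) (N : M i).
Let B := ab_bicat C.
Let R := ab_rep M.
Let N' : R i := ab_emb (M i) N.
Variable HN : @inthom k B R i i N' N'.
Let A := ih_coalg HN.
Variable Th : forall (j : C) (K : ab (M j)), @inthom k B R i j N' K.

Let S := ab_rep_res M.
Let S' := comod_rep_res A.

(* Valued in [comod_cat]: comparing [comod_rep A j] with [comod_rep_res A j] directly,
   rather than through [comod_cat A j], takes the kernel minutes. *)
Definition Theta_cat (j : C) : linfunctor (ab (M j)) (comod_cat A j) :=
  theta HN (J := linfunctor_id (R j)) (@Th j).

Definition Theta_fun (j : C) : linfunctor (S j) (S' j) := Theta_cat j.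

(** Adjoints make [ih_act] invertible. Only the underlying 2-morphism is recorded, because the
    coherence conditions are checked there. *)
Lemma Theta_mi_exists (j l : C) (F : b1 C j l) (X : S j) :
  exists u : iso (Theta_fun l (ractn S F X)) (ractn S' F (Theta_fun j X)),
    chv (isomor u) = ih_act (F := ab_emb _ F : b1 B j l) (Th X) (Th (ractn S F X)).
Proof.
have [u uE] := ih_act_iso_exists hC (F := F) (Th X) (Th (ractn S F X)).
have uP : isomor u \in comod_morphism (ih_comod HN (Th (ractn S F X)))
    (comod_act_ob (ab_emb _ F : b1 B j l) (ih_comod HN (Th X)) : comod_ob A l).
  by rewrite uE; apply: ih_act_comod.
by exists (comod_iso uP).
Qed.

Definition Theta_mi (j l : C) (F : b1 C j l) (X : S j) := sval (cid (Theta_mi_exists F X)).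

Lemma Theta_miE (j l : C) (F : b1 C j l) (X : S j) :
  chv (isomor (Theta_mi F X)) =
  ih_act (F := ab_emb _ F : b1 B j l) (Th X) (Th (ractn S F X)).
Proof. exact: svalP (cid (Theta_mi_exists F X)). Qed.

Lemma Theta_mi_nat (j l : C) (F G : b1 C j l) (X Y : S j) (f : mor F G) (x : mor X Y) :
  Theta_mi G Y \oc fh (Theta_fun l) (bh (ractn S) f x) =
  bh (ractn S') f (fh (Theta_fun j) x) \oc Theta_mi F X.
Proof.
apply: comod_hom_inj.
change (chv (isomor (Theta_mi G Y)) \oc
  ih_map (Th (ractn S F X)) (Th (ractn S G Y)) (bh (ractn R) (fh (ab_emb _) f) x) =
  bh bcomp (fh (ab_emb _) f : mor (ab_emb _ F : b1 B j l) _) (ih_map (Th X) (Th Y) x) \oc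
  chv (isomor (Theta_mi F X))).
by rewrite !Theta_miE; apply: ih_act_nat.
Qed.

Lemma Theta_mi_comp (j l m : C) (F : b1 C l m) (G : b1 C j l) (X : S j) :
  Theta_mi (bcomp F G) X \oc fh (Theta_fun m) (rasc S F G X) =
  rasc S' F G (Theta_fun j X)
    \oc (bh (ractn S') (idmor F) (Theta_mi G X) \oc Theta_mi F (ractn S G X)).
Proof.
apply: comod_hom_inj.
pose F' : b1 B l m := ab_emb _ F; pose G' : b1 B j l := ab_emb _ G.
pose p : mor (bcomp F' G') (ab_emb _ (bcomp F G) : b1 B j m) := pf_comp (ab_pfun C) F G.
change (chv (isomor (Theta_mi (bcomp F G) X)) \oc
  ih_map (Th (ractn S F (ractn S G X))) (Th (ractn S (bcomp F G) X))
    (bh (ractn R) p (idmor (X : R j)) \oc rasc R F' G' X) =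
  (bh bcomp p (idmor (ihob (Th X))) \oc basc F' G' (ihob (Th X))) \oc
  (bh bcomp (fh (ab_emb _) (idmor F) : mor F' F') (chv (isomor (Theta_mi G X))) \oc
   chv (isomor (Theta_mi F (ractn S G X))))).
(* Naturality of [ih_act] moves the structural isomorphism [p] of the embedding to the outside,
   which leaves the coherence for [F'] and [G']. *)
rewrite !Theta_miE fh_id -(ih_map_cmp _ (Th (ractn R (bcomp F' G') X))).
rewrite cmpA (ih_act_nat p (idmor (X : R j)) (Th X) _ (Th X)) ih_map_id.
rewrite -[LHS]cmpA -[RHS]cmpA; congr (_ \oc _).
exact: (@ih_act_comp k B R i N' j l m F' G' X (Th X) (Th (ractn R G' X))
  (Th (ractn R F' (ractn R G' X))) (Th (ractn R (bcomp F' G') X))).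
Qed.

Lemma Theta_mi_unit (j : C) (X : S j) :
  run S' (Theta_fun j X) \oc Theta_mi (bunit C j) X = fh (Theta_fun j) (run S X).
Proof.
apply: comod_hom_inj.
change ((blun (ihob (Th X)) \oc bh bcomp (idmor (bunit B j)) (idmor (ihob (Th X)))) \oc
    chv (isomor (Theta_mi (bunit C j) X)) =
  ih_map (Th (ractn S (bunit C j) X)) (Th X)
    (run R X \oc bh (ractn R) (idmor (bunit B j)) (idmor (X : R j)))).
rewrite Theta_miE !bh_id !cmp1r.
exact: ih_act_unit.
Qed.

Definition Theta_rep : repmor S S' :=
  @RepMor k C S S' Theta_fun Theta_mi Theta_mi_nat Theta_mi_comp Theta_mi_unit.

Variable H : forall (j : C) (X : M j), ihom N X.

(** On embedded objects [Th] and [H] represent the same functor; the identity induces the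
    isomorphism between them. *)
Lemma ih_unique_iso_nat j (X Y : M j) (f : mor X Y) :
  ih_map (Th (ab_emb _ Y)) (H Y) (idmor (ab_emb (M j) Y)) \oc
    ih_map (Th (ab_emb _ X)) (Th (ab_emb _ Y)) (fh (ab_emb (M j)) f) =
  ih_map (H X) (H Y) (fh (ab_emb (M j)) f) \oc
    ih_map (Th (ab_emb _ X)) (H X) (idmor (ab_emb (M j) X)).
Proof. by rewrite !ih_map_cmp cmp1l cmp1r. Qed.

Definition emb_theta j : linfunctor (M j) (comod_cat A j) :=
  theta HN (J := ab_emb (M j) : linfunctor (M j) (R j)) (@H j).

Lemma Theta_emb_iso_exists j (X : M j) :
  exists u : iso (Theta_cat j (ab_emb (M j) X) : comod_cat A j) (emb_theta j X),
    chv (isomor u) = ih_map (Th (ab_emb (M j) X)) (H X) (idmor (ab_emb (M j) X)).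
Proof.
have uP : isomor (ih_map_iso (Th (ab_emb (M j) X)) (H X) (iso_id (ab_emb (M j) X)))
  \in comod_morphism (ih_comod HN (Th (ab_emb (M j) X))) (ih_comod HN (H X)).
  exact: ih_mapP.
by exists (comod_iso uP).
Qed.

Definition Theta_emb_iso j (X : M j) := sval (cid (Theta_emb_iso_exists X)).

Lemma Theta_emb_isoE j (X : M j) : chv (isomor (Theta_emb_iso X)) =
  ih_map (Th (ab_emb (M j) X)) (H X) (idmor (ab_emb (M j) X)).
Proof. exact: svalP (cid (Theta_emb_iso_exists X)). Qed.

Lemma Theta_emb_iso_nat j (X Y : M j) (f : mor X Y) :
  Theta_emb_iso Y \oc fh (Theta_cat j) (fh (ab_emb (M j)) f) =
  fh (emb_theta j) f \oc Theta_emb_iso X.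
Proof.
apply: comod_hom_inj.
change (chv (isomor (Theta_emb_iso Y)) \oc
    ih_map (Th (ab_emb _ X)) (Th (ab_emb _ Y)) (fh (ab_emb (M j)) f) =
  ih_map (H X) (H Y) (fh (ab_emb (M j)) f) \oc chv (isomor (Theta_emb_iso X))).
rewrite !Theta_emb_isoE; exact: ih_unique_iso_nat.
Qed.

Lemma Theta_rep_emb j :
  nat_isomorphic (linfunctor_comp (Theta_cat j) (ab_emb (M j))) (emb_theta j).
Proof.
exists (@Theta_emb_iso j); exact: Theta_emb_iso_nat.
Qed.

End ThetaMorphism.

(** * Restriction to injective objects *)

Section Restriction.
Variables (k : fieldType).

(** [F] reflects injectivity, and the injective objects of the abelianization come from [A]. *)
Lemma injective_essential_image (A D : lincat k) (hA : finitary_cat A) (F : linfunctor (ab A) D) :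
  fully_faithful F -> essentially_surjective F ->
  forall (Y : D), injective_ob Y -> exists X : A, inhabited (iso (F (ab_emb A X)) Y).
Proof.
move=> ffF esF Y inY; have [P [u]] := esF Y.
have inP : injective_ob P.
  by apply: (ff_es_reflect_injective ffF esF); apply: injective_iso (iso_sym u) inY.
have [X [v]] := ab_injective_emb hA inP.
by exists X; split; apply: iso_comp u (fh_iso F v).
Qed.

Lemma comp_emb_ff (A D : lincat k) (F : linfunctor (ab A) D) :
  fully_faithful F -> fully_faithful (linfunctor_comp F (ab_emb A)).
Proof.
move=> ffF X Y g; have [m mE] := @ff_full _ _ _ F (ab_emb A X) (ab_emb A Y) g ffF.
have [f fE] := ab_emb_full m.
exists f; split; first by rewrite -mE fE.
move=> f' f'E; apply: ab_emb_faithful; apply: (ff_faithful ffF).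
by rewrite -fE mE -f'E.
Qed.

Lemma corestrict_ff (C : bicat k) (S R : tworep C) (P : forall i, R i -> Prop)
    (P_act : forall i j (F : b1 C i j) (X : R i), P i X -> P j (ractn R F X))
    (Phi : repmor S R) (P_Phi : forall i (X : S i), P i (Phi i X)) j :
  fully_faithful (Phi j) -> fully_faithful (corestrict P_act P_Phi j).
Proof. by move=> ffPhi X Y g; apply: (ffPhi X Y g). Qed.

Lemma corestrict_es (C : bicat k) (S R : tworep C) (P : forall i, R i -> Prop)
    (P_act : forall i j (F : b1 C i j) (X : R i), P i X -> P j (ractn R F X))
    (Phi : repmor S R) (P_Phi : forall i (X : S i), P i (Phi i X)) j :
  (forall Y, P j Y -> exists X, inhabited (iso (Phi j X) Y)) ->
  essentially_surjective (corestrict P_act P_Phi j).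
Proof.
move=> esPhi Y; have [X [u]] := esPhi _ (svalP Y); exists X; split.
exact: (@fullsub_iso k (R j) (P j) (exist _ (Phi j X) (P_Phi j X)) Y u).
Qed.

Lemma ff_es_restrict (C : bicat k) (hC : fiat C) (M S : tworep C) (hM : finitary_rep M)
    (Phi : repmor (ab_rep_res M) S) :
  (forall j, fully_faithful (Phi j)) -> (forall j, essentially_surjective (Phi j)) ->
  exists hInj : forall (j : C) (X : M j),
      injective_ob (repmor_comp Phi (ab_unit_mor M) j X),
    rep_equivalence (corestrict_inj hC hInj).
Proof.
move=> ff es.
have hInj j (X : M j) : injective_ob (repmor_comp Phi (ab_unit_mor M) j X).
  exact: (ff_es_injective (ff j) (es j) (ab_emb_injective (X := X))).
exists hInj => j; apply: ff_es_equivalence.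
  apply: corestrict_ff; exact: (comp_emb_ff (ff j)).
apply: corestrict_es => Y inY.
exact: (injective_essential_image (hM j) (ff j) (es j) inY).
Qed.

End Restriction.

(** * The equivalence and its restriction *)

Section Main.
Variables (k : fieldType) (C : bicat k) (M : tworep C) (hC : fiat C).
Variables (i : C) (N : M i).
Hypothesis H : forall (j : C) (X : M j), ihom N X.
Hypothesis retractN : forall (j : C) (Z : M j),
  exists (F : b1 C i j) (s : mor Z (ractn M F N)) (r : mor (ractn M F N) Z),
    r \oc s = idmor Z.
Let Th (j : C) (K : ab (M j)) := sval (cid (ih_kernel_exists H K)).
Let ThP (j : C) (K : ab (M j)) : joint_kernel (@ih_copres k C M i N H j K)
    (ih_map (Th K) (H (abX K)) (ab_can K)) :=
  svalP (cid (ih_kernel_exists H K)).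

Definition comparison : repmor (ab_rep_res M) (comod_rep_res (ih_coalg (H N))) :=
  Theta_rep hC (H N) Th.

Lemma comparison_equivalence (hM : finitary_rep M) :
  exists Phi : repmor (ab_rep_res M) (comod_rep_res (ih_coalg (H N))),
    (forall j : C,
       left_exact (Phi j) /\
       nat_isomorphic (linfunctor_comp
           (Phi j : linfunctor (ab (M j)) (comod_cat (ih_coalg (H N)) j)) (ab_emb (M j)))
         (emb_theta (H N) H j)) /\
    rep_equivalence Phi /\
    exists hInj : forall (j : C) (X : M j),
        injective_ob (repmor_comp Phi (ab_unit_mor M) j X),
      rep_equivalence (corestrict_inj hC hInj).
Proof.
have ff j : fully_faithful (comparison j) := Theta_ff hC retractN ThP (j := j).
have es j : essentially_surjective (comparison j) := Theta_es hC retractN ThP (j := j).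
exists comparison; split; [|split].
- move=> j; split; last exact: Theta_rep_emb.
  exact: ff_es_left_exact (ff j) (es j).
- by move=> j; apply: ff_es_equivalence.
- exact: ff_es_restrict.
Qed.

End Main.

(** Transitivity enters through [transitive_retract], which presents each object of [M] as a retract
    of some FN. *)
Lemma transitive_comparison (k : fieldType) (C : bicat k) (hC : fiat C) (M : tworep C)
    (hM : finitary_rep M) (hT : transitive_rep M) (i : C) (N : M i) (hN : ~ is_zero N)
    (H : forall (j : C) (X : M j), ihom N X) :
  exists Phi : repmor (ab_rep_res M) (comod_rep_res (ih_coalg (H i N))),
    (forall j : C,
       left_exact (Phi j) /\
       nat_isomorphic (linfunctor_comp
           (Phi j : linfunctor (ab (M j)) (comod_cat (ih_coalg (H i N)) j)) (ab_emb (M j)))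
         (emb_theta (H i N) H j)) /\
    rep_equivalence Phi /\
    exists hInj : forall (j : C) (X : M j),
        injective_ob (repmor_comp Phi (ab_unit_mor M) j X),
      rep_equivalence (corestrict_inj hC hInj).
Proof.
have [_ fC _] := hC.
exact: (comparison_equivalence hC H (transitive_retract fC hM hT hN) hM).
Qed.

Theorem theorem4p7 (k : closedFieldType) (C : bicat k) (hC : fiat C)
    (M : tworep C) (hMstrict : strict_rep M) (hMfin : finitary_rep M)
    (hMtrans : transitive_rep M)
    (i : C) (N : M i) (hN : ~ is_zero N)
    (H : forall (j : C) (X : M j), ihom N X) :
  let A := ih_coalg (H i N) in
  exists Phi : repmor (ab_rep_res M) (comod_rep_res A),
    (forall j : C,
       left_exact (Phi j) /\
       nat_isomorphic (linfunctor_comp (Phi j) (ab_emb (M j)))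
                      (theta (H i N) (J := ab_emb (M j)) (H j))) /\
    rep_equivalence Phi /\
    exists hInj : forall (j : C) (X : M j),
        injective_ob (repmor_comp Phi (ab_unit_mor M) j X),
      rep_equivalence (corestrict_inj hC hInj).
Proof.
exact: (transitive_comparison hC hMfin hMtrans hN H).
Qed.
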